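(* Let $f:\mathbb{A}\to\mathbb{A}$ be a positive twist map that preserves the Lebesgue measure. Let $U\subset\mathbb{A}$ be a nonempty $f$-periodic non essential open set of finite Lebesgue measure. Then the set of points of $U$ of negative asymptotic torsion is dense in $U$ and has positive Lebesgue measure.
   Context: Notation: $\mathbb{T}=\mathbb{R}/\mathbb{Z}$, $\mathbb{A}=\mathbb{T}\times\mathbb{R}$ with the standard Riemannian metric and standard trivialization of its tangent bundle, Lebesgue measure on $\mathbb{A}$ is the one associated with $dx\wedge dy$, $\pi:\mathbb{R}^2\to\mathbb{A}$, $\pi(x,y)=(x+\mathbb{Z},y)$; a lift of $f$ is a (continuous) map $F:\mathbb{R}^2\to\mathbb{R}^2$ with $\pi\circ F=f\circ\pi$; $p_1,p_2$ are the coordinate projections. A positive twist map is a $\mathcal{C}^1$ diffeomorphism $f:\mathbb{A}\to\mathbb{A}$ isotopic to the identity such that for any lift $F$ of $f$ and any $x\in\mathbb{R}$ the function $y\mapsto p_1\circ F(x,y)$ is an increasing diffeomorphism of $\mathbb{R}$. An essential curve is a topological embedding $\gamma:\mathbb{T}\to\mathbb{A}$ that is not homotopic to a point. An open subset of $\mathbb{A}$ is essential if it contains an essential curve, and non essential otherwise. A set $U$ is $f$-periodic if $f^M(U)=U$ for some integer $M\ge1$. Torsion: $T^1\mathbb{A}$ is the bundle of half-lines (non-zero tangent vectors modulo positive scaling). $v$ denotes the class of the vertical vector $(0,1)$ at any point. For $w,w'\in T^1_z\mathbb{A}$, $\prec(w,w')\in\mathbb{T}$ is the oriented (counterclockwise)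 angle from $w$ to $w'$ divided by $2\pi$, and $\theta(z,w)=\prec(v,w)$. For a continuous path $\gamma:[0,1]\to T^1\mathbb{A}$, $\int_\gamma d\theta=\Theta(1)-\Theta(0)$, where $\Theta:[0,1]\to\mathbb{R}$ is a continuous lift of $\theta\circ\gamma$. Let $(f_t)_{t\in[0,1]}$ be an isotopy in $\mathrm{Diff}^1(\mathbb{A})$ from the identity to $f$, extended to $t\ge 0$ by $f_{1+t}=f_t\circ f_1$. For $n\ge 1$, $DI^n(z,w)$ is the path $[0,1]\ni t\mapsto (f_{nt}(z),Df_{nt}(z)w)\in T^1\mathbb{A}$; the number $\int_{DI^n(z,w)}d\theta$ does not depend on the chosen isotopy. Set $\mathrm{Torsion}_n(f,z,w)=\frac1n\int_{DI^n(z,w)}d\theta$. The asymptotic torsion at $z$ is, whenever the limit exists, $\mathrm{Torsion}(f,z)=\lim_{n\to+\infty}\mathrm{Torsion}_n(f,z,w)$ (independent of $w\in T^1_z\mathbb{A}$). *)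

(* Defs.v *)
From HB Require Import structures.
From mathcomp Require Import all_boot all_order all_algebra.
From mathcomp Require Import archimedean generic_quotient.
From mathcomp Require Import all_classical all_reals all_analysis.

Set Implicit Arguments.
Unset Strict Implicit.
Unset Printing Implicit Defensive.

Import Order.TTheory GRing.Theory Num.Theory.
Import numFieldNormedType.Exports.

Local Open Scope classical_set_scope.
Local Open Scope ring_scope.
Local Open Scope quotient_scope.

Section Circle.
Context {R : realType}.

Definition congr_Z (x y : R) : bool := x - y \is a Num.int.

Lemma congr_Z_refl : reflexive congr_Z.
Proof. by move=> x; rewrite /congr_Z subrr rpred0. Qed.

Lemma congr_Z_sym : symmetric congr_Z.
Proof. by move=> x y; rewrite /congr_Z -opprB rpredN. Qed.

Lemma congr_Z_trans : transitive congr_Z.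
Proof.
move=> y x z; rewrite /congr_Z => xy yz.
by rewrite -(subrK y x) -addrA rpredD.
Qed.

Canonical congr_Z_equiv :=
  EquivRel congr_Z congr_Z_refl congr_Z_sym congr_Z_trans.

End Circle.

Definition circle (R : realType) : Type :=
  quotient_topology {eq_quot (@congr_Z_equiv R)}.

HB.instance Definition _ (R : realType) := Quotient.copy (circle R)
  (quotient_topology {eq_quot (@congr_Z_equiv R)}).
HB.instance Definition _ (R : realType) := PointedTopological.copy (circle R)
  (quotient_topology {eq_quot (@congr_Z_equiv R)}).

(* [R^o] is [R] seen as a normed module over itself, so that the plane is a
   normed space in which differentials make sense. *)
Notation plane R := (R^o * R^o)%type.

Notation annulus R := (circle R * R^o)%type.

Section Smooth.
Context {R : realType} {V W : normedModType R}.

(* Only used for V of finite dimension, where continuity of p |-> 'd g p in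
   operator norm is the same as pointwise continuity. *)
Definition C1 (g : V -> W) : Prop :=
  (forall p, differentiable g p) /\ (forall u, continuous (fun p => 'd g p u)).

End Smooth.

Definition C1_diffeo (R : realType) (V W : normedModType R) (g : V -> W) :=
  exists h : W -> V, [/\ cancel g h, cancel h g, C1 g & C1 h].

Section Annulus.
Context {R : realType}.
Local Notation T := (circle R).
Local Notation A := (annulus R).
Local Notation P := (plane R).

Definition circle_proj (x : R) : T := \pi_T x.

Definition annulus_proj (p : P) : A := (circle_proj p.1, p.2).

Definition is_lift (f : A -> A) (F : P -> P) : Prop :=
  continuous F /\ (forall p, annulus_proj (F p) = f (annulus_proj p)).

(* A map of A is C^1 iff it has a C^1 lift, annulus_proj being the smooth
   universal covering. *)
Definition annulus_C1 (f : A -> A) : Prop :=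
  exists2 F : P -> P, is_lift f F & C1 F.

Definition annulus_C1_diffeo (f : A -> A) : Prop :=
  exists g : A -> A, [/\ cancel f g, cancel g f, annulus_C1 f & annulus_C1 g].

(* Df(z) in the standard trivialization of TA.  Two lifts of f differ by a
   constant in Z x {0}, so neither the lift nor the representative of z
   matters. *)
Definition tangent_map (f : A -> A) (z : A) (w : P) : P :=
  'd (xget (fun=> 0) [set F : P -> P | is_lift f F] : P -> P)
     ((repr z.1, z.2) : P) w.

(* A continuous path in Diff^1(A), for the compact-open C^1 topology, from the
   identity to f. *)
Definition isotopy_from_id (I : R -> A -> A) (f : A -> A) : Prop :=
  [/\ forall t, 0 <= t <= 1 -> annulus_C1_diffeo (I t),
      I 0 = id,
      I 1 = f,
      {within [set q : R * A | 0 <= q.1 <= 1],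
        continuous (fun q : R * A => I q.1 q.2)} &
      forall u : P, {within [set q : R * A | 0 <= q.1 <= 1],
        continuous (fun q : R * A => tangent_map (I q.1) q.2 u)} ].

Definition isotopic_to_id (f : A -> A) : Prop :=
  exists I, isotopy_from_id I f.

Definition positive_twist_map (f : A -> A) : Prop :=
  [/\ annulus_C1_diffeo f,
      isotopic_to_id f &
      forall F : P -> P, is_lift f F -> forall x : R,
        let g := fun y : R^o => (F (x, y)).1 in
        C1_diffeo g /\ {homo g : y y' / y < y'} ].

Definition annulus_borel : set (set A) := <<s [set B : set A | open B] >>.

(* The area form dx /\ dy, computed on the fundamental domain [0, 1[ x R. *)
Definition annulus_lebesgue (B : set A) : \bar R :=
  (@lebesgue_measure R \x @lebesgue_measure R)%E
    [set p : R * R | 0 <= p.1 < 1 /\ B (annulus_proj p)].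

Definition preserves_lebesgue (f : A -> A) : Prop :=
  forall B, annulus_borel B -> annulus_lebesgue (f @^-1` B) = annulus_lebesgue B.

Definition topological_embedding (X Y : topologicalType) (c : X -> Y) : Prop :=
  [/\ injective c, continuous c &
      forall O : set X, open O -> exists2 O' : set Y, open O' & O = c @^-1` O'].

Definition homotopic_to_point (c : T -> A) : Prop :=
  exists H : R * T -> A,
    [/\ {within [set q : R * T | 0 <= q.1 <= 1], continuous H},
        forall s, H (0, s) = c s &
        exists z, forall s, H (1, s) = z].

Definition essential_curve (c : T -> A) : Prop :=
  topological_embedding c /\ ~ homotopic_to_point c.

Definition essential (U : set A) : Prop :=
  exists2 c : T -> A, essential_curve c & range c `<=` U.

Definition periodic_set (f : A -> A) (U : set A) : Prop :=
  exists2 M : nat, (1 <= M)%N & iter M f @` U = U.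

Definition rotate (a : R) (w : P) : P :=
  (cos (2 * pi * a) * w.1 - sin (2 * pi * a) * w.2,
   sin (2 * pi * a) * w.1 + cos (2 * pi * a) * w.2).

(* Half-lines of T^1_z A are represented by nonzero vectors.  The angle is a
   class modulo Z, so the chosen representative is irrelevant. *)
Definition oriented_angle (w w' : P) : T :=
  circle_proj (xget 0 [set a | exists2 r : R, 0 < r & w' = r *: rotate a w]).

Definition theta (w : P) : T := oriented_angle ((0, 1) : P) w.

(* The value does not depend on the lift Th, two lifts on [0, 1] differing by
   an integer constant. *)
Definition path_variation (c : R -> T) : R :=
  xget 0 [set Th 1 - Th 0 | Th in
    [set Th : R -> R | {within [set t | 0 <= t <= 1], continuous Th} /\
                       forall t, 0 <= t <= 1 -> circle_proj (Th t) = c t]].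

(* f_(k + s) = f_s \o f_1^k for k : nat and 0 <= s < 1. *)
Definition extend_isotopy (I : R -> A -> A) (t : R) (z : A) : A :=
  I (t - (Num.truncn t)%:R) (iter (Num.truncn t) (I 1) z).

Definition torsion_n (I : R -> A -> A) (n : nat) (z : A) (w : P) : R :=
  n%:R^-1 * path_variation
    (fun t => theta (tangent_map (extend_isotopy I (n%:R * t)) z w)).

(* tau is the asymptotic torsion of f at z: the limit exists and equals tau,
   whatever the isotopy and the tangent direction. *)
Definition is_torsion (f : A -> A) (z : A) (tau : R) : Prop :=
  isotopic_to_id f /\
  forall I, isotopy_from_id I f -> forall w : P, w <> 0 ->
    torsion_n I n z w @[n --> \oo] --> tau.

Definition negative_torsion (f : A -> A) : set A :=
  [set z | exists2 tau, tau < 0 & is_torsion f z tau].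

End Annulus.

(* Main.v *)
(* The twist condition makes the image of the vertical direction turn clockwise,
   by less than half a turn at each step, so the torsion at z is
   - lim m_n(z) / 2n, where m_n(z) counts half turns and is read off the signs of
   the first coordinates of Df^k(z)(0, 1), k <= n.  As m_n is additive along
   orbits up to 1, Birkhoff averages of m_K show that the limit exists almost
   everywhere on U.  By recurrence the torsion is negative at almost every point
   where some Df^n sends the vertical to the left, so it remains to find such a
   point in every nonempty open V included in U.

   Otherwise V lifts a square B and, slightly to the left above it, a square B'
   such that every positive iterate of a lift F of f puts all of B' to the right
   of all of B.  The products f^(Mn)(B) x f^(Mn)(B') have a constant positive
   measure inside U x U, so two of them meet: some iterate of F brings a point of
   B back to B and a point of B' back to B', up to integer translations.  These
   two translations are equal, for otherwise a connected subset of the lift of U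
   contains two translates of one point and U contains an essential polygonal
   curve.  So the order of B and B' is both kept and reversed. *)
Require Import Defs.
From HB Require Import structures.
From mathcomp Require Import all_boot all_order all_algebra.
From mathcomp Require Import archimedean generic_quotient.
From mathcomp Require Import all_classical all_reals all_analysis.
From mathcomp Require Import measurable_realfun.
From mathcomp Require Import ring lra zify.

Set Implicit Arguments.
Unset Strict Implicit.
Unset Printing Implicit Defensive.

Import Order.TTheory GRing.Theory Num.Theory.
Import numFieldNormedType.Exports.

Local Open Scope classical_set_scope.
Local Open Scope ring_scope.

(** * Directions and angles in the plane *)

(** The twist condition speaks of f alone, so it fixes the angle of the image of the vertical only
    modulo a full turn, whereas torsion counts turns along an isotopy. The missing integer is found
    with secants: the vertical tangent vector is deformed into a vertical secant, and this one into
    horizontal secants that join a point to its translates, which no isotopy of the annulus can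
    turn. Counting half turns from the signs of derivatives of iterates of f then frees the argument
    from isotopies and makes measurability accessible. The count is additive only up to 1 at each
    junction, so Birkhoff averages are taken over blocks of length L, with an error of order 1 / L
    on the frequency, and L is sent to infinity. Recurrence is used in U x U because the two squares
    must come back under the same iterate. Essential curves are embedded by definition, hence the
    grid paths of minimal length, which cannot cross themselves. *)

Section Directions.
Context {R : realType}.
Implicit Types (t x y : R) (u v w : plane R).

(** The unit vector at a counterclockwise angle of t turns from the vertical, in accordance with
    [theta]: small positive t point to the left, small negative t to the right. *)
Definition dir t : plane R := (- sin (2 * pi * t), cos (2 * pi * t)).

Definition points_to t w := exists2 r, 0 < r & w = r *: dir t.

Definition dot u v : R := u.1 * v.1 + u.2 * v.2.

Definition det u v : R := u.1 * v.2 - u.2 * v.1.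

Lemma scaleRE (a : R) (b : R^o) : a *: b = (a : R) * b.
Proof. by []. Qed.

Lemma plane_eqP u v : u.1 = v.1 -> u.2 = v.2 -> u = v.
Proof. by case: u v => [a b] [c d] /= -> ->. Qed.

Lemma plane_eq0 u : u.1 = 0 -> u.2 = 0 -> u = 0.
Proof. by move=> *; exact: plane_eqP. Qed.

Lemma dirD x y :
  dir (x + y) = cos (2 * pi * y) *: dir x + sin (2 * pi * y) *: (- (dir x).2, (dir x).1).
Proof.
by rewrite /dir mulrDr sinD cosD; apply: plane_eqP => /=; rewrite /GRing.scale /=; ring.
Qed.

Lemma dir_half x : dir (x + 2^-1) = - dir x.
Proof.
have e : 2 * pi * 2^-1 = pi :> R by field.
by rewrite dirD e cospi sinpi scale0r addr0 scaleN1r.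
Qed.

Lemma dir1 x : dir (x + 1) = dir x.
Proof. by rewrite [1](splitr 1) mul1r addrA !dir_half opprK. Qed.

Lemma dirDnat x n : dir (x + n%:R) = dir x.
Proof.
elim: n => [|n IH]; first by rewrite addr0.
by rewrite -natr1 addrA dir1.
Qed.

Lemma dirDint x (k : R) : k \is a Num.int -> dir (x + k) = dir x.
Proof.
move=> /intrP[[n|n] ->]; first exact: dirDnat.
by rewrite NegzE mulrNz -[in RHS](subrK n.+1%:R x) dirDnat.
Qed.

Lemma dot_dir x y : dot (dir x) (dir y) = cos (2 * pi * (y - x)).
Proof. by rewrite /dot /dir /= mulrBr cosB; ring. Qed.

Lemma det_dir x y : det (dir x) (dir y) = sin (2 * pi * (y - x)).
Proof. by rewrite /det /dir /= mulrBr sinB; ring. Qed.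

Lemma dotZ a b u v : dot (a *: u) (b *: v) = a * b * dot u v.
Proof. by rewrite /dot /= /GRing.scale /=; ring. Qed.

Lemma detZ a b u v : det (a *: u) (b *: v) = a * b * det u v.
Proof. by rewrite /det /= /GRing.scale /=; ring. Qed.

Lemma dot_ge0 u : 0 <= dot u u.
Proof. by rewrite addr_ge0// -expr2 sqr_ge0. Qed.

Lemma dot_gt0 u : u != 0 -> 0 < dot u u.
Proof.
move=> u0; rewrite lt_neqAle dot_ge0 andbT eq_sym.
apply: contra u0; rewrite /dot paddr_eq0 -?expr2 ?sqr_ge0// !sqrf_eq0.
by move=> /andP[/eqP ? /eqP ?]; apply/eqP/plane_eq0.
Qed.

Lemma dir_neq0 x : dir x != 0.
Proof.
apply/eqP => e; have := dot_dir x x; rewrite e subrr mulr0 cos0.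
by rewrite /dot /= mulr0 addr0 => /esym/eqP; rewrite oner_eq0.
Qed.

Lemma points_neq0 x w : points_to x w -> w != 0.
Proof. by case=> r r0 ->; rewrite scaler_eq0 negb_or dir_neq0 gt_eqF. Qed.

Lemma sin_2pi_gt0 x : 0 < x < 2^-1 -> 0 < sin (2 * pi * x).
Proof.
have p0 := pi_gt0 R.
by move=> /andP[x0 x1]; apply: sin_gt0_pi; apply/andP; split; [|have : pi * x < pi * 2^-1 by rewrite ltr_pM2l]; nra.
Qed.

Lemma sin_2pi_lt0 x : - 2^-1 < x < 0 -> sin (2 * pi * x) < 0.
Proof.
move=> xE; rewrite -[x]opprK mulrN sinN oppr_lt0 sin_2pi_gt0//; lra.
Qed.

Lemma cos_2pi_eq1 x : cos (2 * pi * x) = 1 -> x \is a Num.int.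
Proof.
move=> h; have /andP[f0 f1] := floor_itv x.
rewrite [x](_ : _ = (Num.floor x)%:~R); first exact: intr_int.
set k := (_%:~R : R).
have ek : k \is a Num.int by exact: intr_int.
move: f0 f1; rewrite intrD -/k => f0 f1.
have : (dir (x - k)).2 = (dir x).2 by rewrite -(dirDint (x - k) ek) subrK.
rewrite /dir /= h.
have p0 := pi_gt0 R.
set y := x - k; have y0 : 0 <= y by rewrite subr_ge0.
have y1 : y < 1 by rewrite ltrBlDl.
move=> c; suff : y = 0 by move=> /eqP; rewrite subr_eq0 => /eqP.
have key (z : R) : 0 <= z <= 2^-1 -> cos (2 * pi * z) = 1 -> z = 0.
  move=> z01 cz; have : 2 * pi * z = 0.
    apply: cos_inj; rewrite ?cos0// in_itv /= ?lexx ?(ltW p0)//.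
    by apply/andP; split; [|have : pi * z <= pi * 2^-1 by rewrite ler_pM2l//; lra]; nra.
  by move/eqP; rewrite !mulf_eq0 (gt_eqF p0) pnatr_eq0 /= => /eqP.
have [yl|yl] := leP y 2^-1; first by apply: key => //; lra.
(* Beyond half a turn, the symmetry of the cosine brings 1 - y into the range of [key]; its
   vanishing contradicts y < 1. *)
have : 1 - y = 0.
  apply: key; first by lra.
  rewrite mulrBr mulr1 (_ : _ - _ = - (2 * pi * y) + pi *+ 2); last by rewrite mulr2n; ring.
  by rewrite cosD2pi cosN.
lra.
Qed.

Lemma points_uniq x y w : points_to x w -> points_to y w -> y - x \is a Num.int.
Proof.
case=> r r0 -> [s s0 e].
have hrs : r = s.
  have : dot (r *: dir x) (r *: dir x) = dot (s *: dir y) (s *: dir y) by rewrite e.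
  rewrite !dotZ !dot_dir !subrr !mulr0 cos0 !mulr1 => /eqP.
  by rewrite -!expr2 eqrXn2 ?ltW// => /eqP.
have : dir x = dir y by move: e; rewrite hrs => /scalerI; apply; rewrite gt_eqF.
move=> d; apply: cos_2pi_eq1; rewrite -dot_dir -d dot_dir subrr mulr0 cos0//.
Qed.

Lemma points_int x (k : R) w : k \is a Num.int -> points_to x w -> points_to (x + k) w.
Proof. by move=> ki [r r0 ->]; exists r => //; rewrite dirDint. Qed.

Lemma points_dir x : points_to x (dir x).
Proof. by exists 1 => //; rewrite scale1r. Qed.

Lemma pointsZ x r w : 0 < r -> points_to x w -> points_to x (r *: w).
Proof. by move=> r0 [s s0 ->]; exists (r * s); rewrite ?mulr_gt0// scalerA. Qed.

Lemma pointsN x w : points_to x w -> points_to (x + 2^-1) (- w).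
Proof. by case=> r r0 ->; exists r => //; rewrite dir_half scalerN. Qed.

Lemma points_detP x y u v : points_to x u -> points_to y v ->
  exists2 r, 0 < r & det u v = r * sin (2 * pi * (y - x)).
Proof.
move=> [r r0 ->] [s s0 ->]; exists (r * s); first exact: mulr_gt0.
by rewrite detZ det_dir.
Qed.

(** The angle from u to v in turns when the two vectors form an acute angle. Being explicit, it is
    visibly continuous in both vectors. *)
Definition increment u v : R := atan (det u v / dot u v) / (2 * pi).

Lemma points_increment x u v : points_to x u -> 0 < dot u v ->
  points_to (x + increment u v) v.
Proof.
move=> xu duv; have u0 := points_neq0 xu; have p0 := pi_gt0 R.
case: xu => r r0 uE; have d0 := dot_gt0 u0.
set a := atan (det u v / dot u v).
have ea : 2 * pi * increment u v = a by rewrite /increment mulrC divfK// mulf_neq0// gt_eqF.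
have c0 : 0 < cos a by rewrite cos_gt0_pihalf// atan_gtNpi2 atan_ltpi2.
have sa : sin a = det u v / dot u v * cos a.
  by rewrite -(atanK (det u v / dot u v)) -/a /tan divfK// gt_eqF.
exists (dot u v / dot u u * r / cos a); first by rewrite divr_gt0// mulr_gt0// divr_gt0.
rewrite dirD ea sa.
have e1 : (dir x).1 = u.1 / r by rewrite uE (_ : (r *: dir x).1 = r * (dir x).1)// mulrAC divff ?mul1r// gt_eqF.
have e2 : (dir x).2 = u.2 / r by rewrite uE (_ : (r *: dir x).2 = r * (dir x).2)// mulrAC divff ?mul1r// gt_eqF.
have c1 : cos a != 0 by rewrite gt_eqF.
have r1 : r != 0 by rewrite gt_eqF.
have := d0; rewrite lt0r => /andP[d1 _].
have := duv; rewrite lt0r => /andP[d2 _].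
move: e1 e2; case: (dir x) => [p q] /= -> ->.
rewrite /dot in d1 d2; have c2 : cos a \is a GRing.unit by rewrite unitfE.
by apply: plane_eqP; rewrite /= /GRing.scale /= /det /dot; field; rewrite ?c1 ?r1 ?d1 ?d2.
Qed.

(** [increment] from the vertical reaches the open upper half-plane; the lower one follows by a
    change of sign, and horizontal vectors are multiples of [dir 4^-1]. *)
Lemma points_exists w : w != 0 -> exists x, points_to x w.
Proof.
move=> w0; set s : plane R := (0, 1).
have ps : points_to 0 s by exists 1 => //; rewrite /dir mulr0 sin0 cos0 scale1r oppr0.
set e : plane R := (-1, 0).
have [d|d] := ltP 0 (dot s w); first by exists (0 + increment s w); exact: points_increment.
have [d2|d2] := ltP (dot s w) 0.
  have : points_to (0 + increment s (- w)) (- w).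
    by apply: points_increment => //; rewrite -scaleN1r -[s]scale1r dotZ; lra.
  by move=> /pointsN; rewrite opprK => ?; eexists; eassumption.
have w2 : w.2 = 0.
  have <- : dot s w = w.2 by transitivity (0 * w.1 + 1 * w.2 : R) => //; ring.
  by apply/eqP; rewrite eq_le d d2.
have p0 := pi_gt0 R.
have e4 : 2 * pi * 4^-1 = pi / 2 :> R by field.
have we : w = (- w.1) *: dir 4^-1.
  apply: plane_eqP; rewrite /dir /= e4 ?sin_pihalf ?cos_pihalf ?scaler0//.
  by rewrite scaleRE mulrN1 opprK.
have [n|n|n] := ltgtP w.1 0.
- by exists 4^-1, (- w.1); rewrite ?oppr_gt0.
- exists (4^-1 + 2^-1), w.1 => //; rewrite dir_half scalerN -scaleNr//.
- by move: w0; rewrite we n oppr0 scale0r eqxx.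
Qed.

Lemma points_fst_gt0 x w : points_to x w -> - 2^-1 < x < 0 -> 0 < w.1.
Proof.
by case=> r r0 -> /sin_2pi_lt0; rewrite /dir /= scalerN oppr_gt0 pmulr_rlt0.
Qed.

Lemma points_fst_lt0 x w : points_to x w -> 0 < x < 2^-1 -> w.1 < 0.
Proof.
by case=> r r0 -> /sin_2pi_gt0; rewrite /dir /= scalerN oppr_lt0 pmulr_rgt0.
Qed.

Lemma fst_points_half (k : R) x w : points_to x w -> x = k / 2 -> k \is a Num.int ->
  w.1 = 0.
Proof.
case=> r r0 -> -> /intrP[m ->].
suff e (n : nat) : sin (pi *+ n) = 0 :> R.
  rewrite /dir /= (_ : 2 * pi * _ = pi *~ m); last first.
    by rewrite mulrzl -mulrzr; field.
  by case: m => n; rewrite ?NegzE ?mulrNz ?sinN -?pmulrn e ?oppr0 scaler0.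
elim: n => [|n IH]; first by rewrite mulr0n sin0.
by rewrite mulrSr sinDpi IH oppr0.
Qed.

End Directions.

(** * Continuous determinations of an angle *)

Section AngleLift.
Context {R : realType}.
Implicit Types (t : R).

Lemma continuous_fst_plane (T : topologicalType) (f : T -> plane R) (x : T) :
  {for x, continuous f} -> {for x, continuous (fun y => (f y).1)}.
Proof. by move=> cf; apply: (cvg_comp _ _ cf); exact: cvg_fst. Qed.

Lemma continuous_snd_plane (T : topologicalType) (f : T -> plane R) (x : T) :
  {for x, continuous f} -> {for x, continuous (fun y => (f y).2)}.
Proof. by move=> cf; apply: (cvg_comp _ _ cf); exact: cvg_snd. Qed.

Lemma continuous_pair (T U V : topologicalType) (f : T -> U) (g : T -> V) (x : T) :
  {for x, continuous f} -> {for x, continuous g} ->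
  {for x, continuous (fun y => (f y, g y))}.
Proof. by move=> cf cg; apply: cvg_pair; [exact: cf|exact: cg]. Qed.

Lemma continuous_dot (T : topologicalType) (f g : T -> plane R) (x : T) :
  {for x, continuous f} -> {for x, continuous g} ->
  {for x, continuous (fun y => dot (f y) (g y) : R^o)}.
Proof.
move=> cf cg; apply: (@cvgD _ R^o _ _ _ (fun y => (f y).1 * (g y).1) (fun y => (f y).2 * (g y).2)); apply: cvgM; by [exact: continuous_fst_plane|exact: continuous_snd_plane].
Qed.

Lemma continuous_det (T : topologicalType) (f g : T -> plane R) (x : T) :
  {for x, continuous f} -> {for x, continuous g} ->
  {for x, continuous (fun y => det (f y) (g y) : R^o)}.
Proof.
move=> cf cg; apply: (@cvgB _ R^o _ _ _ (fun y => (f y).1 * (g y).2) (fun y => (f y).2 * (g y).1)); apply: cvgM; by [exact: continuous_fst_plane|exact: continuous_snd_plane].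
Qed.

Lemma continuous_increment (T : topologicalType) (f g : T -> plane R) (x : T) :
  {for x, continuous f} -> {for x, continuous g} -> 0 < dot (f x) (g x) ->
  {for x, continuous (fun y => increment (f y) (g y) : R^o)}.
Proof.
move=> cf cg d0; apply: cvgM; last exact: cvg_cst.
apply: continuous_comp; last exact: continuous_atan.
apply: cvgM; first exact: continuous_det.
by apply: cvgV; [rewrite gt_eqF|exact: continuous_dot].
Qed.

Lemma in01_0 : 0 <= (0 : R) <= 1.
Proof. by apply/andP; split. Qed.

Lemma in01_1 : 0 <= (1 : R) <= 1.
Proof. by apply/andP; split. Qed.

(** Retraction of the line onto [0, 1]: precomposing with it turns continuity within the unit
    interval into continuity everywhere. *)
Definition clamp t : R := Num.min 1 (Num.max 0 t).

Lemma clamp_itv t : 0 <= clamp t <= 1.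
Proof. by rewrite /clamp le_min ge_min le_max !lexx ler01. Qed.

Lemma clampE t : 0 <= t <= 1 -> clamp t = t.
Proof. by move=> /andP[t0 t1]; rewrite /clamp max_r// min_r. Qed.

Lemma clamp_ge1 t : 1 <= t -> clamp t = 1.
Proof. by move=> t1; rewrite /clamp max_r ?min_l// (le_trans ler01). Qed.

Lemma clamp_le0 t : t <= 0 -> clamp t = 0.
Proof. by move=> t0; rewrite /clamp max_l// min_r. Qed.

Lemma continuous_clamp : continuous (clamp : R -> R).
Proof.
move=> t; apply: continuous_min; first exact: cvg_cst.
by apply: continuous_max; [exact: cvg_cst|exact: cvg_id].
Qed.

Lemma points_chain (g : nat -> plane R) x n : points_to x (g 0%N) ->
  (forall i, (i < n)%N -> 0 < dot (g i) (g i.+1)) ->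
  points_to (x + \sum_(i < n) increment (g i) (g i.+1)) (g n).
Proof.
move=> p0; elim: n => [|n IH] d; first by rewrite big_ord0 addr0.
rewrite big_ord_recr addrA /=; apply: points_increment; last exact: d.
by apply: IH => i ni; apply: d; rewrite ltnS ltnW.
Qed.

Lemma continuous_sum (T : topologicalType) n (f : nat -> T -> R^o) (x : T) :
  (forall i, (i < n)%N -> {for x, continuous (f i)}) ->
  (\sum_(i < n) f i y) @[y --> x] --> (\sum_(i < n) f i x : R^o).
Proof.
elim: n => [|n IH] cf.
  rewrite big_ord0 (_ : (fun y : T => \sum_(i < 0) f i y) = cst (0 : R^o)); first exact: cvg_cst.
  by apply/funext => y; rewrite big_ord0.
rewrite (_ : (fun y : T => \sum_(i < n.+1) f i y) = (fun y => \sum_(i < n) f i y + f n y)); last first.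
  by apply/funext => y; rewrite big_ord_recr.
rewrite big_ord_recr /=.
apply: (@cvgD _ R^o _ _ _ (fun y => \sum_(i < n) f i y)); last exact: cf.
by apply: IH => i ni; apply: cf; rewrite ltnS ltnW.
Qed.

(** On the diagonal the scalar product is a positive squared norm, so it stays positive nearby;
    compactness of the unit square gives one mesh for all base points. *)
Lemma dot_uniformly_gt0 (w : R * R -> plane R) : continuous w ->
  (forall p, w p != 0) ->
  exists N : nat, forall s t s' t', 0 <= s <= 1 -> 0 <= t <= 1 ->
    `|s - s'| <= N.+1%:R^-1 -> `|t - t'| <= N.+1%:R^-1 ->
    0 < dot (w (s, t)) (w (s', t')).
Proof.
move=> cw w0.
pose P (n : nat) (p : R * R) := forall q : R * R, `|p.1 - q.1| <= n.+1%:R^-1 ->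
  `|p.2 - q.2| <= n.+1%:R^-1 -> 0 < dot (w p) (w q).
have K : compact (`[0, 1]%classic `*` `[0, 1]%classic : set (R * R)).
  by apply: compact_setX; exact: segment_compact.
have /compact_near_coveringP/(_ nat \oo P _) := K.
case.
  move=> x _.
  have cd : {for (x, x), continuous (fun q : (R * R) * (R * R) => dot (w q.1) (w q.2) : R^o)}.
    apply: continuous_dot; apply: continuous_comp; try exact: cw.
      exact: cvg_fst.
    exact: cvg_snd.
  have d0 : 0 < dot (w x) (w x) by exact: dot_gt0.
  have := cd _ (lt_nbhsr d0).
  move=> /= [[A B] /= [/nbhs_ballP[e /= e0 eA] /nbhs_ballP[e' /= e'0 e'B]] AB].
  pose d := Num.min e (e' / 2); have d1 : 0 < d by rewrite lt_min e0 divr_gt0.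
  exists (ball x d, [set n | n.+1%:R^-1 < e' / 2]) => /=.
    split; first exact: nbhsx_ballx.
    have e2 : 0 < e' / 2 by rewrite divr_gt0.
    exact: (near_infty_natSinv_lt (PosNum e2)).
  move=> [p n] /= [px ne] q pq1 pq2; apply: (AB (p, q)); split => /=.
    by apply: eA; apply: le_ball px; rewrite ge_min lexx.
  apply: e'B; rewrite [e'](splitr e'); apply: (@ball_triangle _ _ p).
    by apply: le_ball px; rewrite ge_min lexx orbT.
  by split; rewrite /ball /= ; [exact: le_lt_trans pq1 ne|exact: le_lt_trans pq2 ne].
move=> N _ HN; exists N => s t s' t' s01 t01 ss tt.
by apply: (HN N (leqnn N) (s, t)) => //=; rewrite !in_itv.
Qed.

(** The angle is continued from (0, 0) to (s, 0), then to (s, t), by adding N + 1 acute increments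
    on each side. The sum is continuous in (s, t) because its subdivision points are. *)
Lemma angle_lift_square (w : R * R -> plane R) : continuous w ->
  (forall p, w p != 0) ->
  exists2 Th : R * R -> R, continuous Th &
    forall s t, 0 <= s <= 1 -> 0 <= t <= 1 -> points_to (Th (s, t)) (w (s, t)).
Proof.
move=> cw w0; have [N HN] := dot_uniformly_gt0 cw w0.
have [x0 px0] := points_exists (w0 (0, 0)).
(* Subdivision of [0, 1] stopped at t: the number of terms does not depend on t, and the last point
   is t itself. *)
pose m (t : R) (i : nat) : R := Num.min (clamp t) (i%:R / N.+1%:R).
have m0 t : m t 0%N = 0.
  by rewrite /m mul0r min_r//; case/andP: (clamp_itv t).
have mN t : 0 <= t <= 1 -> m t N.+1 = t.
  by move=> t01; rewrite /m divff ?pnatr_eq0// clampE// min_l//; case/andP: t01.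
have m01 t i : 0 <= m t i <= 1.
  have /andP[c0 c1] := clamp_itv t.
  by rewrite /m le_min ge_min c0 c1 /= divr_ge0.
have mS t i : `|m t i - m t i.+1| <= N.+1%:R^-1.
  rewrite /m -[i.+1%:R]natr1 mulrDl mul1r.
  have : 0 < N.+1%:R^-1 :> R by rewrite invr_gt0.
  set d := N.+1%:R^-1; set a := i%:R * d; set c := clamp t => d0.
  rewrite ler_norml /Num.min.
  by case: ltP => ?; case: ltP => ?; apply/andP; split; lra.
have cm i : continuous (m ^~ i).
  move=> t; apply: continuous_min; last exact: cvg_cst.
  exact: continuous_clamp.
pose Th (p : R * R) : R := x0 + (\sum_(i < N.+1) increment (w (m p.1 i, 0)) (w (m p.1 i.+1, 0)))
  + (\sum_(i < N.+1) increment (w (clamp p.1, m p.2 i)) (w (clamp p.1, m p.2 i.+1))).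
exists Th.
  have cw2 (f g : R * R -> R) : continuous f -> continuous g ->
      continuous (fun p => w (f p, g p)).
    move=> cf cg p; apply: continuous_comp; last exact: cw.
    by apply: continuous_pair; [exact: cf|exact: cg].
  have c1 i : continuous (fun p : R * R => m p.1 i).
    by move=> p; apply: (@continuous_comp _ _ _ fst (m ^~ i)); [exact: cvg_fst|exact: cm].
  have c2 i : continuous (fun p : R * R => m p.2 i).
    by move=> p; apply: (@continuous_comp _ _ _ snd (m ^~ i)); [exact: cvg_snd|exact: cm].
  have cc : continuous (fun p : R * R => clamp p.1).
    by move=> p; apply: continuous_comp; [exact: cvg_fst|exact: continuous_clamp].
  have c0 : continuous (fun p : R * R => 0 : R) by move=> p; exact: cvg_cst.
  move=> p; apply: (@cvgD _ R^o); [apply: (@cvgD _ R^o); first exact: cvg_cst|].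
    apply: (@continuous_sum _ _ (fun i (p : R * R) => increment (w (m p.1 i, 0)) (w (m p.1 i.+1, 0)))) => i _.
    apply: continuous_increment; [exact: cw2|exact: cw2|].
    by apply: HN; rewrite ?m01 ?lexx ?ler01// subrr normr0 invr_ge0.
  apply: (@continuous_sum _ _ (fun i (p : R * R) => increment (w (clamp p.1, m p.2 i)) (w (clamp p.1, m p.2 i.+1)))) => i _.
  apply: continuous_increment; [exact: cw2|exact: cw2|].
  by apply: HN; rewrite ?m01 ?clamp_itv// subrr normr0 invr_ge0.
move=> s t s01 t01; rewrite /Th /=.
have -> : w (s, t) = w (clamp s, m t N.+1) by rewrite clampE// mN.
apply: (points_chain (g := fun i => w (clamp s, m t i))); last first.
  by move=> i _; apply: HN; rewrite ?m01 ?clamp_itv// subrr normr0 invr_ge0.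
have -> : w (clamp s, m t 0) = w (m s N.+1, 0) by rewrite m0 mN// clampE.
apply: (points_chain (g := fun i => w (m s i, 0))); first by rewrite m0.
by move=> i _; apply: HN; rewrite ?m01 ?lexx ?ler01// subrr normr0 invr_ge0.
Qed.

Lemma angle_lift_path (w : R -> plane R) x : continuous w ->
  (forall t, w t != 0) -> points_to x (w 0) ->
  exists Th : R -> R, [/\ continuous Th, Th 0 = x &
    forall t, 0 <= t <= 1 -> points_to (Th t) (w t)].
Proof.
move=> cw w0 px.
have [|p|Th cTh HTh] := @angle_lift_square (fun p => w p.2).
- by move=> p; apply: continuous_comp; [exact: cvg_snd|exact: cw].
- exact: w0.
have i0 : 0 <= (0 : R) <= 1 by lra.
have k := points_uniq (HTh 0 0 i0 i0) px.
exists (fun t => Th (0, t) + (x - Th (0, 0))); split.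
- move=> t; apply: (@cvgD _ R^o); last exact: cvg_cst.
  apply: continuous_comp; last exact: cTh.
  by apply: continuous_pair; [exact: cvg_cst|exact: cvg_id].
- by rewrite addrC subrK.
- by move=> t t01; apply: points_int => //; exact: HTh.
Qed.

Lemma IVT01 (g : R -> R) v : continuous g ->
  Num.min (g 0) (g 1) <= v <= Num.max (g 0) (g 1) ->
  exists2 c, 0 <= c <= 1 & g c = v.
Proof.
move=> cg gv; have [||c] := @IVT R g 0 1 v _ _ gv; first exact: ler01.
  exact: continuous_subspaceT.
by rewrite in_itv /=; exists c.
Qed.

Lemma continuous_avoids (g : R -> R) a b : continuous g ->
  (forall t, 0 <= t <= 1 -> g t != a /\ g t != b) -> a < g 0 < b -> a < g 1 < b.
Proof.
move=> cg gab /andP[a0 b0]; rewrite !ltNge; apply/andP; split; apply/negP => h.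
  have [|c c01 gc] := @IVT01 g a cg.
    by rewrite ge_min h orbT /= le_max (ltW a0).
  by have [/eqP] := gab c c01.
have [|c c01 gc] := @IVT01 g b cg.
  by rewrite ge_min (ltW b0) /= le_max h orbT.
by have [_ /eqP] := gab c c01.
Qed.

(** Integer values never meet g 0 - 1/2 or g 0 + 1/2, so the final value stays within one half of
    the initial one. *)
Lemma int_valued_ends (g : R -> R) : continuous g ->
  (forall t, 0 <= t <= 1 -> g t \is a Num.int) -> g 1 = g 0.
Proof.
move=> cg gi; have i0 : 0 <= (0 : R) <= 1 by lra.
have i1 : 0 <= (1 : R) <= 1 by lra.
have := gi 0 i0 => /intrP[k gk].
have av t : 0 <= t <= 1 -> g t != g 0 - 2^-1 /\ g t != g 0 + 2^-1.
  move=> t01; have /intrP[l ->] := gi t t01; rewrite gk; split; apply/eqP => e.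
    have : (2 * (k - l))%:~R = (1%:~R : R) by rewrite intrM rmorphB /=; lra.
    by move=> /intr_inj; lia.
  have : (2 * (l - k))%:~R = (1%:~R : R) by rewrite intrM rmorphB /=; lra.
  by move=> /intr_inj; lia.
have := continuous_avoids cg av; have /intrP[l ->] := gi 1 i1; rewrite gk.
move=> /(_ _)/andP[|l1 l2]; first by lra.
have : `|(l - k)%:~R| < (1%:~R : R) by rewrite rmorphB /= ltr_norml; lra.
by rewrite -intr_norm ltr_int => h; congr (_%:~R); lia.
Qed.

Lemma int_valued_constant (g : R -> R) t : continuous g ->
  (forall t, 0 <= t <= 1 -> g t \is a Num.int) -> 0 <= t <= 1 -> g t = g 0.
Proof.
move=> cg gi t01; have := @int_valued_ends (fun s => g (s * t)).
rewrite mul1r mul0r; apply.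
  move=> s; apply: (@continuous_comp _ _ _ (fun s : R => s * t) g); last exact: cg.
  by apply: (@cvgM R R); [exact: cvg_id|exact: cvg_cst].
by move=> s s01; apply: gi; nra.
Qed.

Lemma continuous_comp_within (X Y Z : topologicalType) (S : set Y) (g : Y -> Z) (h : X -> Y) :
  continuous h -> (forall x, S (h x)) -> {within S, continuous g} -> continuous (g \o h).
Proof.
move=> ch hS cg; apply/continuousP => B oB.
have /continuousP/(_ _ oB)/open_subspaceP := cg.
move=> [C oC CB]; rewrite comp_preimage.
rewrite (_ : h @^-1` _ = h @^-1` C); first by move/continuousP: ch; apply.
apply/seteqP; split=> t /= k.
  have : (C `&` S) (h t) by rewrite CB; split.
  by case.
have : (g @^-1` B `&` S) (h t) by rewrite -CB; split.
by case.
Qed.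

Lemma continuous_within_clamp (T : topologicalType) (f : R -> T) :
  {within [set t | 0 <= t <= 1], continuous f} -> continuous (f \o clamp).
Proof. exact: continuous_comp_within continuous_clamp clamp_itv. Qed.

End AngleLift.

(** * Lifts and tangent maps *)

Section AnnulusTopology.
Context {R : realType}.
Local Notation T := (circle R).
Local Notation A := (annulus R).
Local Notation P := (plane R).
Local Open Scope quotient_scope.

(** The deck transformations of the covering [annulus_proj]. *)
Definition shift_by (k : int) (p : P) : P := (p.1 + k%:~R, p.2).

Lemma shift_byE k p : shift_by k p = p + ((k%:~R, 0) : P).
Proof. by apply: plane_eqP => //=; rewrite addr0. Qed.

Lemma circle_projP (x y : R) : circle_proj x = circle_proj y <-> x - y \is a Num.int.
Proof.
pose Q := {eq_quot (@congr_Z_equiv R)}.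
by split => [h|h]; [exact: (introT (eqquotP Q x y) h)|exact: (elimT (eqquotP Q x y) h)].
Qed.

Lemma circle_projD_int (x : R) (k : R) : k \is a Num.int ->
  circle_proj (x + k) = circle_proj x.
Proof. by move=> ki; apply/circle_projP; rewrite addrAC subrr add0r. Qed.

Lemma circle_proj_repr (s : T) : circle_proj (repr s) = s.
Proof. exact: reprK. Qed.

Lemma continuous_circle_proj : continuous (@circle_proj R).
Proof. exact: pi_continuous. Qed.

Lemma open_circle (B : set T) : open B <-> open (@circle_proj R @^-1` B).
Proof. by []. Qed.

Lemma circle_proj_open (B : set R) : open B -> open (@circle_proj R @` B).
Proof.
move=> oB; apply/open_circle.
rewrite (_ : _ @^-1` _ = \bigcup_(k in [set: int]) ((fun x : R => x + k%:~R) @^-1` B)).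
  apply: bigcup_open => k _.
  have : continuous (fun x : R => x + k%:~R).
    by move=> x; apply: (@cvgD _ R^o); [exact: cvg_id|exact: cvg_cst].
  by move=> /continuousP; apply.
apply/seteqP; split => x /=.
  move=> [y By /circle_projP/intrP[k xy]]; exists k => //=.
  by rewrite -xy addrC subrK.
by move=> [k _ /= Bx]; exists (x + k%:~R) => //; rewrite circle_projD_int ?intr_int.
Qed.

Definition plane_of (z : A) : P := (repr z.1, z.2).

Lemma annulus_proj_plane_of z : annulus_proj (plane_of z) = z.
Proof. by case: z => s y; rewrite /annulus_proj /plane_of /= circle_proj_repr. Qed.

Lemma annulus_projP (p q : P) :
  annulus_proj p = annulus_proj q <-> exists k, q = shift_by k p.
Proof.
case: p q => [a b] [c d]; rewrite /annulus_proj /shift_by /=; split.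
  case=> /esym/circle_projP/intrP[k e] ->; exists k.
  by congr pair; rewrite -e addrC subrK.
by case=> k [-> ->]; rewrite circle_projD_int ?intr_int.
Qed.

Lemma annulus_proj_shift k p : annulus_proj (shift_by k p) = annulus_proj p.
Proof. by apply/esym/annulus_projP; exists k. Qed.

Lemma continuous_annulus_proj : continuous (@annulus_proj R).
Proof.
move=> p; apply: (@continuous_pair _ _ _ (fun p : P => circle_proj p.1) snd); last exact: cvg_snd.
by apply: (@continuous_comp _ _ _ fst (@circle_proj R)); [exact: cvg_fst|exact: continuous_circle_proj].
Qed.

Lemma annulus_proj_open (B : set P) : open B -> open (@annulus_proj R @` B).
Proof.
rewrite openE => oB; rewrite openE => _ [p Bp <-].
have [/= e e0 eB] := (nbhs_ballP p B).1 (oB p Bp).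
exists (circle_proj @` ball p.1 e, ball p.2 e) => /=.
  split; last exact: nbhsx_ballx.
  apply: open_nbhs_nbhs; split; first by apply: circle_proj_open; exact: ball_open.
  by exists p.1 => //; exact: ballxx.
move=> [s y] /= [[x xe <-] ye]; exists (x, y) => //.
by apply: eB; split.
Qed.

Lemma open_annulus (B : set A) : open B <-> open (@annulus_proj R @^-1` B).
Proof.
split; first by move: B; apply/continuousP; exact: continuous_annulus_proj.
move=> /annulus_proj_open; congr open; apply/seteqP; split => z /=.
  by move=> [p Bp <-].
by move=> Bz; exists (plane_of z); rewrite /= annulus_proj_plane_of.
Qed.

Lemma continuous_annulus (Z : topologicalType) (f : A -> Z) :
  continuous (f \o @annulus_proj R) -> continuous f.
Proof.
move=> /continuousP cf; apply/continuousP => B oB; apply/open_annulus.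
by have := cf B oB; rewrite comp_preimage.
Qed.

(** An injective continuous map of the circle into the plane: it yields the Hausdorff property of
    the annulus and lets [angle_lift_square] lift homotopies of curves. *)
Definition circle_dir (s : T) : P := dir (repr s).

Lemma circle_dirE x : circle_dir (circle_proj x) = dir x.
Proof.
have /circle_projP k : circle_proj (repr (circle_proj x)) = circle_proj x.
  exact: circle_proj_repr.
by rewrite -[in RHS](dirDint x k) addrC subrK.
Qed.

Lemma continuous_dir : continuous (@dir R).
Proof.
have c : continuous (fun x : R => 2 * pi * x : R^o).
  by move=> x; apply: cvgM; [exact: cvg_cst|exact: cvg_id].
move=> x; apply: (@continuous_pair _ _ _ (fun x : R => - sin (2 * pi * x) : R^o) (fun x : R => cos (2 * pi * x) : R^o)).
  apply: (@cvgN _ R^o); apply: (@continuous_comp _ _ _ (fun x : R => 2 * pi * x : R) (@sin R)); first exact: c.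
  exact: continuous_sin.
apply: (@continuous_comp _ _ _ (fun x : R => 2 * pi * x : R) (@cos R)); first exact: c.
exact: continuous_cos.
Qed.

Lemma continuous_circle_dir : continuous circle_dir.
Proof.
apply/(@quotient_continuous R); have -> : circle_dir \o \pi_T = @dir R.
  by apply/funext => x /=; exact: circle_dirE.
exact: continuous_dir.
Qed.

Lemma dir_circle_proj (x y : R) : dir x = dir y -> circle_proj x = circle_proj y.
Proof.
move=> e; apply/circle_projP; apply: (@points_uniq _ _ _ (dir x)); last exact: points_dir.
by rewrite e; exact: points_dir.
Qed.

Lemma circle_dir_inj : injective circle_dir.
Proof.
move=> s t /dir_circle_proj; by rewrite !circle_proj_repr.
Qed.

Lemma hausdorff_inj (X Y : topologicalType) (g : X -> Y) :
  injective g -> continuous g -> hausdorff_space Y -> hausdorff_space X.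
Proof.
move=> ig cg hY x y xy; apply: ig; apply: hY => B C gB gC.
by have [z [Bz Cz]] := xy _ _ (cg x _ gB) (cg y _ gC); exists (g z).
Qed.

Lemma annulus_hausdorff : hausdorff_space A.
Proof.
have hP : hausdorff_space P by exact: norm_hausdorff.
apply: (@hausdorff_inj _ (P * P)%type (fun z => (circle_dir z.1, (0, z.2)))).
- by move=> [s y] [t z] /= e; rewrite (circle_dir_inj (congr1 fst e)) (congr1 (snd \o snd) e : y = z).
- move=> z; apply: (@continuous_pair _ P P (fun z : A => circle_dir z.1) (fun z : A => (0, z.2) : P)).
    by apply: (@continuous_comp _ _ _ fst circle_dir); [exact: cvg_fst|exact: continuous_circle_dir].
  by apply: (@continuous_pair _ _ _ (fun z : A => 0 : R^o) snd); [exact: cvg_cst|exact: cvg_snd].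
- exact: (@norm_hausdorff _ (P * P)%type).
Qed.

Lemma circle_compact : compact [set: T].
Proof.
have -> : [set: T] = @circle_proj R @` `[0, 1]%classic.
  apply/seteqP; split => // s _; set x := repr s.
  have /andP[f0 f1] := floor_itv x; rewrite intrD in f1.
  exists (x - (Num.floor x)%:~R).
    by rewrite /= in_itv /=; lra.
  by rewrite -rmorphN circle_projD_int ?intr_int// circle_proj_repr.
apply: continuous_compact; last exact: segment_compact.
by apply: continuous_subspaceT; exact: continuous_circle_proj.
Qed.

(** A continuous map from a compact space to a Hausdorff space is closed; the open set wanted is the
    complement of the image of the complement of O. *)
Lemma circle_embedding (Y : topologicalType) (c : T -> Y) : hausdorff_space Y ->
  injective c -> continuous c -> topological_embedding c.
Proof.
move=> hY ic cc; split => // O oO.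
exists (~` (c @` (~` O))); last first.
  apply/seteqP; split => s /=; first by move=> Os [t nO /ic ts]; apply: nO; rewrite ts.
  by move=> h; apply: contrapT => nO; apply: h; exists s.
apply: closed_openC; apply: compact_closed => //.
apply: continuous_compact; first exact: continuous_subspaceT.
apply: (subclosed_compact _ circle_compact) => //.
exact: open_closedC.
Qed.

Lemma plane_int_constant (g : P -> R) : continuous g -> (forall p, g p \is a Num.int) ->
  forall p q, g p = g q.
Proof.
move=> cg gi p q.
have := @int_valued_ends _ (fun t => g (q + t *: (p - q))).
rewrite scale0r scale1r addr0 addrCA subrr addr0; apply; last by move=> *; exact: gi.
move=> t; apply: (@continuous_comp _ _ _ (fun t : R => q + t *: (p - q)) g); last exact: cg.
apply: (@cvgD _ P); first exact: cvg_cst.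
by apply: cvgZr_tmp; exact: cvg_id.
Qed.

Lemma annulus_lift_unique (F G : P -> P) : continuous F -> continuous G ->
  (forall p, annulus_proj (F p) = annulus_proj (G p)) ->
  exists k, forall p, G p = shift_by k (F p).
Proof.
move=> cF cG FG.
have h p : exists k, G p = shift_by k (F p) by apply/annulus_projP.
have c : continuous (fun p => (G p).1 - (F p).1 : R).
  by move=> p; apply: (@cvgB _ R^o); apply: continuous_fst_plane; [exact: cG|exact: cF].
have i p : (G p).1 - (F p).1 \is a Num.int.
  by have [k ->] := h p; rewrite /= addrC addKr intr_int.
have [k k0] := h 0; exists k => p.
have := plane_int_constant c i p 0; rewrite k0 /= [in RHS]addrC addKr.
have [l ->] := h p => /=; rewrite addrC addKr => /intr_inj -> //.
Qed.

End AnnulusTopology.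
Section Tangent.
Context {R : realType}.
Local Notation T := (circle R).
Local Notation A := (annulus R).
Local Notation P := (plane R).

Lemma shift_by_add k : @shift_by R k = (id : P -> P) + cst ((k%:~R, 0) : P).
Proof. by apply/funext => p; rewrite shift_byE. Qed.

Lemma is_diff_shift_by k (p : P) : is_diff p (@shift_by R k : P -> P) (id : P -> P).
Proof.
rewrite shift_by_add -[X in is_diff _ _ X](addr0 (id : P -> P)).
exact: is_diffD.
Qed.

Lemma differentiable_shift_by k (p : P) : differentiable (@shift_by R k : P -> P) p.
Proof. by have [] := is_diff_shift_by k p. Qed.

Lemma diff_shift_by k (p w : P) : 'd (@shift_by R k : P -> P) p w = w.
Proof. by have [_ ->] := is_diff_shift_by k p. Qed.

Lemma continuous_shift_by k : continuous (@shift_by R k : P -> P).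
Proof. by move=> p; exact/differentiable_continuous/differentiable_shift_by. Qed.

Lemma shift_byK k : cancel (@shift_by R k) (shift_by (- k)).
Proof. by move=> p; apply: plane_eqP => //=; rewrite rmorphN addrK. Qed.

Lemma linear_plane (L : {linear P -> P}) (v : P) :
  L v = v.1 *: L ((1, 0) : P) + v.2 *: L ((0, 1) : P).
Proof.
rewrite -!linearZ -linearD; congr (L _).
by apply: plane_eqP => /=; rewrite !scaleRE; ring.
Qed.

(** [C1] gives continuity in the point for each fixed vector; expanding the vector in the standard
    basis makes it joint. *)
Lemma continuous_diff_pair (F : P -> P) (X : topologicalType) (q v : X -> P) (x : X) :
  C1 F -> {for x, continuous q} -> {for x, continuous v} ->
  {for x, continuous (fun y => 'd F (q y) (v y) : P)}.
Proof.
move=> [dF cF] cq cv.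
pose D1 p : P := 'd F p ((1, 0) : P); pose D2 p : P := 'd F p ((0, 1) : P).
have c1 : continuous D1 by exact: cF.
have c2 : continuous D2 by exact: cF.
have -> : (fun y => 'd F (q y) (v y) : P) = (fun y => (v y).1 *: D1 (q y) + (v y).2 *: D2 (q y)).
  by apply/funext => y; exact: linear_plane.
have k1 : {for x, continuous (fun y => D1 (q y))}.
  by apply: (@continuous_comp _ _ _ q D1); [exact: cq|exact: c1].
have k2 : {for x, continuous (fun y => D2 (q y))}.
  by apply: (@continuous_comp _ _ _ q D2); [exact: cq|exact: c2].
apply: (@cvgD _ P).
  by apply: (@cvgZ _ P); [exact: (continuous_fst_plane cv)|exact: k1].
by apply: (@cvgZ _ P); [exact: (continuous_snd_plane cv)|exact: k2].
Qed.

Lemma C1_continuous (F : P -> P) : C1 F -> continuous F.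
Proof. by move=> [dF _] p; exact: differentiable_continuous. Qed.

Lemma diff_comp_plane (F G : P -> P) (p u : P) : differentiable G p -> differentiable F (G p) ->
  'd (F \o G) p u = 'd F (G p) ('d G p u) :> P.
Proof. by move=> dG dF; exact: (congr1 (fun h => h u) (diff_comp dG dF)). Qed.

Lemma diff_precomp_shift (G : P -> P) j (p w : P) : differentiable G (shift_by j p) ->
  'd (G \o shift_by j) p w = 'd G (shift_by j p) w :> P.
Proof.
move=> dG.
exact: etrans (diff_comp_plane w (differentiable_shift_by j p) dG)
  (congr1 ('d G (shift_by j p)) (diff_shift_by j p w)).
Qed.

Lemma diff_postcomp_shift (F : P -> P) k (p w : P) : differentiable F p ->
  'd (shift_by k \o F) p w = 'd F p w :> P.
Proof.
move=> dF.
exact: etrans (diff_comp_plane w dF (differentiable_shift_by k (F p))) (diff_shift_by k _ _).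
Qed.

Lemma eq_diff (F G : P -> P) (p w : P) : F = G -> 'd F p w = 'd G p w :> P.
Proof. by move=> ->. Qed.

Lemma diff_lift_shift (F G : P -> P) j k (p w : P) : differentiable F p ->
  differentiable G (shift_by j p) -> (forall q, G (shift_by j q) = shift_by k (F q)) ->
  'd G (shift_by j p) w = 'd F p w :> P.
Proof.
move=> dF dG e; have eq : G \o shift_by j = shift_by k \o F by apply/funext => q; exact: e.
have e1 := diff_precomp_shift w dG.
have e2 := diff_postcomp_shift k w dF.
have e3 := eq_diff p w eq.
apply: etrans (esym e1) _.
apply: etrans e3 _.
exact: e2.
Qed.

Lemma C1_comp (F G : P -> P) : C1 F -> C1 G -> C1 (F \o G).
Proof.
move=> cF cG; have [dF _] := cF; have [dG kG] := cG.
split => [p|u]; first exact: differentiable_comp.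
have -> : (fun p => 'd (F \o G) p u : P) = (fun p => 'd F (G p) ('d G p u) : P).
  by apply/funext => p; exact: diff_comp_plane.
by move=> p; apply: (@continuous_diff_pair F P G (fun p => 'd G p u : P) p cF); [exact: (C1_continuous cG)|exact: kG].
Qed.

Lemma C1_shift_by k : C1 (@shift_by R k : P -> P).
Proof.
split; first exact: differentiable_shift_by.
move=> u; have -> : (fun p => 'd (@shift_by R k : P -> P) p u : P) = cst u.
  by apply/funext => p; exact: diff_shift_by.
by move=> p; exact: cvg_cst.
Qed.

Lemma lift_unique (f : A -> A) F G : is_lift f F -> is_lift f G ->
  exists k, forall p, G p = shift_by k (F p).
Proof.
by move=> [cF hF] [cG hG]; apply: annulus_lift_unique => // p; rewrite hF hG.
Qed.

Lemma lift_shift (f : A -> A) F k : is_lift f F -> is_lift f (F \o shift_by k).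
Proof.
move=> [cF hF]; split => [p|p]; last by rewrite /= hF annulus_proj_shift.
by apply: (@continuous_comp _ _ _ (shift_by k) F); [exact: continuous_shift_by|exact: cF].
Qed.

Lemma lift_comp (f g : A -> A) F G : is_lift f F -> is_lift g G -> is_lift (f \o g) (F \o G).
Proof.
move=> [cF hF] [cG hG]; split => p; last by rewrite /= hF hG.
by apply: (@continuous_comp _ _ _ G F); [exact: cG|exact: cF].
Qed.

Lemma lift_id : is_lift (@id A) (@id P).
Proof. by split => // p; exact: cvg_id. Qed.

Lemma lift_iter (f : A -> A) F n : is_lift f F -> is_lift (iter n f) (iter n F).
Proof.
move=> lF; elim: n => [|n IH]; first exact: lift_id.
exact: (lift_comp lF IH).
Qed.

Lemma C1_lift (f : A -> A) F : annulus_C1 f -> is_lift f F -> C1 F.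
Proof.
move=> [G lG cG] lF; have [k e] := lift_unique lG lF.
have -> : F = shift_by k \o G by apply/funext => p; exact: e.
exact: (C1_comp (C1_shift_by k) cG).
Qed.

Lemma annulus_C1_comp (f g : A -> A) : annulus_C1 f -> annulus_C1 g -> annulus_C1 (f \o g).
Proof.
move=> [F lF cF] [G lG cG]; exists (F \o G); [exact: lift_comp|exact: C1_comp].
Qed.

Lemma annulus_C1_id : annulus_C1 (@id A).
Proof.
exists id; first exact: lift_id.
have -> : (id : P -> P) = @shift_by R 0 by apply/funext => p; rewrite shift_byE /= addr0.
exact: C1_shift_by.
Qed.

Lemma annulus_C1_iter (f : A -> A) n : annulus_C1 f -> annulus_C1 (iter n f).
Proof.
move=> cf; elim: n => [|n IH]; first exact: annulus_C1_id.
exact: (annulus_C1_comp cf IH).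
Qed.

Lemma annulus_C1_continuous (f : A -> A) : annulus_C1 f -> continuous f.
Proof.
move=> [F [cF hF] _]; apply: continuous_annulus.
have -> : f \o @annulus_proj R = @annulus_proj R \o F.
  by apply/funext => p /=; rewrite hF.
by move=> p; apply: continuous_comp; [exact: cF|exact: continuous_annulus_proj].
Qed.

(** Frees [tangent_map] from its chosen lift and representative: they differ from F and p by integer
    translations, whose differential is the identity. *)
Lemma tangentE (f : A -> A) F p w : annulus_C1 f -> is_lift f F ->
  tangent_map f (annulus_proj p) w = 'd F p w.
Proof.
move=> cf lF; rewrite /tangent_map.
set G := xget _ _.
have lG : is_lift f G by have := @xgetPex _ (fun=> 0) [set F : P -> P | is_lift f F]; apply; exists F.
move: G lG => G lG.
have /annulus_projP[j jE] : annulus_proj p = annulus_proj (plane_of (annulus_proj p)).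
  by rewrite annulus_proj_plane_of.
have -> : ((repr (annulus_proj p).1, (annulus_proj p).2) : P) = shift_by j p.
  by rewrite -jE.
have [k e] := lift_unique lF (lift_shift j lG).
have [dG _] := C1_lift cf lG; have [dF _] := C1_lift cf lF.
exact: (@diff_lift_shift F G j k p w (dF p) (dG _) e).
Qed.

Lemma tangent_comp (f g : A -> A) z w : annulus_C1 f -> annulus_C1 g ->
  tangent_map (f \o g) z w = tangent_map f (g z) (tangent_map g z w).
Proof.
move=> cf cg; have [F lF _] := cf; have [G lG _] := cg.
rewrite -(annulus_proj_plane_of z); set p := plane_of z.
rewrite (tangentE _ _ cg lG) -(lG.2 p) (tangentE _ _ cf lF).
rewrite (tangentE _ _ (annulus_C1_comp cf cg) (lift_comp lF lG)).
apply: diff_comp_plane; first by have [+ _] := C1_lift cg lG; exact.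
by have [+ _] := C1_lift cf lF; exact.
Qed.

Lemma tangent_id z w : tangent_map (@id A) z w = w.
Proof.
rewrite -(annulus_proj_plane_of z) (tangentE _ _ annulus_C1_id lift_id).
by have [_ ->] : is_diff (plane_of z) (id : P -> P) (id : P -> P) by exact: _.
Qed.

Lemma tangent_linear (f : A -> A) z a u b v :
  tangent_map f z (a *: u + b *: v) = a *: tangent_map f z u + b *: tangent_map f z v.
Proof. by rewrite /tangent_map linearD !linearZ. Qed.

Lemma tangentZ (f : A -> A) z a u : tangent_map f z (a *: u) = a *: tangent_map f z u.
Proof. by rewrite /tangent_map linearZ. Qed.

Lemma tangentN (f : A -> A) z u : tangent_map f z (- u) = - tangent_map f z u.
Proof. by rewrite /tangent_map linearN. Qed.

Lemma continuous_tangent (f : A -> A) u : annulus_C1 f -> continuous (fun z => tangent_map f z u).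
Proof.
move=> cf; apply: continuous_annulus; have [F lF [_ cF]] := cf.
have -> : (fun z => tangent_map f z u) \o @annulus_proj R = (fun p => 'd F p u : P).
  by apply/funext => p /=; rewrite (tangentE _ _ cf lF).
exact: cF.
Qed.

Lemma tangent_neq0 (f : A -> A) z w : annulus_C1_diffeo f -> w != 0 -> tangent_map f z w != 0.
Proof.
move=> [g [fK gK cf cg]]; apply: contra => /eqP e.
have : tangent_map (g \o f) z w = w.
  by rewrite (_ : g \o f = id) ?tangent_id//; apply/funext.
rewrite tangent_comp// e => <-.
by rewrite -(scale0r (0 : P)) tangentZ !scale0r.
Qed.

Lemma annulus_C1_diffeo_C1 (f : A -> A) : annulus_C1_diffeo f -> annulus_C1 f.
Proof. by case=> g []. Qed.

Lemma det_tangent (f : A -> A) z u v : det (tangent_map f z u) (tangent_map f z v) =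
  det (tangent_map f z ((1, 0) : P)) (tangent_map f z ((0, 1) : P)) * det u v.
Proof.
have h (w : P) : w = w.1 *: ((1, 0) : P) + w.2 *: ((0, 1) : P).
  by apply: plane_eqP => /=; rewrite !scaleRE; ring.
rewrite {1}(h u) {1}(h v) !tangent_linear /det /= !scaleRE; ring.
Qed.

Lemma det_eq0 (u v : P) : det u v = 0 -> u != 0 -> exists a, v = a *: u.
Proof.
move=> d u0; exists (dot u v / dot u u).
have d0 := dot_gt0 u0; have d1 : dot u u != 0 by rewrite gt_eqF.
have e1 : dot u v * u.1 = dot u u * v.1.
  by move: d => /eqP; rewrite /det subr_eq0 /dot => /eqP d; ring: d.
have e2 : dot u v * u.2 = dot u u * v.2.
  by move: d => /eqP; rewrite /det subr_eq0 /dot => /eqP d; ring: d.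
by apply: plane_eqP; rewrite /= scaleRE mulrAC ?e1 ?e2 mulrC mulKf.
Qed.

Lemma det_tangent_neq0 (f : A -> A) z u v : annulus_C1_diffeo f ->
  det u v != 0 -> det (tangent_map f z u) (tangent_map f z v) != 0.
Proof.
move=> cf; rewrite det_tangent => d0; rewrite mulf_neq0//.
apply/eqP => /det_eq0[].
  by apply: tangent_neq0 => //; apply/eqP => /(congr1 fst) /= /eqP; rewrite oner_eq0.
move=> a e; have : tangent_map f z (a *: ((1, 0) : P) + (- 1) *: ((0, 1) : P)) = 0.
  by rewrite tangent_linear e scaleN1r subrr.
apply/eqP/tangent_neq0 => //; apply/eqP => /(congr1 snd) /= /eqP.
by rewrite scaler0 add0r scaleRE mulr1 oppr_eq0 oner_eq0.
Qed.

End Tangent.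

(** * Derivatives and mean values along segments *)

Section LineDerivative.
Context {R : realType}.
Local Notation P := (plane R).

Lemma is_diff_fst (p : P) : is_diff p (fst : P -> R^o) (fst : P -> R^o).
Proof.
have c : continuous (fst : P -> R^o) by move=> q; exact: cvg_fst.
have d := @linear_differentiable _ P R^o (fst : {linear P -> R^o}) p c.
apply: DiffDef; first exact: d.
exact: (@diff_lin _ P R^o (fst : {linear P -> R^o}) p c).
Qed.

Lemma is_diff_snd (p : P) : is_diff p (snd : P -> R^o) (snd : P -> R^o).
Proof.
have c : continuous (snd : P -> R^o) by move=> q; exact: cvg_snd.
have d := @linear_differentiable _ P R^o (snd : {linear P -> R^o}) p c.
apply: DiffDef; first exact: d.
exact: (@diff_lin _ P R^o (snd : {linear P -> R^o}) p c).
Qed.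

Lemma is_diff_line (a w : P) (t : R^o) :
  is_diff t (fun s : R^o => a + s *: w) (fun s : R^o => s *: w).
Proof.
have h := is_diffD (is_diff_cst a t) (is_diff_scalel t w).
rewrite add0r in h; exact: h.
Qed.

(** The hypothesis on l, being its own differential, is a way to treat both coordinate projections
    at once. *)
Lemma is_diff_comp_line (G : P -> P) (l : P -> R^o) (a w : P) (t : R^o) :
  (forall p, is_diff p l l) -> differentiable G (a + t *: w) ->
  is_diff t (fun s : R^o => l (G (a + s *: w))) (fun s : R^o => l ('d G (a + t *: w) (s *: w))).
Proof.
move=> dl dG.
have h1 := is_diff_comp (is_diff_line a w t) (differentiableP dG).
exact: (is_diff_comp h1 (dl _)).
Qed.

Lemma is_derive_comp_line (G : P -> P) (l : P -> R^o) (a w : P) (t : R) :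
  (forall p, is_diff p l l) -> differentiable G (a + t *: w) ->
  is_derive t (1 : R) (fun s : R => l (G (a + s *: w)) : R) (l ('d G (a + t *: w) w)).
Proof.
move=> dl dG; have h := is_diff_comp_line (t := t) dl dG.
apply: DeriveDef.
  by apply: diff_derivable; case: h.
rewrite deriveE; last by case: h.
case: h => _ ->; by rewrite scale1r.
Qed.

(** The mean value theorem fails for maps into the plane, so it is stated for one coordinate l at a
    time; the intermediate point depends on l. *)
Lemma MVT_line (G : P -> P) (l : P -> R^o) (a w : P) :
  (forall p, is_diff p l l) -> (forall p, differentiable G p) ->
  exists2 c : R, 0 < c < 1 & l (G (a + w)) - l (G a) = l ('d G (a + c *: w) w).
Proof.
move=> dl dG.
have [||c] := @MVT R (fun s => l (G (a + s *: w))) (fun s => l ('d G (a + s *: w) w)) 0 1 ltr01.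
- by move=> x _; exact: is_derive_comp_line.
- apply: continuous_subspaceT => x.
  have [d _] := @is_diff_comp_line G l a w x dl (dG _).
  exact: differentiable_continuous d.
- by rewrite in_itv /= => c01; rewrite scale1r scale0r addr0 subr0 mulr1; exists c.
Qed.

Lemma MVT_plane (G : P -> P) (l : P -> R^o) (a b : P) :
  (forall p, is_diff p l l) -> (forall p, differentiable G p) ->
  exists2 c : R, 0 < c < 1 & l (G b) - l (G a) = l ('d G (a + c *: (b - a)) (b - a)).
Proof.
move=> dl dG; have [c c01 e] := @MVT_line G l a (b - a) dl dG; exists c => //.
have eb : G (a + (b - a)) = G b by congr G; rewrite addrCA subrr addr0.
exact: etrans (congr1 (fun x => l x - l (G a)) (esym eb)) e.
Qed.

(** Monotonicity alone gives a nonnegative derivative; it cannot vanish, by the chain rule, because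
    the inverse of g is differentiable too. *)
Lemma twist_fst_gt0 (F : P -> P) (p : P) : C1 F ->
  (let g := fun y : R^o => (F (p.1, y)).1 in C1_diffeo g /\ {homo g : y y' / y < y'}) ->
  0 < ('d F p ((0, 1) : P)).1.
Proof.
move=> [dF _] /= [[h [gh _ [dg _] [dh _]]] inc].
set g := (fun y : R^o => (F (p.1, y)).1) in gh dg inc dh.
set m := (_.1 : R).
have gE : g = (fun s : R^o => (F ((p.1, 0) + s *: ((0, 1) : P))).1).
  apply/funext => s; rewrite /g; congr (F _).1; apply: plane_eqP; rewrite /= !scaleRE ?mulr0 ?mulr1 ?addr0 ?add0r//.
have pE : p = (p.1, 0) + (p.2 : R) *: ((0, 1) : P).
  by apply: plane_eqP; rewrite /= !scaleRE ?mulr0 ?mulr1 ?addr0 ?add0r.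
have hd := @is_diff_comp_line F fst (p.1, 0) ((0, 1) : P) p.2 is_diff_fst (dF _).
have hder := @is_derive_comp_line F fst (p.1, 0) ((0, 1) : P) p.2 is_diff_fst (dF _).
rewrite -gE -pE in hd hder.
have m0 : m != 0.
  apply/eqP => e.
  have hc := is_diff_comp hd (differentiableP (dh (g p.2))).
  rewrite (_ : h \o g = id) in hc; last by apply/funext.
  have [_ e1] := hc.
  have [_ e2] : is_diff (p.2 : R^o) (id : R^o -> R^o) (id : R^o -> R^o) by exact: _.
  have := congr1 (fun k : R^o -> R^o => k 1) (etrans (esym e1) e2).
  rewrite /= scale1r -/m e linear0 => /eqP; by rewrite eq_sym oner_eq0.
rewrite lt_neqAle eq_sym m0 /=.
have -> : m = g^`()%classic p.2 by rewrite derive1E; case: hder => _ ->.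
apply: (@incr_derive1_ge0 _ g setT).
- by move=> x _; apply: diff_derivable; exact: dg.
- by move=> x y _ _; exact: inc.
- by rewrite interiorT.
Qed.

End LineDerivative.

(** * Rotation of directions along an isotopy *)

Section Isotopy.
Context {R : realType}.
Local Notation T := (circle R).
Local Notation A := (annulus R).
Local Notation P := (plane R).
Variables (I : R -> A -> A) (f : A -> A).
Hypothesis isoI : isotopy_from_id I f.

Lemma iso_diffeo t : annulus_C1_diffeo (I (clamp t)).
Proof. by case: isoI => h _ _ _ _; exact: h (clamp_itv t). Qed.

Lemma iso_C1 t : annulus_C1 (I (clamp t)).
Proof. exact/annulus_C1_diffeo_C1/iso_diffeo. Qed.

Lemma iso0 : I (clamp 0) = id.
Proof. by rewrite clampE ?in01_0//; case: isoI. Qed.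

Lemma iso1 : I (clamp 1) = f.
Proof. by rewrite clampE ?in01_1//; case: isoI. Qed.

(* [clamp] freezes the isotopy outside of the time interval [0, 1]. *)
Definition iso_tangent (t : R) (p u : P) : P := tangent_map (I (clamp t)) (annulus_proj p) u.

Lemma continuous_iso_tangent (X : topologicalType) (t : X -> R) (p u : X -> P) (x : X) :
  {for x, continuous t} -> {for x, continuous p} -> {for x, continuous u} ->
  {for x, continuous (fun y => iso_tangent (t y) (p y) (u y))}.
Proof.
move=> ct cp cu; have [_ _ _ _ cI] := isoI.
have key v : continuous (fun q : R * P => iso_tangent q.1 q.2 v).
  apply: (continuous_comp_within (h := fun q : R * P => (clamp q.1, annulus_proj q.2)) _ _ (cI v)).
    move=> q; apply: (@continuous_pair _ _ _ (fun q : R * P => clamp q.1) (fun q : R * P => annulus_proj q.2)).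
      by apply: (@continuous_comp _ _ _ fst (@clamp R)); [exact: cvg_fst|exact: continuous_clamp].
    by apply: (@continuous_comp _ _ _ snd (@annulus_proj R)); [exact: cvg_snd|exact: continuous_annulus_proj].
  by move=> q; exact: clamp_itv.
pose D1 (q : R * P) := iso_tangent q.1 q.2 ((1, 0) : P).
pose D2 (q : R * P) := iso_tangent q.1 q.2 ((0, 1) : P).
have -> : (fun y => iso_tangent (t y) (p y) (u y)) =
   (fun y => (u y).1 *: D1 (t y, p y) + (u y).2 *: D2 (t y, p y)).
  by apply/funext => y; exact: linear_plane.
have ctp : {for x, continuous (fun y => (t y, p y))} by exact: continuous_pair.
have k1 : {for x, continuous (fun y => D1 (t y, p y))}.
  by apply: (@continuous_comp _ _ _ (fun y => (t y, p y)) D1); [exact: ctp|exact: key].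
have k2 : {for x, continuous (fun y => D2 (t y, p y))}.
  by apply: (@continuous_comp _ _ _ (fun y => (t y, p y)) D2); [exact: ctp|exact: key].
apply: (@cvgD _ P).
  by apply: (@cvgZ _ P); [exact: (continuous_fst_plane cu)|exact: k1].
by apply: (@cvgZ _ P); [exact: (continuous_snd_plane cu)|exact: k2].
Qed.

Lemma iso_tangent_neq0 t p u : u != 0 -> iso_tangent t p u != 0.
Proof. by apply: tangent_neq0; exact: iso_diffeo. Qed.

Lemma iso_tangent0 p u : iso_tangent 0 p u = u.
Proof. by rewrite /iso_tangent iso0 tangent_id. Qed.

Definition iso_lift (t : R) : P -> P := xget (fun=> 0) [set F : P -> P | is_lift (I (clamp t)) F].

Lemma iso_liftP t : is_lift (I (clamp t)) (iso_lift t).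
Proof.
have [F lF _] := iso_C1 t.
by have := @xgetPex _ (fun=> 0) [set F : P -> P | is_lift (I (clamp t)) F]; apply; exists F.
Qed.

Lemma iso_lift_differentiable t p : differentiable (iso_lift t) p.
Proof. by have [d _] := C1_lift (iso_C1 t) (iso_liftP t); exact: d. Qed.

Lemma iso_lift_diff t p u : 'd (iso_lift t) p u = iso_tangent t p u :> P.
Proof. by rewrite /iso_tangent (tangentE _ _ (iso_C1 t) (iso_liftP t)). Qed.

(* The lift at time [t] is chosen without any continuity in [t], but secants do
   not depend on that choice. *)
Definition secant t (p q : P) : P := iso_lift t q - iso_lift t p.

Lemma secantE t p q F : is_lift (I (clamp t)) F -> secant t p q = F q - F p.
Proof.
move=> lF; have [k e] := lift_unique (iso_liftP t) lF.
by rewrite /secant !e !shift_byE opprD addrACA subrr addr0.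
Qed.

Lemma MVT_secant t p q (l : P -> R^o) : (forall p, is_diff p l l) ->
  exists2 c : R, 0 < c < 1 & l (iso_lift t q) - l (iso_lift t p) = l (iso_tangent t (p + c *: (q - p)) (q - p)).
Proof.
move=> dl; have [c c01 e] := @MVT_plane R (iso_lift t) l p q dl (iso_lift_differentiable t).
exists c; first exact: c01.
exact: etrans e (congr1 l (iso_lift_diff t _ _)).
Qed.

Lemma plane_norm_lt (u : P) e : `|u| < e <-> `|u.1| < e /\ `|u.2| < e.
Proof. by rewrite prod_normE /= gt_max; split => [/andP//|[-> ->]]. Qed.

Lemma MVT_secant_lt t p q e :
  (forall c : R, 0 < c < 1 -> `|iso_tangent t (p + c *: (q - p)) (q - p)| < e) ->
  `|secant t p q| < e.
Proof.
move=> h; apply/plane_norm_lt; split.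
  have [c c01 ec] := MVT_secant t p q is_diff_fst.
  by rewrite /= ec; have /plane_norm_lt[] := h c c01.
have [c c01 ec] := MVT_secant t p q is_diff_snd.
by rewrite /= ec; have /plane_norm_lt[] := h c c01.
Qed.

(** The tangent map is jointly continuous and kills the zero vector, so it is small on short
    vectors; mean values transfer this to secants. *)
Lemma secant_near_diag (t0 : R) (q0 : P) e : 0 < e ->
  \forall y \near (t0, q0), `|secant y.1 q0 y.2| < e.
Proof.
move=> e0.
have c : {for (t0, q0, 0 : P), continuous (fun y : R * P * P => iso_tangent y.1.1 y.1.2 y.2)}.
  apply: continuous_iso_tangent; last exact: cvg_snd.
    by apply: (@continuous_comp _ _ _ fst fst); [exact: cvg_fst|exact: cvg_fst].
  by apply: (@continuous_comp _ _ _ fst snd); [exact: cvg_fst|exact: cvg_snd].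
have /= z0 : iso_tangent t0 q0 (0 : P) = 0.
  by rewrite /iso_tangent -[X in tangent_map _ _ X](scale0r (0 : P)) tangentZ scale0r.
have : \forall y \near (t0, q0, 0 : P), `|iso_tangent y.1.1 y.1.2 y.2| < e.
  move/cvgrPdist_lt: c => /(_ _ e0) /=; rewrite z0.
  by apply: filterS => y /=; rewrite sub0r normrN.
move=> /nbhs_ballP[d /= d0 hd].
apply/nbhs_ballP; exists d => //= -[t q] /= [/= t0t qd].
apply: MVT_secant_lt => c' /andP[c0 c1].
apply: (hd (t, q0 + c' *: (q - q0), q - q0)); split => /=; first split => //=.
  rewrite -ball_normE /=; rewrite -ball_normE /= in qd.
  rewrite opprD addrA subrr add0r normrN normrZ gtr0_norm//.
  by apply: le_lt_trans qd; rewrite -[leRHS]mul1r distrC ler_wpM2r// ltW.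
by rewrite -ball_normE /= sub0r opprB; rewrite -ball_normE /= in qd.
Qed.

(** By compactness, the tangent maps at times t and t0 are close uniformly along the segment from p
    to q; the mean value theorem is applied to the difference of the two lifts. *)
Lemma secant_near_time (t0 : R) (p q : P) e : 0 < e ->
  \forall t \near t0, `|secant t p q - secant t0 p q| < e.
Proof.
move=> e0; pose w := q - p.
pose Q (t : R) (c : R) := `|iso_tangent t (p + c *: w) w - iso_tangent t0 (p + c *: w) w| < e.
have : \forall t \near t0, forall c, `[0, 1]%classic c -> Q t c.
  have /compact_near_coveringP/(_ R (nbhs t0) Q _) : compact (`[0, 1]%classic : set R) by exact: segment_compact.
  apply => c _.
  have cl : continuous (fun y : R * R => p + y.1 *: w).
    move=> y; apply: (@cvgD _ P); first exact: cvg_cst.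
    by apply: (@cvgZr_tmp _ P); exact: cvg_fst.
  have ck : {for (c, t0), continuous (fun y : R * R => iso_tangent y.2 (p + y.1 *: w) w - iso_tangent t0 (p + y.1 *: w) w)}.
    have k1 : {for (c, t0), continuous (fun y : R * R => iso_tangent y.2 (p + y.1 *: w) w)}.
      by apply: continuous_iso_tangent; [exact: cvg_snd|exact: cl|exact: cvg_cst].
    have k2 : {for (c, t0), continuous (fun y : R * R => iso_tangent t0 (p + y.1 *: w) w)}.
      by apply: continuous_iso_tangent; [exact: cvg_cst|exact: cl|exact: cvg_cst].
    exact: (cvgB k1 k2).
  pose K (y : R * R) : P := iso_tangent y.2 (p + y.1 *: w) w - iso_tangent t0 (p + y.1 *: w) w.
  have K0 : K (c, t0) = 0 by exact: subrr.
  have /cvgrPdist_lt/(_ _ e0) : {for (c, t0), continuous K} by exact: ck.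
  by rewrite K0; apply: filterS => y; rewrite sub0r normrN.
apply: filterS => t hQ.
pose G := iso_lift t - iso_lift t0.
have dG r : differentiable G r.
  by apply: differentiableB; exact: iso_lift_differentiable.
have eG r u : 'd G r u = iso_tangent t r u - iso_tangent t0 r u :> P.
  have d := is_diffB (differentiableP (iso_lift_differentiable t r)) (differentiableP (iso_lift_differentiable t0 r)).
  have [_ h] := d; have := congr1 (fun k : P -> P => k u) h; move=> -> /=.
  by rewrite -!iso_lift_diff.
have eS : secant t p q - secant t0 p q = G q - G p.
  by rewrite /secant /G !fctE !opprD !opprK addrACA.
rewrite eS; apply/plane_norm_lt; split.
  have [c c01 ec] := @MVT_plane R G fst p q is_diff_fst dG.
  have /plane_norm_lt[+ _] : Q t c by apply: hQ; rewrite /= in_itv /=; lra.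
  by congr (`|_| < e); exact/esym/(etrans ec (congr1 fst (eG _ _))).
have [c c01 ec] := @MVT_plane R G snd p q is_diff_snd dG.
have /plane_norm_lt[_ +] : Q t c by apply: hQ; rewrite /= in_itv /=; lra.
by congr (`|_| < e); exact/esym/(etrans ec (congr1 snd (eG _ _))).
Qed.

Lemma continuous_secant p : continuous (fun y : R * P => secant y.1 p y.2).
Proof.
move=> [t0 q0]; apply/cvgrPdist_lt => e e0.
have e2 : 0 < e / 2 by rewrite divr_gt0.
have hA := secant_near_diag t0 q0 e2.
have hB : \forall y \near (t0, q0), `|secant y.1 p q0 - secant t0 p q0| < e / 2.
  have := secant_near_time t0 p q0 e2.
  exact: (@cvg_fst _ _ (nbhs t0) (nbhs q0)).
near=> y; have yA : `|secant y.1 q0 y.2| < e / 2 by near: y.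
have yB : `|secant y.1 p q0 - secant t0 p q0| < e / 2 by near: y.
rewrite distrC /=.
(* Cutting the secant at q0 separates the motion of the end point from that of time. *)
have -> : secant y.1 p y.2 - secant t0 p q0 = secant y.1 q0 y.2 + (secant y.1 p q0 - secant t0 p q0).
  by rewrite [RHS]addrA; congr (_ - _); rewrite /secant addrA subrK.
by apply: le_lt_trans (ler_normD _ _) _; rewrite [e]splitr ltrD.
Unshelve. all: by end_near. Qed.

(** At each time the two ends have the same projection, so the secant is an integer horizontal
    vector; it varies continuously in time and is known at time 0. *)
Lemma secant_shift t p k : secant t p (shift_by k p) = (k%:~R, 0).
Proof.
pose g (s : R) := (secant s p (shift_by k p)).
have cg : continuous g.
  move=> s; apply: (@continuous_comp _ _ _ (fun s : R => (s, shift_by k p)) (fun y => secant y.1 p y.2)); last exact: continuous_secant.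
  by apply: continuous_pair; [exact: cvg_id|exact: cvg_cst].
have h s : exists j, g s = (j%:~R, 0).
  have [_ pL] := iso_liftP s.
  have : annulus_proj (iso_lift s p) = annulus_proj (iso_lift s (shift_by k p)).
    by rewrite !pL annulus_proj_shift.
  move=> /annulus_projP[j e]; exists j.
  by rewrite /g /secant e shift_byE addrC addKr.
have g0 : g 0 = (k%:~R, 0).
  rewrite /g (@secantE 0 p _ id).
    by rewrite shift_byE addrC addKr.
  by rewrite iso0; exact: lift_id.
have gi s : (g s).1 \is a Num.int by have [j ->] := h s; exact: intr_int.
have cg1 : continuous (fun s => (g s).1 : R).
  by move=> s; exact: (continuous_fst_plane (cg s)).
have e : (g (clamp t)).1 = k%:~R.
  by rewrite (int_valued_constant cg1 (fun s _ => gi s) (clamp_itv t)) g0.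
have -> : secant t p (shift_by k p) = g (clamp t).
  by rewrite /g /secant /iso_lift (clampE (clamp_itv t)).
by have [j ej] := h (clamp t); apply: plane_eqP; [exact: e|rewrite ej].
Qed.

Lemma secant_neq0 t p q : q != p -> secant t p q != 0.
Proof.
apply: contra => /eqP e.
have [_ pL] := iso_liftP t.
have : annulus_proj p = annulus_proj q.
  have [g [gK _ _ _]] := iso_diffeo t; apply: (can_inj gK).
  by rewrite -!pL; congr annulus_proj; apply/esym/eqP; rewrite -subr_eq0 -/(secant t p q) e.
move=> /annulus_projP[k qE].
move: e; rewrite qE secant_shift => /(congr1 fst) /= k0.
by rewrite shift_byE k0 addr0.
Qed.

Lemma iso_lift_shift t k p : iso_lift t (shift_by k p) = shift_by k (iso_lift t p).
Proof.
have /eqP := secant_shift t p k; rewrite /secant subr_eq addrC => /eqP ->.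
by rewrite [RHS]shift_byE.
Qed.

(** The lift to the real line of the action of the isotopy on directions, as a relation between
    initial and final angles; whole turns are remembered. *)
Definition turns (z : A) (x y : R) := exists Th : R -> R,
  [/\ continuous Th, Th 0 = x, Th 1 = y &
    forall t, 0 <= t <= 1 -> points_to (Th t) (tangent_map (I t) z (dir x))].

Lemma iso_tangent_plane_of t z u : 0 <= t <= 1 ->
  iso_tangent t (plane_of z) u = tangent_map (I t) z u.
Proof. by move=> t01; rewrite /iso_tangent annulus_proj_plane_of clampE. Qed.

Lemma continuous_iso_tangent_time p u : continuous (fun t => iso_tangent t p u).
Proof. by move=> t; apply: continuous_iso_tangent; [exact: cvg_id|exact: cvg_cst|exact: cvg_cst]. Qed.

Lemma turns_exists z x : exists y, turns z x y.
Proof.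
have [||| Th [cTh T0 hT]] := @angle_lift_path _ (fun t => iso_tangent t (plane_of z) (dir x)) x.
- exact: continuous_iso_tangent_time.
- by move=> t; apply: iso_tangent_neq0; exact: dir_neq0.
- by rewrite iso_tangent0; exact: points_dir.
exists (Th 1), Th; split; [exact: cTh|exact: T0|exact: erefl|move=> t t01].
by rewrite -(iso_tangent_plane_of z _ t01); exact: hT.
Qed.

Lemma turns_end z x y : turns z x y -> points_to y (tangent_map f z (dir x)).
Proof.
move=> [Th [_ _ <- h]]; have := h 1 in01_1.
by have [_ _ -> _ _] := isoI.
Qed.

Lemma turns_half z x y : turns z x y -> turns z (x + 2^-1) (y + 2^-1).
Proof.
move=> [Th [cT T0 T1 h]]; exists (fun t => Th t + 2^-1); split.
- by move=> t; apply: (@cvgD _ R^o); [exact: cT|exact: cvg_cst].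
- by rewrite T0.
- by rewrite T1.
- by move=> t t01; rewrite dir_half tangentN; apply: pointsN; exact: h.
Qed.

(** Invertible linear maps keep independent vectors independent, so the gap between the two angles
    never meets 0 or 1/2 during the isotopy. *)
Lemma turns_lt z x1 x2 y1 y2 : turns z x1 y1 -> turns z x2 y2 ->
  x1 < x2 < x1 + 2^-1 -> y1 < y2 < y1 + 2^-1.
Proof.
move=> [T1 [c1 t10 t11 h1]] [T2 [c2 t20 t21 h2]] x12.
have cg : continuous (fun t => T2 t - T1 t).
  by move=> t; apply: (@cvgB _ R^o); [exact: c2|exact: c1].
have := @continuous_avoids _ _ 0 2^-1 cg.
rewrite t10 t20 t11 t21 => h.
suff : 0 < y2 - y1 < 2^-1 by lra.
apply: h; last by lra.
move=> t t01.
have hd : annulus_C1_diffeo (I t) by rewrite -(clampE t01); exact: iso_diffeo.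
have d0 : det (dir x1) (dir x2) != 0.
  by rewrite det_dir gt_eqF// sin_2pi_gt0//; lra.
have := det_tangent_neq0 z hd d0.
have [r r0 ->] := points_detP (h1 t t01) (h2 t t01) => dn.
split; apply: contra dn => /eqP ->.
  by rewrite mulr0 sin0 mulr0.
by rewrite (_ : 2 * pi * 2^-1 = pi) ?sinpi ?mulr0//; field.
Qed.

Lemma turns_unique z x y y' : turns z x y -> turns z x y' -> y = y'.
Proof.
move=> [T1 [c1 t10 t11 h1]] [T2 [c2 t20 t21 h2]].
have cg : continuous (fun t => T2 t - T1 t).
  by move=> t; apply: (@cvgB _ R^o); [exact: c2|exact: c1].
have := int_valued_ends cg; rewrite t10 t20 t11 t21 subrr => h.
apply/esym/eqP; rewrite -subr_eq0 h// => t t01.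
by apply: points_uniq; [exact: h1|exact: h2].
Qed.

Hypothesis f_twist : positive_twist_map f.

Lemma twist_tangent_gt0 z : 0 < (tangent_map f z ((0, 1) : P)).1.
Proof.
have [/annulus_C1_diffeo_C1 cf _ tw] := f_twist.
have [F lF _] := cf; rewrite -(annulus_proj_plane_of z) (tangentE _ _ cf lF).
apply: twist_fst_gt0; first exact: C1_lift lF.
by have := tw F lF (plane_of z).1.
Qed.

Lemma iso_lift1 : is_lift f (iso_lift 1).
Proof. by have := iso_liftP 1; rewrite iso1. Qed.

Lemma secant1_vertical_gt0 p (r : R) : 0 < r ->
  0 < (secant 1 p (p + ((0, r) : P))).1.
Proof.
move=> r0; have [_ _ tw] := f_twist.
have [_ inc] := tw _ iso_lift1 p.1.
rewrite /secant /= subr_gt0.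
have := inc p.2 (p.2 + r); rewrite ltrDl => /(_ r0).
have -> : (p.1, p.2) = p by case: (p).
by have -> : ((p.1, p.2 + r) : P) = p + ((0, r) : P) by apply: plane_eqP => //=; rewrite addr0.
Qed.

(** A lift of the inverse of f, corrected by a translation to be a left inverse. It is a right
    inverse up to a translation, which cancellation forces to be trivial. *)
Lemma iso_lift1_onto : exists G : P -> P,
  [/\ continuous G, cancel G (iso_lift 1) & cancel (iso_lift 1) G].
Proof.
have [[g [fK gK cf cg]] _ _] := f_twist.
have [G0 lG0 _] := cg.
have lid : is_lift id (G0 \o iso_lift 1).
  by have := lift_comp lG0 iso_lift1; rewrite (_ : g \o f = id)//; apply/funext.
have [k ek] := lift_unique (@lift_id R) lid.
pose G := shift_by (- k) \o G0.
have GK : cancel (iso_lift 1) G.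
  by move=> p; rewrite /G /= (ek p : G0 (iso_lift 1 p) = _) shift_byK.
have lG : is_lift g G.
  split; last by move=> p; rewrite /G /= annulus_proj_shift; case: lG0.
  have [cG0 _] := lG0; move=> p; apply: (@continuous_comp _ _ _ G0 (shift_by (- k))); first exact: cG0.
  exact: continuous_shift_by.
have lid2 : is_lift id (iso_lift 1 \o G).
  by have := lift_comp iso_lift1 lG; rewrite (_ : f \o g = id)//; apply/funext.
have [l el] := lift_unique (@lift_id R) lid2.
exists G; split => //; first by case: lG.
move=> p; rewrite (el p : iso_lift 1 (G p) = _) /=.
have := el (iso_lift 1 p); rewrite /= GK => /(congr1 fst) /= /eqP.
by rewrite -subr_eq0 opprD addrA subrr sub0r oppr_eq0 => /eqP l0; rewrite shift_byE l0 addr0.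
Qed.

(** q is the preimage, under the lift at time 1, of the upper half of the unit circle around the
    image of p, run from right to left. Its ends are translates of p since that lift commutes with
    integer translations. *)
Lemma arc_path p : exists q : R -> P, [/\ continuous q,
  q 0 = shift_by 1 p, q 1 = shift_by (-1) p &
  forall s, secant 1 p (q s) = dir (s / 2 - 4^-1)].
Proof.
have [G [cG GK KG]] := iso_lift1_onto.
pose q (s : R) : P := G (iso_lift 1 p + dir (s / 2 - 4^-1)).
have e4 : 2 * pi * 4^-1 = pi / 2 :> R by field.
have d1 : dir (4^-1 : R) = ((-1)%:~R, 0).
  by apply: plane_eqP; rewrite /dir /= e4 ?sin_pihalf ?cos_pihalf.
have d2 : dir (- 4^-1 : R) = (1%:~R, 0).
  by apply: plane_eqP; rewrite /dir /= mulrN e4 ?sinN ?cosN ?sin_pihalf ?cos_pihalf ?opprK.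
exists q; split.
- move=> s; apply: (@continuous_comp _ _ _ (fun s : R => iso_lift 1 p + dir (s / 2 - 4^-1)) G); last exact: cG.
  apply: (@cvgD _ P); first exact: cvg_cst.
  apply: (@continuous_comp _ _ _ (fun s : R => s / 2 - 4^-1) (@dir R)); last exact: continuous_dir.
  by apply: (@cvgB _ R^o); [apply: (@cvgM R R); [exact: cvg_id|exact: cvg_cst]|exact: cvg_cst].
- by rewrite /q mul0r sub0r d2 -shift_byE -iso_lift_shift KG.
- rewrite /q (_ : 1 / 2 - 4^-1 = 4^-1 :> R); last by field.
  by rewrite d1 -shift_byE -iso_lift_shift KG.
- by move=> s; rewrite /secant /q GK addrC addKr.
Qed.

Lemma int_valued_level (g : R -> R) (h : R -> R) (w : R -> P) t : continuous g -> continuous h ->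
  (forall s, 0 <= s <= 1 -> points_to (g s) (w s) /\ points_to (h s) (w s)) -> 0 <= t <= 1 ->
  h t - g t = h 0 - g 0.
Proof.
move=> cg ch gh t01.
have cgh : continuous (fun s => h s - g s).
  by move=> s; apply: (@cvgB _ R^o); [exact: ch|exact: cg].
by apply: (int_valued_constant cgh) => // s s01; have [a b] := gh s s01; exact: points_uniq a b.
Qed.

(* The secant from [p] to [q s] is [dir (s / 2 - 4^-1)] at time 1.  For s = 0, 1 it
   is horizontal and does not turn along the isotopy, so at time 0 it also makes
   half a turn as s goes from 0 to 1, hence is vertical for some s. *)
Lemma vertical_secant_turns p : exists (r : R) (Th : R -> R),
  [/\ 0 < r, continuous Th, Th 0 = 0, - 2^-1 < Th 1 < 0 &
    forall t, 0 <= t <= 1 -> points_to (Th t) (secant t p (p + ((0, r) : P)))].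
Proof.
have [q [cq q0 q1 hq]] := arc_path p.
pose w (y : R * R) := secant y.1 p (q y.2).
have cw : continuous w.
  move=> y; apply: (@continuous_comp _ _ _ (fun y : R * R => (y.1, q y.2)) (fun y => secant y.1 p y.2)); last exact: continuous_secant.
  apply: (@continuous_pair _ _ _ (fst : R * R -> R) (fun y : R * R => q y.2)); first exact: cvg_fst.
  by apply: (@continuous_comp _ _ _ snd q); [exact: cvg_snd|exact: cq].
have qp s : q s != p.
  apply/eqP => e; have := hq s; rewrite e /secant subrr => /esym/eqP.
  exact/negP/dir_neq0.
have w0 y : w y != 0 by exact: secant_neq0.
have [Th cTh hTh] := angle_lift_square cw w0.
have cTt s : continuous (fun t => Th (t, s)).
  move=> t; apply: (@continuous_comp _ _ _ (fun t : R => (t, s)) Th); last exact: cTh.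
  by apply: continuous_pair; [exact: cvg_id|exact: cvg_cst].
have cTs t : continuous (fun s => Th (t, s)).
  move=> s; apply: (@continuous_comp _ _ _ (fun s : R => (t, s)) Th); last exact: cTh.
  by apply: continuous_pair; [exact: cvg_cst|exact: cvg_id].
have clin : continuous (fun s : R => s / 2 - 4^-1).
  by move=> s; apply: (@cvgB _ R^o); [apply: (@cvgM R R); [exact: cvg_id|exact: cvg_cst]|exact: cvg_cst].
pose c := Th (1, 0) + 4^-1.
have T1 s : 0 <= s <= 1 -> Th (1, s) = c + (s / 2 - 4^-1).
  move=> s01; have := @int_valued_level (fun s => s / 2 - 4^-1) (fun s => Th (1, s)) (fun s => w (1, s)) s clin (cTs 1).
  rewrite mul0r sub0r opprK -/c => h; rewrite -h ?subrK//.
  by move=> u u01; split; [rewrite /w /= hq; exact: points_dir|exact: hTh in01_1 u01].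
have Th_const s k : 0 <= s <= 1 -> q s = shift_by k p -> Th (0, s) = Th (1, s).
  move=> s01 qs; have [x0 px0] := points_exists (w0 (0, s)).
  have := @int_valued_level (cst x0) (fun t => Th (t, s)) (fun t => w (t, s)) 1 _ (cTt s) _ in01_1.
  move=> h; apply/esym/(addIr (- x0)); apply: h; first by move=> t; exact: cvg_cst.
  move=> t t01; split; last exact: hTh t01 s01.
  by move: px0; rewrite /w /= qs !secant_shift.
have T00 : Th (0, 0) = c - 4^-1.
  by rewrite (Th_const 0 1)// ?in01_0// T1 ?in01_0// mul0r sub0r.
have T01 : Th (0, 1) = c + 4^-1.
  by rewrite (Th_const 1 (-1))// ?in01_1// T1 ?in01_1//; congr (_ + _); field.
(* At time 0 the angle runs from c - 1/4 to c + 1/4. As c will turn out to be an integer, the value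
   c means vertical and upward. *)
have [s s01 Ts] : exists2 s, 0 <= s <= 1 & Th (0, s) = c.
  apply: (@IVT01 _ (fun s => Th (0, s))); first exact: cTs.
  by rewrite T00 T01 ge_min le_max; lra.
have e1 := T1 s s01.
have cint : c \is a Num.int.
  have := hTh 1 0 in01_1 in01_0; rewrite T1 ?in01_0// /w /= hq => h.
  by have := points_uniq (points_dir _) h; rewrite addrK.
have [r r0 qs] : exists2 r : R, 0 < r & q s = p + ((0, r) : P).
  have [r r0] := hTh 0 s in01_0 s01.
  rewrite Ts /w /= (secantE (t := 0) _ _ (F := id)); last by rewrite iso0; exact: lift_id.
  rewrite -(add0r c) (dirDint _ cint) /dir mulr0 sin0 cos0 oppr0 => e.
  exists r => //; move/eqP: e; rewrite subr_eq addrC => /eqP ->; congr (_ + _).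
  by apply: plane_eqP; rewrite /= scaleRE ?mulr0 ?mulr1.
exists r, (fun t => Th (t, s) - c); split => //.
- by move=> t; apply: (@cvgB _ R^o); [exact: cTt|exact: cvg_cst].
- by rewrite Ts subrr.
- rewrite e1 addrAC subrr add0r.
  (* By the twist, the image of an upward vertical secant points to the right, which excludes the
     angles s / 2 - 1/4 in [0, 1/4]. *)
  have := secant1_vertical_gt0 p r0; rewrite -qs hq => d.
  suff : s / 2 - 4^-1 < 0 by lra.
  rewrite ltNge; apply/negP; rewrite le_eqVlt => /orP[/eqP e|p0].
    by move: d; rewrite -e /dir /= mulr0 sin0 oppr0 ltxx.
  have := points_fst_lt0 (points_dir (s / 2 - 4^-1)); move: d; lra.
- move=> t t01; rewrite -qs; apply: points_int; first by rewrite rpredN.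
  exact: hTh t01 s01.
Qed.

(* Deforms a secant direction into a tangent one as [y.2] goes to 0. *)
Definition secant_slope (p w : P) (y : R * R) : P :=
  if y.2 == 0 then iso_tangent y.1 p w else y.2^-1 *: secant y.1 p (p + y.2 *: w).

Lemma secant_slope_neq0 p w y : w != 0 -> secant_slope p w y != 0.
Proof.
move=> w0; rewrite /secant_slope; case: ifPn => [_|y0]; first exact: iso_tangent_neq0.
rewrite scaler_eq0 invr_eq0 (negbTE y0) /=; apply: secant_neq0.
by rewrite -subr_eq0 addrAC subrr add0r scaler_eq0 (negbTE y0).
Qed.

(** One formula for the secant and the tangent cases: continuity of [secant_slope] at parameter zero
    is read off it. *)
Lemma MVT_secant_slope (l : P -> R^o) p w y : (forall p, is_diff p l l) ->
  (forall a (u : P), l (a *: u) = a * l u) -> (forall u v : P, l (u - v) = l u - l v) ->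
  exists2 c, 0 <= c <= 1 & l (secant_slope p w y) = l (iso_tangent y.1 (p + (c * y.2) *: w) w).
Proof.
move=> dl lZ lB; rewrite /secant_slope; case: ifPn => [/eqP ->|y0].
  by exists 0; [exact: in01_0|rewrite mulr0 scale0r addr0].
have [c c01 e] := MVT_secant y.1 p (p + y.2 *: w) dl.
exists c; first by lra.
rewrite lZ /secant lB e.
have -> : p + y.2 *: w - p = y.2 *: w by rewrite addrAC subrr add0r.
have es : c *: (y.2 *: w) = (c * y.2) *: w := scalerA _ _ _.
by rewrite es /iso_tangent (tangentZ (I (clamp y.1)) _ y.2 w) lZ mulKf.
Qed.

Lemma continuous_secant_slope p w : continuous (secant_slope p w).
Proof.
move=> [t0 s0]; apply/cvgrPdist_lt => e e0.
have [->|sn] := eqVneq s0 0.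
  have e1 : secant_slope p w (t0, 0) = iso_tangent t0 p w by rewrite /secant_slope eqxx.
  have : {for (t0, p), continuous (fun y : R * P => iso_tangent y.1 y.2 w)}.
    by apply: continuous_iso_tangent; [exact: cvg_fst|exact: cvg_snd|exact: cvg_cst].
  move=> /cvgrPdist_lt/(_ _ e0)/nbhs_ballP[d /= d0 hd].
  have cl : {for 0, continuous (fun s : R => s *: w)}.
    by apply: (@cvgZr_tmp _ P); exact: cvg_id.
  have : \forall s \near (0 : R), `|s *: w| < d.
    move/cvgrPdist_lt: cl => /(_ _ d0); rewrite scale0r.
    by apply: filterS => s; rewrite sub0r normrN.
  move=> /nbhs_ballP[d' /= d'0 hd'].
  exists (ball t0 (Num.min d d'), ball (0 : R) (Num.min d d')) => /=.
    by split; apply: nbhsx_ballx; rewrite lt_min d0.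
  move=> [t s] [/= td sd]; rewrite e1.
  have key (c : R) : 0 <= c <= 1 -> `|iso_tangent t0 p w - iso_tangent t (p + (c * s) *: w) w| < e.
    move=> /andP[c0 c1]; apply: (hd (t, p + (c * s) *: w)); split => /=.
      by apply: le_ball td; rewrite ge_min lexx.
    rewrite -ball_normE /= opprD addrA subrr add0r normrN -scalerA normrZ ger0_norm//.
    have : `|s *: w| < d by apply: hd'; apply: le_ball sd; rewrite ge_min lexx orbT.
    by apply: le_lt_trans; rewrite -[leRHS]mul1r ler_wpM2r.
  apply/plane_norm_lt; split.
    have [c c01 ec] := @MVT_secant_slope fst p w (t, s) is_diff_fst (fun _ _ => erefl) (fun _ _ => erefl).
    have /plane_norm_lt[+ _] := key c c01.
    by congr (`|_| < e); congr (_ - _); exact: esym ec.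
  have [c c01 ec] := @MVT_secant_slope snd p w (t, s) is_diff_snd (fun _ _ => erefl) (fun _ _ => erefl).
  have /plane_norm_lt[_ +] := key c c01.
  by congr (`|_| < e); congr (_ - _); exact: esym ec.
pose g (y : R * R) := y.2^-1 *: secant y.1 p (p + y.2 *: w).
have cg : {for (t0, s0), continuous g}.
  have ci : {for (t0, s0), continuous (fun y : R * R => y.2^-1 : R)}.
    by apply: cvgV => //; exact: cvg_snd.
  have cs : continuous (fun y : R * R => secant y.1 p (p + y.2 *: w)).
    move=> y; apply: (@continuous_comp _ _ _ (fun y : R * R => (y.1, p + y.2 *: w)) (fun y => secant y.1 p y.2)); last exact: continuous_secant.
    apply: (@continuous_pair _ _ _ (fst : R * R -> R) (fun y : R * R => p + y.2 *: w)); first exact: cvg_fst.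
    apply: (@cvgD _ P); first exact: cvg_cst.
    by apply: (@cvgZr_tmp _ P); exact: cvg_snd.
  exact: (cvgZ ci (cs (t0, s0))).
have gE (y : R * R) : y.2 != 0 -> secant_slope p w y = g y.
  by rewrite /secant_slope => /negbTE ->.
have n1 : \forall y \near (t0, s0), `|g (t0, s0) - g y| < e.
  by move/cvgrPdist_lt: cg; apply.
have n2 : \forall y \near (t0, s0), y.2 != 0.
  have : {for (t0, s0), continuous (snd : R * R -> R)} by exact: cvg_snd.
  move=> /cvgrPdist_lt/(_ `|s0|); rewrite normr_gt0 => /(_ sn).
  apply: filterS => y /= h; apply/eqP => y0; move: h; rewrite y0 subr0 ltxx//.
rewrite gE//; near=> y; rewrite gE; near: y; [exact: n1|exact: n2].
Unshelve. all: by end_near. Qed.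

(** The secant of [vertical_secant_turns] turns by an amount in ]-1/2, 0[. Shrinking it to a tangent
    vector changes nothing at time 0, where it stays vertical; at time 1 it always points to the
    right by the twist condition, so its angle cannot leave that interval. *)
Lemma turns_vertical z y : turns z 0 y -> - 2^-1 < y < 0.
Proof.
move=> ty; set p := plane_of z.
have [r [Th [r0 cTh Th0 Th1 hTh]]] := vertical_secant_turns p.
pose w : P := (0, r).
have wn : w != 0.
  by apply/eqP => /(congr1 snd) /= e; move: r0; rewrite e ltxx.
have pw : points_to 0 w.
  exists r => //; rewrite /dir mulr0 sin0 cos0 oppr0.
  by apply: plane_eqP; rewrite /= scaleRE ?mulr0 ?mulr1.
have V0 := fun y => secant_slope_neq0 p y wn.
have [S cS hS] := angle_lift_square (@continuous_secant_slope p w) V0.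
have cSt s : continuous (fun t => S (t, s)).
  move=> t; apply: (@continuous_comp _ _ _ (fun t : R => (t, s)) S); last exact: cS.
  by apply: continuous_pair; [exact: cvg_id|exact: cvg_cst].
have cSs t : continuous (fun s => S (t, s)).
  move=> s; apply: (@continuous_comp _ _ _ (fun s : R => (t, s)) S); last exact: cS.
  by apply: continuous_pair; [exact: cvg_cst|exact: cvg_id].
have slope0 s : secant_slope p w (0, s) = w.
  rewrite /secant_slope /=; case: ifPn => [_|s0]; first exact: iso_tangent0.
  rewrite (secantE (t := 0) _ _ (F := id)); last by rewrite iso0; exact: lift_id.
  by rewrite addrAC subrr add0r scalerA mulVf// scale1r.
have cst0 s : 0 <= s <= 1 -> S (0, s) = S (0, 0).
  move=> s01.
  have := @int_valued_level (cst 0) (fun s => S (0, s)) (cst w) s _ (cSs 0) _ s01.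
  rewrite !subr0; apply; first by move=> t; exact: cvg_cst.
  by move=> u u01; split; [exact: pw|have := hS 0 u in01_0 u01; rewrite slope0].
set d := S (0, 0).
have dint : d \is a Num.int.
  by have := hS 0 0 in01_0 in01_0; rewrite slope0 => h; have := points_uniq pw h; rewrite subr0.
have e1 : S (1, 1) - d = Th 1.
  have := @int_valued_level Th (fun t => S (t, 1)) (fun t => secant_slope p w (t, 1)) 1 cTh (cSt 1) _ in01_1.
  rewrite (cst0 1 in01_1) Th0 subr0 -/d => h; rewrite -h; first by rewrite opprB addrCA subrr addr0.
  move=> t t01; split; last exact: hS t01 in01_1.
  by rewrite /secant_slope /= oner_eq0 invr1 !scale1r; exact: hTh.
have key : - 2^-1 < S (1, 0) - d < 0.
  (* The parameter is reversed, to start at the full secant and end at the tangent vector. *)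
  have := @continuous_avoids _ (fun s => S (1, 1 - s) - d) (- 2^-1) 0.
  rewrite subr0 subrr e1 => h; apply: h => //.
    move=> s; apply: (@cvgB _ R^o); last exact: cvg_cst.
    apply: (@continuous_comp _ _ _ (fun s : R => 1 - s) (fun s => S (1, s))); last exact: cSs.
    by apply: (@cvgB _ R^o); [exact: cvg_cst|exact: cvg_id].
  move=> s s01; have s01' : 0 <= 1 - s <= 1 by lra.
  have := hS 1 (1 - s) in01_1 s01'.
  have : 0 < (secant_slope p w (1, 1 - s)).1.
    rewrite /secant_slope /=; case: ifPn => [_|s1].
      rewrite /iso_tangent iso1; have := twist_tangent_gt0 (annulus_proj p) => m0.
      have -> : w = r *: ((0, 1) : P) by apply: plane_eqP; rewrite /= scaleRE ?mulr0 ?mulr1.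
      by rewrite tangentZ /= scaleRE mulr_gt0.
    have s2 : 0 < 1 - s by rewrite lt_neqAle eq_sym s1; lra.
    change (0 < (1 - s)^-1 * (secant 1 p (p + (1 - s) *: w)).1).
    apply: mulr_gt0; first by rewrite invr_gt0.
    have -> : (1 - s) *: w = (0, (1 - s) * r) by apply: plane_eqP; rewrite /= scaleRE ?mulr0.
    by apply: secant1_vertical_gt0; rewrite mulr_gt0.
  set u := secant_slope _ _ _ => u0 hu.
  have hu' : points_to (S (1, 1 - s) - d) u by apply: points_int hu; rewrite rpredN.
  split; apply/eqP => e.
    have := @fst_points_half _ (-1) _ _ hu'; rewrite e mulN1r => /(_ erefl).
    by rewrite rpredN1 => /(_ isT) u1; move: u0; rewrite u1 ltxx.
  have := @fst_points_half _ 0 _ _ hu'; rewrite e mul0r => /(_ erefl).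
  by rewrite rpred0 => /(_ isT) u1; move: u0; rewrite u1 ltxx.
suff t0 : turns z 0 (S (1, 0) - d) by rewrite (turns_unique ty t0).
exists (fun t => S (t, 0) - d); split.
- by move=> t; apply: (@cvgB _ R^o); [exact: cSt|exact: cvg_cst].
- exact: subrr.
- exact: erefl.
- move=> t t01; apply: points_int; first by rewrite rpredN.
  have := hS t 0 t01 in01_0; rewrite /secant_slope eqxx /= (iso_tangent_plane_of z _ t01).
  move=> [a a0 e]; exists (r^-1 * a); first by rewrite mulr_gt0 ?invr_gt0.
  rewrite -scalerA -e -tangentZ; congr tangent_map.
  rewrite /dir mulr0 sin0 cos0 oppr0.
  by apply: plane_eqP; rewrite /= scaleRE ?mulr0 ?mulVf ?gt_eqF.
Qed.

End Isotopy.

(** * Torsion and half turns *)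

Section DirectionCocycle.
Context {R : realType}.
Local Notation A := (annulus R).
Local Notation P := (plane R).
(* [H z] is the lift, provided by an isotopy, of the action of the differential
   at [z] on directions. *)
Variables (f : A -> A) (H : A -> R -> R).
Hypothesis f_C1 : annulus_C1 f.
Hypothesis H_lt : forall z x y, x < y -> H z x < H z y.
Hypothesis H_half : forall z x, H z (x + 2^-1) = H z x + 2^-1.
Hypothesis H_points : forall z x, points_to (H z x) (tangent_map f z (dir x)).
Hypothesis H_vertical : forall z, - 2^-1 < H z 0 < 0.

Definition vertical_image (n : nat) (z : A) : R := (tangent_map (iter n f) z ((0, 1) : P)).1.

(* The vertical direction only turns clockwise, by less than half a turn at each
   step, so its half turns can be read off the signs of [vertical_image]. *)
Fixpoint half_turns (n : nat) (z : A) : nat :=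
  if n is n'.+1 then
    (half_turns n' z + ((-1) ^+ half_turns n' z * vertical_image n z < 0)%R)%N
  else 0%N.

Fixpoint H_iter (n : nat) (z : A) (x : R) : R :=
  if n is n'.+1 then H (iter n' f z) (H_iter n' z x) else x.

Lemma H_sub z x (m : nat) : H z (x - m%:R / 2) = H z x - m%:R / 2.
Proof.
elim: m => [|m IH]; first by rewrite mul0r !subr0.
apply: (@addIr _ 2^-1); rewrite -H_half.
have -> : x - m.+1%:R / 2 + 2^-1 = x - m%:R / 2 by rewrite -natr1; field.
by rewrite IH -natr1; field.
Qed.

Lemma H_iter_lt n z x y : x < y -> H_iter n z x < H_iter n z y.
Proof. by move=> xy; elim: n => //= n IH; exact: H_lt. Qed.

Lemma H_iter_le n z x y : x <= y -> H_iter n z x <= H_iter n z y.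
Proof. by rewrite le_eqVlt => /orP[/eqP -> //|/(H_iter_lt n z)/ltW]. Qed.

Lemma H_iter_sub n z x (m : nat) : H_iter n z (x - m%:R / 2) = H_iter n z x - m%:R / 2.
Proof. by elim: n => //= n ->; exact: H_sub. Qed.

Lemma H_iterD n k z x : H_iter (n + k) z x = H_iter k (iter n f z) (H_iter n z x).
Proof.
elim: k => [|k IH]; first by rewrite addn0.
by rewrite addnS /= IH -iterD addnC.
Qed.

Lemma H_iter_points n z x : points_to (H_iter n z x) (tangent_map (iter n f) z (dir x)).
Proof.
elim: n => [|n [r r0 IH]]; first by rewrite (tangent_id z); exact: points_dir.
have := tangent_comp z (dir x) f_C1 (annulus_C1_iter n f_C1).
rewrite -/(iter n.+1 f) => ->; rewrite IH tangentZ.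
by apply: pointsZ => //; exact: H_points.
Qed.

(** [H_iter] is increasing and commutes with half turns, so the displacement of x stays within a
    bounded distance of that of the vertical: all directions turn alike up to a constant. *)
Lemma H_iter_bounded n z x : `|H_iter n z x - x - H_iter n z 0| <= 1.
Proof.
have key (k : nat) (y : R) : - (k.+1%:R / 2) <= y <= - (k%:R / 2) -> `|H_iter n z y - y - H_iter n z 0| <= 1.
  move=> /andP[y0 y1].
  have h0 := H_iter_le n z y0; have h1 := H_iter_le n z y1.
  rewrite -sub0r H_iter_sub in h0; rewrite -sub0r H_iter_sub in h1.
  rewrite -natr1 in h0 y0; rewrite ler_norml; lra.
(* Intervals are indexed by natural numbers to the left of 0, so x is first moved there by a whole
   number of turns. *)
pose m := Num.bound `|x|.
have e : H_iter n z x - x = H_iter n z (x - m%:R / 2) - (x - m%:R / 2).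
  by rewrite H_iter_sub; ring.
have [k hk] : exists k : nat, - (k.+1%:R / 2) <= x - m.*2%:R / 2 <= - (k%:R / 2).
  have xm : x < m%:R by apply: le_lt_trans (ler_norm _) _; apply: archi_boundP.
  have y0 : 0 <= 2 * (m%:R - x) by lra.
  exists (Num.truncn (2 * (m%:R - x))).
  have /andP[t0 t1] := truncn_itv y0.
  have e2 : m.*2%:R = 2 * m%:R :> R by rewrite -mul2n natrM.
  by rewrite e2 -[X in - (X / 2)]natr1; rewrite -natr1 in t1; lra.
have := key k _ hk; rewrite (_ : H_iter n z _ - _ = H_iter n z x - x)//.
by rewrite H_iter_sub; ring.
Qed.

Lemma points_alternate x (m : nat) (w : P) : points_to (x - m%:R / 2) w -> - 2^-1 < x < 0 ->
  0 < (-1) ^+ m * w.1.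
Proof.
move=> pw xE.
have pm : points_to x ((-1) ^+ m *: w).
  elim: m w pw => [|m IH] w pw; first by rewrite expr0 scale1r; rewrite mul0r subr0 in pw.
  rewrite exprS mulN1r scaleNr -scalerN; apply: IH.
  have := pointsN pw; rewrite -natr1 (_ : x - _ + _ = x - m%:R / 2)//; by field.
exact: points_fst_gt0 pm xE.
Qed.

Lemma points_half_fst (m : nat) (w : P) : points_to (- (m%:R / 2)) w -> w.1 = 0.
Proof.
move=> pw; apply: (@fst_points_half _ (- m%:R) _ _ pw); first by rewrite mulNr.
by rewrite rpredN rpred_nat.
Qed.

Lemma H_iter_vertical n z : points_to (H_iter n z 0) (tangent_map (iter n f) z ((0, 1) : P)).
Proof.
have -> : ((0, 1) : P) = dir 0 by rewrite /dir mulr0 sin0 cos0 oppr0.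
exact: H_iter_points.
Qed.

Lemma H_iter_step n z (m : nat) : - (m.+1%:R / 2) <= H_iter n z 0 <= - (m%:R / 2) ->
  - (m.+2%:R / 2) < H_iter n.+1 z 0 < - (m%:R / 2).
Proof.
move=> /andP[h0 h1] /=.
set z' := iter n f z.
have Hle x y : x <= y -> H z' x <= H z' y.
  by rewrite le_eqVlt => /orP[/eqP -> //|/(H_lt z')/ltW].
have HN k : H z' (- (k%:R / 2)) = H z' 0 - k%:R / 2 by have := H_sub z' 0 k; rewrite sub0r.
have := Hle _ _ h0; have := Hle _ _ h1; rewrite !HN.
have := H_vertical z'; rewrite -[m.+2%:R]natr1 -[m.+1%:R]natr1; lra.
Qed.

(** A count m means an angle in [-(m + 1)/2, -m/2[, the right end being attained only at time 0. The
    next angle is in ]-(m + 2)/2, -m/2[, and the sign of the first coordinate, corrected by (-1)^m,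
    tells on which side of -(m + 1)/2 it lies. At this value the image is vertical and the strict
    test adds nothing. *)
Lemma half_turnsP n z : - ((half_turns n z).+1%:R / 2) <= H_iter n z 0 <= - ((half_turns n z)%:R / 2) /\
  ((0 < n)%N -> H_iter n z 0 < - ((half_turns n z)%:R / 2)).
Proof.
elim: n => [|n [IH _]]; first by rewrite /= mul0r oppr0; split => //; lra.
set m := half_turns n z in IH *.
have /andP[s0 s1] := H_iter_step IH.
rewrite [half_turns n.+1 z]/=  -/m.
have hp := H_iter_vertical n.+1 z.
set a := H_iter n.+1 z 0 in s0 s1 hp *.
rewrite /vertical_image; set w := tangent_map _ _ _ in hp *.
suff : - ((m + ((-1) ^+ m * w.1 < 0)%R).+1%:R / 2) <= a < - ((m + ((-1) ^+ m * w.1 < 0)%R)%:R / 2).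
  by move=> /andP[-> a1]; rewrite a1 (ltW a1).
have [am|am|am] := ltgtP a (- (m.+1%:R / 2)).
- have pa : points_to ((a + m.+1%:R / 2) - m.+1%:R / 2) w by rewrite addrK.
  have := points_alternate pa; rewrite exprS mulN1r mulNr oppr_gt0.
  rewrite -[m.+2%:R]natr1 -[m.+1%:R]natr1 in s0 am *.
  move=> ->; last by lra.
  by rewrite addn1 -[m.+2%:R]natr1 -[m.+1%:R]natr1; lra.
- have pa : points_to ((a + m%:R / 2) - m%:R / 2) w by rewrite addrK.
  have := points_alternate pa; rewrite -[m.+1%:R]natr1 in am *.
  move=> h; have w0 : 0 < (-1) ^+ m * w.1 by apply: h; lra.
  have -> : ((-1) ^+ m * w.1 < 0) = false by apply/negbTE; rewrite -leNgt ltW.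
  rewrite addn0 -[m.+1%:R]natr1; clear -am s1; lra.
- rewrite am in hp; rewrite (points_half_fst hp) mulr0 ltxx addn0 am lexx /=.
  by rewrite -[m.+1%:R]natr1; lra.
Qed.

Lemma half_turns_le n z : (half_turns n z <= n)%N.
Proof. by elim: n => //= n IH; case: (_ < _)%R; rewrite ?addn1 ?addn0 ?ltnS// leqW. Qed.

(** The strict bound at time n yields a strict inequality between integers, which absorbs the extra
    1 in the lower bound at time n + k. Strictness fails at n = 0, a trivial case. *)
Lemma half_turns_super n k z : (half_turns n z + half_turns k (iter n f z) <= half_turns (n + k) z)%N.
Proof.
case: n => [|n]; first by rewrite add0n.
have [_ /(_ isT) a1] := half_turnsP n.+1 z.
have [/andP[_ b1] _] := half_turnsP k (iter n.+1 f z).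
have [/andP[c0 _] _] := half_turnsP (n.+1 + k) z.
have := H_iter_lt k (iter n.+1 f z) a1.
rewrite -H_iterD -sub0r H_iter_sub => h.
rewrite -ltnS -(ltr_nat R) natrD; lra.
Qed.

Lemma half_turns_sub n k z : (half_turns (n + k) z <= (half_turns n z + half_turns k (iter n f z)).+1)%N.
Proof.
case: k => [|k]; first by rewrite addn0 /= addn0.
have [/andP[a0 _] _] := half_turnsP n z.
have [/andP[b0 _] _] := half_turnsP k.+1 (iter n f z).
have [_ /(_ _)] := half_turnsP (n + k.+1) z; rewrite addnS => /(_ isT) c0.
have := H_iter_le k.+1 (iter n f z) a0.
rewrite -H_iterD -sub0r H_iter_sub addnS => h.
rewrite -ltnS -(ltr_nat R) -[_.+2%:R]natr1 -[_.+1%:R]natr1 natrD.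
rewrite -natr1 in b0; rewrite -natr1 in h; lra.
Qed.

Lemma half_turns_gt0 n z : (0 < n)%N -> vertical_image n z < 0 -> (0 < half_turns n z)%N.
Proof.
move=> n0 v0; rewrite lt0n; apply/eqP => e.
have [/andP[a0 _] /(_ n0)] := half_turnsP n z; rewrite e mul0r oppr0 => a1.
rewrite e in a0; have hp := H_iter_vertical n z.
move: v0; rewrite /vertical_image.
move: a0; rewrite le_eqVlt => /orP[/eqP a0|a0].
  by rewrite -a0 in hp; rewrite (points_half_fst hp) ltxx.
have := points_fst_gt0 hp; rewrite a1 andbT; move: a0; rewrite mul1r => -> /(_ isT).
by move=> h1 h2; have := lt_trans h1 h2; rewrite ltxx.
Qed.

(** The angle of u lies in ]0, 1/2[ and stays above that of the vertical, hence above -1/2. It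
    becomes negative at the first step, and from then on stays below the angle of a vertical started
    at f z, which is never positive. *)
Lemma tilted_stays_right z (u : P) n : (forall n, (0 < n)%N -> 0 <= vertical_image n z) ->
  u.1 < 0 -> 0 < (tangent_map f z u).1 -> (0 < n)%N -> 0 < (tangent_map (iter n f) z u).1.
Proof.
move=> v0 u0 Du n0.
have m0 k : half_turns k z = 0%N.
  elim: k => //= k ->; rewrite expr0 mul1r ltNge v0//.
have a0 k : - 2^-1 < H_iter k z 0.
  have [/andP[h _] _] := half_turnsP k.+1 z; rewrite m0 mul1r in h.
  (* [half_turnsP] gives only a weak bound, but reaching -1/2 at time k would push the angle
     strictly below -1/2 at time k + 1. *)
  rewrite ltNge; apply/negP => hk.
  have hk' : H_iter k z 0 <= - (1%:R / 2) by rewrite mul1r.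
  have le x y : x <= y -> H (iter k f z) x <= H (iter k f z) y.
    by rewrite le_eqVlt => /orP[/eqP -> //|/(H_lt (iter k f z))/ltW].
  have := le _ _ hk'; rewrite -sub0r H_sub mul1r.
  by have := H_vertical (iter k f z); move: h => /=; lra.
have un : u != 0 by apply/eqP => e; move: u0; rewrite e ltxx.
have [x0 px0] := points_exists un.
have [x xE px] : exists2 x, 0 < x < 2^-1 & points_to x u.
  pose y := x0 - (Num.floor x0)%:~R.
  have py : points_to y u by rewrite /y -rmorphN; apply: points_int => //; exact: intr_int.
  have /andP[f0 f1] := floor_itv x0; rewrite intrD in f1.
  have y01 : 0 <= y < 1 by rewrite /y; lra.
  exists y => //; apply/andP; split.
    rewrite lt_neqAle; have /andP[-> _] := y01; rewrite andbT; apply/eqP => e.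
    rewrite -e in py; have := @points_half_fst 0 u; rewrite mul0r oppr0 => /(_ py).
    by move=> e0; move: u0; rewrite e0 ltxx.
  rewrite ltNge le_eqVlt; apply/negP => /orP[/eqP e|h].
    have := @fst_points_half _ 1 _ _ py; rewrite -e mul1r => /(_ erefl (rpred1 _)) e0.
    by move: u0; rewrite e0 ltxx.
  have := points_fst_gt0 (points_int (rpredN1 _) py); rewrite (_ : _ < _ < _); last by lra.
  by move=> /(_ isT) h1; have := lt_trans h1 u0; rewrite ltxx.
have hx : H z x < 0.
  rewrite ltNge le_eqVlt; apply/negP => h.
  have [r r0 uE] := px.
  have pu : points_to (H z x) (tangent_map f z u) by rewrite uE tangentZ; apply: pointsZ.
  have h2 : H z x < 2^-1.
    have /(H_lt z) : x < 0 + 2^-1 by lra.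
    by rewrite H_half; have := H_vertical z; lra.
  move: h => /orP[/eqP e|h].
    rewrite -e in pu; have := @points_half_fst 0 _; rewrite mul0r oppr0 => /(_ _ pu) e0.
    by move: Du; rewrite e0 ltxx.
  have := points_fst_lt0 pu; rewrite h h2 => /(_ isT) h1.
  by have := lt_trans h1 Du; rewrite ltxx.
rewrite -(prednK n0); move: n.-1 => {n0}n.
have [r r0 uE] := px; have pu : points_to (H_iter n.+1 z x) (tangent_map (iter n.+1 f) z u).
  by rewrite uE tangentZ; apply: pointsZ => //; exact: H_iter_points.
apply: points_fst_gt0 pu _; apply/andP; split.
  by apply: lt_trans (a0 n.+1) _; apply: H_iter_lt; case/andP: xE.
have -> : H_iter n.+1 z x = H_iter n (f z) (H z x) by have := H_iterD 1 n z x; rewrite add1n.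
apply: lt_le_trans (H_iter_lt n (f z) hx) _.
have [/andP[_ h] _] := half_turnsP n (f z).
by apply: le_trans h _; rewrite oppr_le0 divr_ge0.
Qed.

End DirectionCocycle.

(** * Torsion as displacement of lifted angles *)

Section Torsion.
Context {R : realType}.
Local Notation A := (annulus R).
Local Notation P := (plane R).

Lemma theta_points x (w : P) : points_to x w -> theta w = circle_proj x.
Proof.
move=> pw; rewrite /theta /oriented_angle.
have rE a : rotate a ((0, 1) : P) = dir a.
  by apply: plane_eqP; rewrite /rotate /dir /= !mulr0 !mulr1 ?sub0r ?add0r.
set S := [set a : R | _].
have [r r0 e] : S (xget 0 S) by apply: (@xgetPex _ 0 S); case: pw => r r0 e; exists x, r => //; rewrite rE.
apply/circle_projP; apply: (points_uniq pw).
by exists r => //; rewrite -rE.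
Qed.

Lemma path_variationE (c : R -> circle R) (Th : R -> R) : continuous Th ->
  (forall t, 0 <= t <= 1 -> circle_proj (Th t) = c t) -> path_variation c = Th 1 - Th 0.
Proof.
move=> cT hT; rewrite /path_variation; set S := [set _ | _ in _].
have : S (xget 0 S).
  apply: (@xgetPex _ 0 S); exists (Th 1 - Th 0), Th => //; split => //.
  exact: continuous_subspaceT.
move=> [Th' [cT' hT'] <-].
have cg : continuous (fun t => Th' (clamp t) - Th t).
  move=> t; apply: (@cvgB _ R^o); last exact: cT.
  exact: (continuous_within_clamp cT').
have := int_valued_ends cg; rewrite !clampE ?in01_0 ?in01_1// => h.
suff e : Th' 1 - Th 1 = Th' 0 - Th 0 by lra.
apply: h => t t01; apply/circle_projP.
by rewrite clampE// hT// hT'.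
Qed.

Variables (I : R -> A -> A) (f : A -> A).
Hypothesis isoI : isotopy_from_id I f.
Hypothesis f_twist : positive_twist_map f.

Definition turn (z : A) (x : R) : R := xget 0 [set y | turns I z x y].

Lemma turnP z x : turns I z x (turn z x).
Proof. by have [y ty] := turns_exists isoI z x; apply: (@xgetPex _ 0 [set y | turns I z x y]); exists y. Qed.

Lemma turn_half z x : turn z (x + 2^-1) = turn z x + 2^-1.
Proof. exact: (turns_unique (turnP _ _) (turns_half (turnP z x))). Qed.

(** [turns_lt] compares directions less than half a turn apart; the general case first removes k
    half turns from y. *)
Lemma turn_lt z x y : x < y -> turn z x < turn z y.
Proof.
move=> xy.
have key (u v : R) : u < v < u + 2^-1 -> turn z u < turn z v.
  by move=> uv; have /andP[] := turns_lt isoI (turnP z u) (turnP z v) uv.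
have half (k : nat) u : turn z (u + k%:R / 2) = turn z u + k%:R / 2.
  elim: k => [|k IH]; first by rewrite mul0r !addr0.
  have e (v : R) : v + k.+1%:R / 2 = v + k%:R / 2 + 2^-1 by rewrite -natr1; field.
  by rewrite !e turn_half IH.
pose k := Num.truncn (2 * (y - x)).
have /truncn_itv : 0 <= 2 * (y - x) by lra.
rewrite -/k -[k.+1%:R]natr1 => /andP[k0 k1].
have -> : y = (y - k%:R / 2) + k%:R / 2 by rewrite subrK.
rewrite half.
have : x <= y - k%:R / 2 by lra.
rewrite le_eqVlt => /orP[/eqP e|lt].
  by rewrite -e ltrDl; lra.
apply: ltr_wpDr; first by rewrite divr_ge0.
by apply: key; lra.
Qed.

Lemma turn_points z x : points_to (turn z x) (tangent_map f z (dir x)).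
Proof. exact: (turns_end isoI (turnP z x)). Qed.

Lemma turn_vertical z : - 2^-1 < turn z 0 < 0.
Proof. exact: (turns_vertical isoI f_twist (turnP z 0)). Qed.

Lemma isotopy_C1 t : 0 <= t <= 1 -> annulus_C1 (I t).
Proof. by move=> t01; have [h _ _ _ _] := isoI; exact/annulus_C1_diffeo_C1/h. Qed.

Lemma f_C1 : annulus_C1 f.
Proof. by have [_ _ <- _ _] := isoI; apply: isotopy_C1; exact: in01_1. Qed.

Lemma extend_isotopyE (n : nat) (t : R) : n%:R <= t < n.+1%:R ->
  extend_isotopy I t = I (t - n%:R) \o iter n f.
Proof.
move=> tn; have [_ _ I1 _ _] := isoI.
by apply/funext => z; rewrite /extend_isotopy (truncn_def tn) I1.
Qed.

Lemma extended_turns n z x : exists Th : R -> R, [/\ continuous Th, Th 0 = x,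
  Th n%:R = H_iter f turn n z x &
  forall t, 0 <= t <= n%:R -> points_to (Th t) (tangent_map (extend_isotopy I t) z (dir x))].
Proof.
have [_ I0 _ _ _] := isoI.
have key (k : nat) : extend_isotopy I k%:R = iter k f.
  rewrite (@extend_isotopyE k); last by rewrite lexx ltr_nat ltnSn.
  by rewrite subrr I0.
elim: n => [|n [Th [cT T0 Tn hT]]].
  exists (cst x); split; [by move=> t; exact: cvg_cst|by []|by []|].
  move=> t; rewrite -eq_le => /eqP <-; rewrite (key 0%N) (tangent_id z).
  exact: points_dir.
have [Sh [cS S0 S1 hS]] := turnP (iter n f z) (H_iter f turn n z x).
(* Concatenation: Th is frozen after time n, and the turn of the next step starts there. *)
exists (fun t => Th (Num.min t n%:R) + (Sh (Num.max (t - n%:R) 0) - Sh 0)); split.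
- move=> t; apply: (@cvgD _ R^o).
    apply: (@continuous_comp _ _ _ (fun t : R => Num.min t n%:R) Th); last exact: cT.
    by apply: continuous_min; [exact: cvg_id|exact: cvg_cst].
  apply: (@cvgB _ R^o); last exact: cvg_cst.
  apply: (@continuous_comp _ _ _ (fun t : R => Num.max (t - n%:R) 0) Sh); last exact: cS.
  apply: continuous_max; last exact: cvg_cst.
  by apply: (@cvgB _ R^o); [exact: cvg_id|exact: cvg_cst].
- by rewrite min_l// max_r ?sub0r ?oppr_le0// subrr addr0.
- rewrite min_r ?ler_nat// -natr1 addrAC subrr add0r max_l// Tn S0 S1 /=.
  by rewrite addrCA subrr addr0.
move=> t /andP[t0 t1].
have [tn|tn] := leP t n%:R.
  rewrite max_r ?subr_le0// subrr addr0; apply: hT; by rewrite t0.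
have tn0 : 0 <= t - n%:R by rewrite subr_ge0 ltW.
rewrite max_l// Tn S0 addrCA subrr addr0.
rewrite -natr1 in t1.
(* For [truncn], the final time already belongs to the next unit interval. *)
have [te|te] := eqVneq t n.+1%:R.
  rewrite te key -natr1 addrAC subrr add0r S1.
  exact: (H_iter_points f_C1 turn_points n.+1).
have tin : n%:R <= t < n.+1%:R.
  by rewrite (ltW tn) lt_neqAle te -natr1.
rewrite (extend_isotopyE tin).
have t01 : 0 <= t - n%:R <= 1 by lra.
rewrite (tangent_comp z (dir x) (isotopy_C1 t01) (annulus_C1_iter n f_C1)).
have [r r0 ->] := H_iter_points f_C1 turn_points n z x.
by rewrite tangentZ; apply: pointsZ => //; exact: hS.
Qed.

Lemma torsion_n_turns n z (w : P) : w != 0 -> (0 < n)%N ->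
  exists x, n%:R * torsion_n I n z w = H_iter f turn n z x - x.
Proof.
move=> w0 n0; have [x px] := points_exists w0; exists x.
have [Th [cT T0 Tn hT]] := extended_turns n z x.
rewrite /torsion_n mulrA divff ?pnatr_eq0 -?lt0n// mul1r.
rewrite (@path_variationE _ (fun t => Th (n%:R * t))).
- by rewrite mulr1 mulr0 Tn T0.
- move=> t; apply: (@continuous_comp _ _ _ (fun t : R => n%:R * t) Th); last exact: cT.
  by apply: (@cvgM R R); [exact: cvg_cst|exact: cvg_id].
move=> t /andP[t0 t1]; apply/esym/theta_points.
have [r r0 ->] := px; rewrite tangentZ; apply: pointsZ => //; apply: hT.
by rewrite mulr_ge0//= -[leRHS]mulr1 ler_wpM2l.
Qed.

(** An error of at most 1 comes from replacing w by the vertical, and 1/2 from rounding its angle to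
    half turns. *)
Lemma torsion_n_half_turns n z (w : P) : w != 0 -> (0 < n)%N ->
  `|n%:R * torsion_n I n z w + (half_turns f n z)%:R / 2| <= 2.
Proof.
move=> w0 n0; have [x ->] := torsion_n_turns z w0 n0.
have h1 := H_iter_bounded f turn_lt turn_half n z x.
have [h2 _] := half_turnsP f_C1 turn_lt turn_half turn_points turn_vertical n z.
rewrite -natr1 in h2; rewrite ler_norml in h1; rewrite ler_norml; lra.
Qed.

End Torsion.
Section HalfTurns.
Context {R : realType}.
Local Notation A := (annulus R).
Local Notation P := (plane R).
Variable f : A -> A.
Hypothesis f_twist : positive_twist_map f.

Lemma twist_C1 : annulus_C1 f.
Proof. by have [/annulus_C1_diffeo_C1] := f_twist. Qed.

Lemma twist_half_turns_super n k z :
  (half_turns f n z + half_turns f k (iter n f z) <= half_turns f (n + k) z)%N.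
Proof.
have [_ [I isoI] _] := f_twist.
exact: (half_turns_super twist_C1 (turn_lt isoI) (turn_half isoI) (turn_points isoI) (turn_vertical isoI f_twist)).
Qed.

Lemma twist_half_turns_sub n k z :
  (half_turns f (n + k) z <= (half_turns f n z + half_turns f k (iter n f z)).+1)%N.
Proof.
have [_ [I isoI] _] := f_twist.
exact: (half_turns_sub twist_C1 (turn_lt isoI) (turn_half isoI) (turn_points isoI) (turn_vertical isoI f_twist)).
Qed.

Lemma twist_half_turns_gt0 n z : (0 < n)%N -> vertical_image f n z < 0 -> (0 < half_turns f n z)%N.
Proof.
have [_ [I isoI] _] := f_twist.
exact: (half_turns_gt0 twist_C1 (turn_lt isoI) (turn_half isoI) (turn_points isoI) (turn_vertical isoI f_twist)).
Qed.

Lemma twist_tilted_stays_right z (u : P) n :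
  (forall n, (0 < n)%N -> 0 <= vertical_image f n z) ->
  u.1 < 0 -> 0 < (tangent_map f z u).1 -> (0 < n)%N -> 0 < (tangent_map (iter n f) z u).1.
Proof.
have [_ [I isoI] _] := f_twist.
exact: (tilted_stays_right twist_C1 (turn_lt isoI) (turn_half isoI) (turn_points isoI) (turn_vertical isoI f_twist)).
Qed.

(** The two sequences differ by at most 2 / n. As half turns depend on no isotopy and no tangent
    vector, their limit governs all choices at once. *)
Lemma is_torsion_half_turns z (tau : R) : is_torsion f z tau <->
  - ((half_turns f n z)%:R / 2 / n%:R) @[n --> \oo] --> tau.
Proof.
have key I w : isotopy_from_id I f -> w != 0 ->
    (fun n => torsion_n I n z w - (- ((half_turns f n z)%:R / 2 / n%:R))) @ \oo --> (0 : R).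
  move=> isoI w0; apply: norm_cvg0.
  apply: (@squeeze_cvgr _ _ _ _ (cst 0) (fun n => 2 * n%:R^-1) _).
  - exists 1%N => // n /= n0; rewrite normr_ge0 /=.
    have np : 0 < n%:R :> R by rewrite ltr0n.
    have := torsion_n_half_turns isoI f_twist z w0 n0.
    set T := torsion_n _ _ _ _; set m := (half_turns f n z)%:R => h.
    rewrite ler_pdivlMr// -[X in _ * X <= _](gtr0_norm np) -normrM opprK.
    by rewrite mulrDl divfK ?gt_eqF// [T * _]mulrC.
  - exact: cvg_cst.
  - have i0 : (n%:R^-1 : R) @[n --> \oo] --> (0 : R).
      by have := @cvg_harmonic R; rewrite -(@cvg_shiftS _ (fun n => n%:R^-1 : R)); exact.
    have c2 : (2 : R) @[n --> \oo] --> (2 : R) by exact: cvg_cst.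
    have : (fun n => (2 : R) / n%:R) n @[n --> \oo] --> (2 * 0 : R) by exact: (cvgM c2 i0).
    by rewrite mulr0; exact.
split=> [[[I isoI] h]|h].
  have w0 : ((0, 1) : P) != 0 by apply/eqP => /(congr1 snd) /= /eqP; rewrite oner_eq0.
  apply: (@cvg_sub0 _ R^o _ _ _ _ (fun n => torsion_n I n z ((0, 1) : P))).
    have := key I _ isoI w0; move=> /(@cvgN _ R^o); rewrite oppr0.
    have eq (a b : nat -> R) : b - a = - (fun n => a n - b n).
      by apply/funext => n; rewrite !fctE opprB.
    by rewrite eq.
  by apply: h => //; exact/eqP.
have [_ iso _] := f_twist; split => // I isoI w /eqP w0.
by apply: (@cvg_sub0 _ R^o _ _ _ _ (fun n => - ((half_turns f n z)%:R / 2 / n%:R))) => //; exact: key.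
Qed.

End HalfTurns.

(** * Essential curves from connected sets *)

Section Grid.
Context {R : realType}.
Local Notation A := (annulus R).
Local Notation P := (plane R).
Variable W : set P.

Definition grid_point (N : nat) (v : int * int) : P :=
  (v.1%:~R / N%:R, v.2%:~R / N%:R).

(** The margin 2 / N leaves room for the edges of length 1 / N that start at the vertex. *)
Definition grid_good (N : nat) (v : int * int) : bool :=
  `[< forall q : P, `|q.1 - (grid_point N v).1| <= 2 / N%:R ->
        `|q.2 - (grid_point N v).2| <= 2 / N%:R -> W q >].

Definition grid_edge (N : nat) (u v : int * int) : bool :=
  [&& `|u.1 - v.1| + `|u.2 - v.2| == 1 :> int, grid_good N u & grid_good N v].

Definition grid_connected (N : nat) (u v : int * int) : Prop :=
  exists2 s, path (grid_edge N) u s & last u s = v.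

Definition grid_floor (N : nat) (p : P) : int * int :=
  (Num.floor (N%:R * p.1), Num.floor (N%:R * p.2)).

(** Asked for all fine meshes because the mesh needed depends on the points; transitivity takes the
    larger of two thresholds. *)
Definition grid_related (p q : P) : Prop :=
  exists N0, forall N, (N0 <= N)%N -> grid_connected N (grid_floor N p) (grid_floor N q).

Lemma grid_edge_sym N : symmetric (grid_edge N).
Proof.
move=> u v; rewrite /grid_edge [X in X && _]eq_sym [X in X && _]eq_sym.
by rewrite (distrC u.1) (distrC u.2); congr (_ && _); exact: andbC.
Qed.

Lemma grid_connected_trans N u v w :
  grid_connected N u v -> grid_connected N v w -> grid_connected N u w.
Proof.
move=> [s ps <-] [s' ps' <-]; exists (s ++ s'); last exact: last_cat.
by rewrite cat_path ps.
Qed.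

Lemma grid_connected_sym N u v : grid_connected N u v -> grid_connected N v u.
Proof.
move=> [s ps <-]; exists (rev (belast u s)).
  by rewrite rev_path (eq_path (e' := grid_edge N))// => x y; exact: grid_edge_sym.
case: s ps => //= x s _; rewrite rev_cons last_rcons//.
Qed.

Lemma grid_related_trans p q r : grid_related p q -> grid_related q r -> grid_related p r.
Proof.
move=> [N0 h0] [N1 h1]; exists (maxn N0 N1) => N; rewrite geq_max => /andP[n0 n1].
exact: grid_connected_trans (h0 N n0) (h1 N n1).
Qed.

Lemma grid_related_sym p q : grid_related p q -> grid_related q p.
Proof. by move=> [N0 h0]; exists N0 => N n0; exact/grid_connected_sym/h0. Qed.

Lemma grid_segment1 N (a b : int) (n : nat) :
  (forall k : nat, (k <= n)%N -> grid_good N (a + k%:Z, b)) ->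
  grid_connected N (a, b) (a + n%:Z, b).
Proof.
elim: n => [|n IH] h; first by exists [::] => //=; rewrite addr0.
apply: (@grid_connected_trans _ _ (a + n%:Z, b)); first by apply: IH => k kn; apply: h; rewrite leqW.
exists [:: (a + n.+1%:Z, b)] => //=; rewrite andbT; apply/and3P; split => /=; [|exact: h|exact: h].
by rewrite subrr; lia.
Qed.

Lemma grid_segment2 N (a b : int) (n : nat) :
  (forall k : nat, (k <= n)%N -> grid_good N (a, b + k%:Z)) ->
  grid_connected N (a, b) (a, b + n%:Z).
Proof.
elim: n => [|n IH] h; first by exists [::] => //=; rewrite addr0.
apply: (@grid_connected_trans _ _ (a, b + n%:Z)); first by apply: IH => k kn; apply: h; rewrite leqW.
exists [:: (a, b + n.+1%:Z)] => //=; rewrite andbT; apply/and3P; split => /=; [|exact: h|exact: h].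
by rewrite subrr; lia.
Qed.

(** The path is L-shaped: first horizontal, then vertical. *)
Lemma grid_box N (u v : int * int) :
  (forall c d : int, Num.min u.1 v.1 <= c <= Num.max u.1 v.1 ->
     Num.min u.2 v.2 <= d <= Num.max u.2 v.2 -> grid_good N (c, d)) ->
  grid_connected N u v.
Proof.
case: u v => [a b] [a' b'] /= h.
apply: (@grid_connected_trans _ _ (a', b)).
  have [le|le] := leP a a'.
    have -> : a' = a + `|a' - a|%N%:Z by lia.
    by apply: grid_segment1 => k hk; apply: h; lia.
  apply: grid_connected_sym; have -> : a = a' + `|a' - a|%N%:Z by lia.
  by apply: grid_segment1 => k hk; apply: h; lia.
have [le|le] := leP b b'.
  have -> : b' = b + `|b' - b|%N%:Z by lia.
  by apply: grid_segment2 => k hk; apply: h; lia.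
apply: grid_connected_sym; have -> : b = b' + `|b' - b|%N%:Z by lia.
by apply: grid_segment2 => k hk; apply: h; lia.
Qed.

Lemma grid_floor_near (N : nat) (x y : R) (c : int) (r : R) : (0 < N)%N ->
  `|x - y| < r -> Num.min (Num.floor (N%:R * x)) (Num.floor (N%:R * y)) <= c ->
  c <= Num.max (Num.floor (N%:R * x)) (Num.floor (N%:R * y)) ->
  `|c%:~R / N%:R - x| <= r + N%:R^-1.
Proof.
move=> N0 xy c0 c1.
have np : 0 < N%:R :> R by rewrite ltr0n.
have /andP[x0 x1] := floor_itv (N%:R * x); have /andP[y0 y1] := floor_itv (N%:R * y).
rewrite intrD in x1; rewrite intrD in y1.
have {}c0 : Num.min (Num.floor (N%:R * x))%:~R (Num.floor (N%:R * y))%:~R <= (c%:~R : R).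
  by move: c0; rewrite !ge_min !ler_int.
have {}c1 : (c%:~R : R) <= Num.max (Num.floor (N%:R * x))%:~R (Num.floor (N%:R * y))%:~R.
  by move: c1; rewrite !le_max !ler_int.
have e : c%:~R = N%:R * (c%:~R / N%:R) :> R by rewrite mulrCA divff ?mulr1// gt_eqF.
have e1 : N%:R * N%:R^-1 = 1 :> R by rewrite divff// gt_eqF.
set X := c%:~R / N%:R in e *.
move: x0 x1 y0 y1 c0 c1; rewrite e; set fx := (_%:~R : R); set fy := (_%:~R : R).
move=> x0 x1 y0 y1 c0 c1.
move: xy; rewrite !ltr_norml ler_norml => /andP[xy0 xy1].
move: c0 c1; rewrite ge_min le_max => /orP c0 /orP c1.
have l1 : N%:R * (x - r) <= N%:R * X + 1.
  by case: c0 => c0; have := ler_pM2l np; nra.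
have l2 : N%:R * X <= N%:R * (x + r).
  by case: c1 => c1; nra.
apply/andP; split.
  have : N%:R * (x - r) <= N%:R * (X + N%:R^-1) by rewrite [leRHS]mulrDr e1.
  by rewrite ler_pM2l//; lra.
move: l2; rewrite ler_pM2l// => l2.
have l3 : 0 < N%:R^-1 :> R by rewrite invr_gt0.
by lra.
Qed.

Lemma grid_related_near p : open W -> W p -> \forall q \near p, grid_related p q.
Proof.
rewrite openE => oW Wp; have /nbhs_ballP[r /= r0 rW] := oW p Wp.
apply/nbhs_ballP; exists (r / 2) => /=; first by rewrite divr_gt0.
move=> q [q1 q2].
(* 3 / N adds the rounding error 1 / N and the margin 2 / N of [grid_good]; the other half of r pays
   for the distance from p to q. *)
have [N0 hN0] : exists N0 : nat, forall N, (N0 <= N)%N -> (0 < N)%N /\ 3 / N%:R < r / 2.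
  have r6 : 0 < r / 6 by rewrite divr_gt0.
  have [N0 _ h] := near_infty_natSinv_lt (PosNum r6).
  exists N0.+1 => -[//|N]; rewrite ltnS => /h /= hN; split => //.
  have -> : r / 2 = 3 * (r / 6) by field.
  by rewrite ltr_pM2l.
exists N0 => N /hN0[N0' N3].
apply: grid_box => c d /andP[c0 c1] /andP[d0 d1].
have h1 := grid_floor_near N0' q1 c0 c1; have h2 := grid_floor_near N0' q2 d0 d1.
apply/asboolP => w w1 w2; apply: rW; rewrite /= in w1 w2.
move: h1 h2 w1 w2 N3; set i := N%:R^-1; set X := c%:~R / N%:R; set Y := d%:~R / N%:R => h1 h2 w1 w2 N3.
split; rewrite /ball /=.
  by move: h1 w1; rewrite ltr_norml !ler_norml; lra.
by move: h2 w2; rewrite ltr_norml !ler_norml; lra.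
Qed.

(** By [grid_related_near] the points of W related to p, and those not related to p, form two open
    sets; K cannot meet both. *)
Lemma grid_related_connected (K : set P) p q : open W -> connected K -> K `<=` W ->
  K p -> K q -> grid_related p q.
Proof.
move=> oW cK KW Kp Kq.
have op : open (W `&` [set x | grid_related p x]).
  rewrite openE => x [Wx px]; rewrite /interior /=.
  have h1 := grid_related_near oW Wx; have h2 : nbhs x W by apply: open_nbhs_nbhs.
  apply: filterS2 h1 h2 => y xy Wy; split => //.
  exact: grid_related_trans px xy.
have cl : open (W `&` [set x | ~ grid_related p x]).
  rewrite openE => x [Wx px]; rewrite /interior /=.
  have h1 := grid_related_near oW Wx; have h2 : nbhs x W by apply: open_nbhs_nbhs.
  apply: filterS2 h1 h2 => y xy Wy; split => // py; apply: px.
  exact/(grid_related_trans py)/grid_related_sym.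
have := cK (K `&` [set x | grid_related p x]) _ _ _.
move=> h; have : (K `&` [set x | grid_related p x]) q.
  rewrite h//.
  - exists p; split => //=; exists 0%N => N _; exists [::] => //.
  - exists (W `&` [set x | grid_related p x]) => //.
    apply/seteqP; split => x [Kx px]; [split => //; split => //; exact: KW|by case: px].
  - exists (~` (W `&` [set x | ~ grid_related p x])); first exact: open_closedC.
    apply/seteqP; split => x [Kx px]; split => //=; first by case.
    by apply: contrapT => n; apply: px; split => //; exact: KW.
by case.
Qed.

End Grid.

(** * The simple closed curve of a shortest grid loop *)

Section EssentialCurve.
Context {R : realType}.
Local Notation T := (circle R).
Local Notation A := (annulus R).
Local Notation P := (plane R).
Variables (W : set P) (N : nat).
Hypothesis N_gt2 : (2 < N)%N.

Definition grid_shift (j : int) (u : int * int) : int * int := (u.1 + j * N%:Z, u.2).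

Definition grid_loop (L : nat) : Prop := exists u s (j : int),
  [/\ path (grid_edge W N) u s, last u s = grid_shift j u, j != 0 & size s = L].

(* A grid path of minimal length from a vertex to one of its translates projects
   to a simple closed curve. *)
Variables (u0 : int * int) (s0 : seq (int * int)) (j0 : int).
Hypothesis loop_path : path (grid_edge W N) u0 s0.
Hypothesis loop_last : last u0 s0 = grid_shift j0 u0.
Hypothesis j0_neq0 : j0 != 0.
Hypothesis loop_min : forall L, grid_loop L -> (size s0 <= L)%N.

Let L := size s0.
Let v (i : nat) : int * int := nth u0 (u0 :: s0) i.

Lemma loop_edge i : (i < L)%N -> grid_edge W N (v i) (v i.+1).
Proof. by move=> iL; have /pathP := loop_path; apply. Qed.

Lemma v0 : v 0%N = u0. Proof. by []. Qed.

Lemma vL : v L = grid_shift j0 (v 0%N).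
Proof. by rewrite v0 -loop_last /v (last_nth u0). Qed.

(** If k = 0, cutting out the piece between a and b gives a shorter loop. Otherwise that piece is
    itself a loop, hence is the whole path. *)
Lemma loop_simple a b k : (a < b)%N -> (b <= L)%N -> v b = grid_shift k (v a) ->
  a = 0%N /\ b = L.
Proof.
move=> ab bL e.
pose s1 := take a s0; pose s2 := take (b - a) (drop a s0); pose s3 := drop b s0.
have es : s0 = s1 ++ s2 ++ s3.
  rewrite -[LHS](cat_take_drop a) /s1 /s2 /s3; congr (_ ++ _).
  by rewrite -[LHS](cat_take_drop (b - a)) drop_drop subnK// ltnW.
have sz1 : size s1 = a by rewrite size_takel// (leq_trans (ltnW ab)).
have sz2 : size s2 = (b - a)%N by rewrite size_takel// size_drop leq_sub2r.
have l1 : last u0 s1 = v a.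
  by rewrite (last_nth u0) sz1 /v es -cat_cons nth_cat /= sz1 ltnSn.
have l2 : last (v a) s2 = v b.
  rewrite -l1 -last_cat (last_nth u0) size_cat sz1 sz2 subnKC; last exact: ltnW.
  rewrite /v {1}es catA -[u0 :: (s1 ++ s2) ++ s3]cat_cons nth_cat /= size_cat sz1 sz2.
  by rewrite subnKC ?ltnSn// ltnW.
have := loop_path; rewrite {1}es !cat_path l1 l2 => /and3P[p1 p2 p3].
have sz : L = (a + (b - a) + size s3)%N by rewrite /L es !size_cat sz1 sz2 addnA.
have [k0|k0] := eqVneq k 0.
  have vab : v b = v a by rewrite e k0 /grid_shift mul0r addr0; case: (v a).
  have : grid_loop (a + size s3)%N.
    exists u0, (s1 ++ s3), j0; split => //.
    - by rewrite cat_path p1 l1 -vab.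
    - by rewrite last_cat l1 -vab -l2 -l1 -!last_cat -es.
    - by rewrite size_cat sz1.
  by move/loop_min; rewrite -/L sz => h; exfalso; move: h ab; lia.
have : grid_loop (b - a)%N.
  by exists (v a), s2, k; split => //; rewrite l2.
by move/loop_min; rewrite -/L => h; split; move: h ab bL; lia.
Qed.

Lemma loop_step i : (i < L)%N ->
  let d := ((v i.+1).1 - (v i).1, (v i.+1).2 - (v i).2) in
  (`|d.1| = 1 /\ d.2 = 0) \/ (d.1 = 0 /\ `|d.2| = 1).
Proof. by move=> /loop_edge /and3P[/eqP h _ _] /=; lia. Qed.

(** Each step moves the first coordinate by at most 1, and the total displacement is a nonzero
    multiple of N. *)
Lemma loop_size_gt2 : (2 < L)%N.
Proof.
have h i : (i <= L)%N -> `|(v i).1 - (v 0%N).1| <= i%:Z.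
  elim: i => [|i IH] iL; first by rewrite subrr normr0.
  by have := IH (ltnW iL); have := loop_step iL => /=; lia.
have := h L (leqnn L); rewrite vL /grid_shift /= addrC addKr normrM.
have : 1 <= `|j0| by rewrite -gtz0_ge1 normr_gt0.
move: N_gt2; nia.
Qed.

Definition vertex_point (w : int * int) : P := (w.1%:~R, w.2%:~R).

(* [clamp (t - i)] runs along the i-th edge while [t] is in [i, i + 1]. *)
Definition polygon (t : R) : P := vertex_point (v 0%N) +
  \sum_(i < L) clamp (t - i%:R) *: (vertex_point (v i.+1) - vertex_point (v i)).

Lemma polygonE i (r : R) : (i < L)%N -> 0 <= r <= 1 ->
  polygon (i%:R + r) = vertex_point (v i) + r *: (vertex_point (v i.+1) - vertex_point (v i)).
Proof.
move=> iL r01; rewrite /polygon.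
pose F k := clamp (i%:R + r - k%:R) *: (vertex_point (v k.+1) - vertex_point (v k)).
rewrite (eq_bigr (fun k : 'I_L => F k))// -(big_mkord xpredT F).
rewrite (big_cat_nat (n := i))//=; last exact: ltnW.
have -> : \sum_(0 <= k < i) F k = vertex_point (v i) - vertex_point (v 0%N).
  have <- : \sum_(0 <= k < i) (vertex_point (v k.+1) - vertex_point (v k)) = vertex_point (v i) - vertex_point (v 0%N).
    exact: (telescope_sumr (fun k => vertex_point (v k))).
  apply: eq_big_nat => k /andP[_ ki].
  rewrite /F clamp_ge1 ?scale1r//.
  have : (k.+1%:R : R) <= i%:R by rewrite ler_nat.
  by rewrite -natr1; lra.
have Fi : F i = r *: (vertex_point (v i.+1) - vertex_point (v i)).
  by rewrite /F [i%:R + r]addrC addrK clampE.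
rewrite big_ltn// Fi big_nat big1 ?addr0 => [|k /andP[ik _]]; first by rewrite addrA addrCA subrr addr0.
rewrite /F clamp_le0 ?scale0r//.
have : (i.+1%:R : R) <= k%:R by rewrite ler_nat.
by rewrite -natr1; lra.
Qed.

Lemma polygon_le0 t : t <= 0 -> polygon t = vertex_point (v 0%N).
Proof.
move=> t0; rewrite /polygon big1 ?addr0// => k _.
by rewrite clamp_le0 ?scale0r// subr_le0 (le_trans t0).
Qed.

Lemma polygon_geL t : L%:R <= t -> polygon t = vertex_point (v L).
Proof.
move=> tL; rewrite /polygon.
rewrite (eq_bigr (fun k : 'I_L => vertex_point (v k.+1) - vertex_point (v k))); last first.
  move=> k _; rewrite clamp_ge1 ?scale1r//.
  have : (k.+1%:R : R) <= L%:R by rewrite ler_nat.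
  by rewrite -natr1; lra.
rewrite -(big_mkord xpredT (fun k => vertex_point (v k.+1) - vertex_point (v k))) telescope_sumr//.
by rewrite addrCA subrr addr0.
Qed.

Lemma continuous_polygon : continuous polygon.
Proof.
move=> t; apply: (@cvgD _ P); first exact: cvg_cst.
pose F i (t : R) := clamp (t - i%:R) *: (vertex_point (v i.+1) - vertex_point (v i)).
have cF i : continuous (F i).
  move=> s; apply: (@cvgZr_tmp _ P).
  apply: (@continuous_comp _ _ _ (fun s : R => s - i%:R) (@clamp R)); last exact: continuous_clamp.
  by apply: (@cvgB _ R^o); [exact: cvg_id|exact: cvg_cst].
rewrite -/(F _ _); move: (L) => n; elim: n => [|n IH].
  rewrite big_ord0 (_ : (fun s => \sum_(i < 0) F i s) = cst 0); first exact: cvg_cst.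
  by apply/funext => s; rewrite big_ord0.
rewrite big_ord_recr /= (_ : (fun s => \sum_(i < n.+1) F i s) = (fun s => \sum_(i < n) F i s + F n s)).
  by apply: (@cvgD _ P); [exact: IH|exact: cF].
by apply/funext => s; rewrite big_ord_recr.
Qed.

(** The second alternative is the same unit edge run in the opposite direction. *)
Lemma segment_match (a a' e e' : int) (r r' : R) : `|e| = 1 -> `|e'| = 1 ->
  0 < r < 1 -> 0 < r' < 1 -> a'%:~R + r' * e'%:~R = a%:~R + r * e%:~R ->
  (a = a' /\ r = r') \/ (a' + e' = a /\ a + e = a').
Proof.
move=> e1 e'1 r01 r'01 h.
have ee : (e = 1 \/ e = -1) /\ (e' = 1 \/ e' = -1) by lia.
have key (k : int) (x : R) : k%:~R = x -> -1 < x < 1 -> k = 0.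
  move=> <- /andP[]; rewrite (_ : (-1 : R) = (-1)%:~R)// (_ : (1 : R) = 1%:~R)// !ltr_int; lia.
have key1 (k : int) (x : R) : k%:~R = x -> 0 < x < 2 -> k = 1.
  move=> kx x02; have := key (k - 1) (x - 1); rewrite rmorphB /= kx => /(_ erefl).
  by move=> h1; have h2 : k - 1 = 0 by [apply: h1; lra]; lia.
move: ee h => [[->|->] [->|->]]; rewrite ?rmorphN1 ?mulr1 ?mulrN1 => h.
- have e0 : a' - a = 0 by apply: (key _ (r - r')); rewrite ?rmorphB /=; lra.
  have aa : a = a' by lia.
  by left; split => //; rewrite aa in h; lra.
- have e0 : a' - a = 1 by apply: (key1 _ (r + r')); rewrite ?rmorphB /=; lra.
  by right; lia.
- have e0 : a - a' = 1 by apply: (key1 _ (r + r')); rewrite ?rmorphB /=; lra.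
  by right; lia.
- have e0 : a - a' = 0 by apply: (key _ (r - r')); rewrite ?rmorphB /=; lra.
  have aa : a = a' by lia.
  by left; split => //; rewrite aa in h; lra.
Qed.

Lemma int_segment (a a' e : int) (r : R) : `|e| = 1 -> 0 < r < 1 ->
  a'%:~R = a%:~R + r * e%:~R -> False.
Proof.
move=> e1 r01 h.
have ee : e = 1 \/ e = -1 by lia.
have key (k : int) (x : R) : k%:~R = x -> 0 < x < 1 -> False.
  by move=> <-; rewrite ltr0z (_ : (1 : R) = 1%:~R)// ltr_int; lia.
move: ee h => [->|->]; rewrite ?rmorphN1 ?mulr1 ?mulrN1 => h.
- by apply: (key (a' - a) r) => //; rewrite rmorphB /=; lra.
- by apply: (key (a - a') r) => //; rewrite rmorphB /=; lra.
Qed.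

Lemma loop_distinct i i' k : (i < L)%N -> (i' < L)%N -> v i' = grid_shift k (v i) -> i = i'.
Proof.
move=> iL i'L e; have [lt|lt|//] := ltngtP i i'.
  by have [_ ee] := loop_simple lt (ltnW i'L) e; move: i'L; rewrite ee ltnn.
have e' : v i = grid_shift (- k) (v i').
  by rewrite e /grid_shift /= mulNr addrK; case: (v i).
by have [_ ee] := loop_simple lt (ltnW iL) e'; move: iL; rewrite ee ltnn.
Qed.

(** An edge run backwards identifies each end of one edge with the opposite end of the other; by
    [loop_simple] this makes i and i' each the successor of the other along the closed loop, which
    requires at most two edges. *)
Lemma loop_no_back i i' k : (i < L)%N -> (i' < L)%N ->
  v i'.+1 = grid_shift k (v i) -> v i.+1 = grid_shift (- k) (v i') -> False.
Proof.
move=> iL i'L e1 e2; have L2 := loop_size_gt2.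
have alt j j' l : (j < L)%N -> (j' < L)%N -> v j'.+1 = grid_shift l (v j) ->
    j = j'.+1 \/ (j = 0%N /\ j'.+1 = L).
  move=> jL j'L e; have [lt|lt|->] := ltngtP j j'.+1; last by left.
    by right; exact: (loop_simple lt _ e).
  have e' : v j = grid_shift (- l) (v j'.+1).
    by rewrite e /grid_shift /= mulNr addrK; case: (v j).
  have [] := loop_simple lt (ltnW jL) e'; lia.
by have [] := alt i i' k iL i'L e1; have [] := alt i' i (- k) i'L iL e2; lia.
Qed.

(** Two vertices are told apart by [loop_distinct]. A vertex inside an edge, or perpendicular edges
    crossing inside, would put an integer strictly between consecutive ones. Parallel edges
    coincide, and [loop_no_back] excludes opposite directions. *)
Lemma polygon_inj t t' (k : int) : 0 <= t < L%:R -> 0 <= t' < L%:R ->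
  polygon t' = polygon t + (((k * N%:Z)%:~R, 0) : P) -> t = t'.
Proof.
have dec s : 0 <= s < L%:R -> exists i (r : R), [/\ (i < L)%N, 0 <= r < 1 & s = i%:R + r].
  move=> /andP[sge0 sL]; have /andP[s1 s2] := truncn_itv sge0.
  exists (Num.truncn s), (s - (Num.truncn s)%:R); split.
  - by rewrite -(ltr_nat R); apply: le_lt_trans sL.
  - by rewrite -natr1 in s2; lra.
  - by rewrite addrC subrK.
move=> /dec[i [r [iL r01 ->]]] /dec[i' [r' [i'L r'01 ->]]].
rewrite !polygonE//; [|lra|lra] => e.
have e1 := congr1 fst e; have e2 := congr1 snd e; move: e1 e2 => /=.
rewrite !scaleRE -!rmorphB addr0 addrAC -rmorphD /= => e1 e2.
have st := loop_step iL; have st' := loop_step i'L; move: st st' => /=.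
set a := v i in e1 e2 *; set b := v i.+1 in e1 e2 *.
set a' := v i' in e1 e2 *; set b' := v i'.+1 in e1 e2 *.
move=> st st'.
have vE (c c' : int * int) l : c'.1 = c.1 + l * N%:Z -> c'.2 = c.2 -> c' = grid_shift l c.
  by case: c c' => [? ?] [? ?] /= -> ->.
have same : a' = grid_shift k a -> r = r' -> i%:R + r = i'%:R + r'.
  by move=> /(loop_distinct iL i'L) -> ->.
have [r0|rn] := eqVneq r 0; have [r'0|r'n] := eqVneq r' 0.
- apply: same; last by rewrite r0 r'0.
  rewrite r0 r'0 !mul0r !addr0 in e1 e2.
  by apply: vE; [exact: intr_inj e1|exact: intr_inj e2].
- have r'02 : 0 < r' < 1 by rewrite lt_neqAle eq_sym r'n /=; lra.
  rewrite r0 !mul0r !addr0 in e1 e2.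
  by exfalso; move: st' => [[h _]|[_ h]]; [exact: (int_segment h r'02 (esym e1))|exact: (int_segment h r'02 (esym e2))].
- have r02 : 0 < r < 1 by rewrite lt_neqAle eq_sym rn /=; lra.
  rewrite r'0 !mul0r !addr0 in e1 e2.
  by exfalso; move: st => [[h _]|[_ h]]; [exact: (int_segment h r02 e1)|exact: (int_segment h r02 e2)].
have r02 : 0 < r < 1 by rewrite lt_neqAle eq_sym rn /=; lra.
have r'02 : 0 < r' < 1 by rewrite lt_neqAle eq_sym r'n /=; lra.
move: st st' => [[h1 h2]|[h1 h2]] [[h1' h2']|[h1' h2']].
- have c2 : a'.2 = a.2 by move: e2; rewrite h2 h2' !mulr0 !addr0; exact: intr_inj.
  have [[c1 rr]|[c1 c1']] := segment_match h1 h1' r02 r'02 e1.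
    by apply: same => //; apply: vE; rewrite // c1.
  exfalso; apply: (@loop_no_back i i' k) => //; apply: vE; rewrite -/a -/b -/a' -/b'; clear -c1 c1' c2 h2 h2'; lia.
- exfalso; rewrite h2 mulr0 addr0 in e2; exact: (int_segment h2' r'02 (esym e2)).
- exfalso; rewrite h2' mulr0 addr0 in e2; exact: (int_segment h2 r02 e2).
- have c1 : a'.1 = a.1 + k * N%:Z by move: e1; rewrite h1 h1' !mulr0 !addr0; exact: intr_inj.
  have [[c2 rr]|[c2 c2']] := segment_match h2 h2' r02 r'02 e2.
    by apply: same => //; apply: vE.
  exfalso; apply: (@loop_no_back i i' k) => //; apply: vE; rewrite -/a -/b -/a' -/b'; clear -c1 c2 c2' h1 h1'; lia.
Qed.

Definition loop_lift (t : R) : P := N%:R^-1 *: polygon (L%:R * t).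

Lemma N_gt0 : 0 < N%:R :> R.
Proof. by rewrite ltr0n (leq_trans _ N_gt2). Qed.

Lemma L_gt0 : 0 < L%:R :> R.
Proof. by rewrite ltr0n (leq_trans _ loop_size_gt2). Qed.

Lemma continuous_loop_lift : continuous loop_lift.
Proof.
move=> t; apply: (@cvgZl_tmp _ P).
apply: (@continuous_comp _ _ _ (fun t : R => L%:R * t) polygon); last exact: continuous_polygon.
by apply: (@cvgM R R); [exact: cvg_cst|exact: cvg_id].
Qed.

Lemma loop_lift_le0 t : t <= 0 -> loop_lift t = loop_lift 0.
Proof.
by move=> t0; rewrite /loop_lift mulr0 !polygon_le0// mulr_ge0_le0// ltW// L_gt0.
Qed.

Lemma loop_lift_ge1 t : 1 <= t -> loop_lift t = loop_lift 1.
Proof.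
by move=> t1; rewrite /loop_lift mulr1 !polygon_geL// -[leLHS]mulr1 ler_pM2l// L_gt0.
Qed.

Lemma loop_lift1 : loop_lift 1 = shift_by j0 (loop_lift 0).
Proof.
rewrite /loop_lift mulr1 mulr0 polygon_geL// polygon_le0// vL.
have := N_gt0 => n0; apply: plane_eqP; rewrite /= !scaleRE// rmorphD rmorphM /=.
by field; rewrite gt_eqF.
Qed.

Lemma loop_lift_inj t t' k : 0 <= t < 1 -> 0 <= t' < 1 ->
  loop_lift t' = shift_by k (loop_lift t) -> t = t'.
Proof.
move=> t01 t'01 e; have L0 := L_gt0; have n0 := N_gt0.
apply: (mulfI (lt0r_neq0 L0)); apply: (@polygon_inj _ _ k).
- case/andP: t01 => a b; apply/andP; split; first by apply: mulr_ge0 => //; exact: ltW.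
  by rewrite -[ltRHS]mulr1 ltr_pM2l.
- case/andP: t'01 => a b; apply/andP; split; first by apply: mulr_ge0 => //; exact: ltW.
  by rewrite -[ltRHS]mulr1 ltr_pM2l.
apply: (scalerI (invr_neq0 (lt0r_neq0 n0))); rewrite -/(loop_lift t') e shift_byE scalerDr.
congr (_ + _); apply: plane_eqP; rewrite /= !scaleRE ?mulr0// rmorphM /=.
by field; rewrite gt_eqF.
Qed.

Lemma loop_lift_in t : 0 <= t <= 1 -> W (loop_lift t).
Proof.
move=> /andP[t0 t1]; have L0 := L_gt0; have n0 := N_gt0.
have [i [r [iL r01 e]]] : exists i (r : R), [/\ (i < L)%N, 0 <= r <= 1 & L%:R * t = i%:R + r].
  have [t1'|t1'] := eqVneq t 1.
    have l0 : (0 < L)%N by rewrite (leq_trans _ loop_size_gt2).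
    exists L.-1, 1; split; [by rewrite prednK|exact: in01_1|].
    by rewrite t1' mulr1 natr1 prednK.
  have s0' : 0 <= L%:R * t by apply: mulr_ge0 => //; exact: ltW.
  have sL : L%:R * t < L%:R by rewrite -[ltRHS]mulr1 ltr_pM2l// lt_neqAle t1'.
  have /andP[s1 s2] := truncn_itv s0'; set i := Num.truncn _ in s1 s2.
  exists i, (L%:R * t - i%:R); split.
  - by rewrite -(ltr_nat R); apply: le_lt_trans sL.
  - by rewrite -natr1 in s2; lra.
  - by rewrite addrC subrK.
rewrite /loop_lift e polygonE//.
have /and3P[_ /asboolP g _] := loop_edge iL.
have st := loop_step iL.
have key (d : int) (x : R) : `|d| <= 1 -> `|N%:R^-1 * (x + r * d%:~R) - x / N%:R| <= 2 / N%:R.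
  move=> d1; have -> : N%:R^-1 * (x + r * d%:~R) - x / N%:R = (r * d%:~R) / N%:R.
    by field; rewrite gt_eqF.
  rewrite normrM [`|N%:R^-1|]gtr0_norm ?invr_gt0// ler_pM2r ?invr_gt0//.
  have : `|d%:~R| <= (1 : R) by rewrite -intr_norm (_ : (1 : R) = 1%:~R)// ler_int.
  have h0 := normr_ge0 (d%:~R : R); move=> h1.
  by rewrite normrM [`|r|]ger0_norm; [nra|lra].
apply: g; rewrite /= scaleRE -rmorphB; apply: key; move: st => /=; lia.
Qed.

Definition loop_frac (x : R) : R := x - (Num.floor x)%:~R.

Lemma loop_frac_itv x : 0 <= loop_frac x < 1.
Proof. by rewrite /loop_frac; have := floor_itv x; rewrite intrD; lra. Qed.

Lemma loop_frac_uniq x y : 0 <= y < 1 -> x - y \is a Num.int -> loop_frac x = y.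
Proof.
move=> y01 /intrP[k e]; rewrite /loop_frac.
have -> : Num.floor x = k.
  by apply: floor_def; rewrite intrD; lra.
by rewrite -e opprB addrC subrK.
Qed.

Definition loop_curve (s : T) : A := annulus_proj (loop_lift (loop_frac (repr s))).

Lemma loop_curveE x : loop_curve (circle_proj x) = annulus_proj (loop_lift (loop_frac x)).
Proof.
rewrite /loop_curve; congr (annulus_proj (loop_lift _)).
apply: loop_frac_uniq; first exact: loop_frac_itv.
have /circle_projP : circle_proj (repr (circle_proj x)) = circle_proj x by exact: circle_proj_repr.
rewrite /loop_frac opprB addrCA => h; apply: rpredD => //; exact: intr_int.
Qed.

Lemma continuous_loop_curve : continuous loop_curve.
Proof.
apply/(@quotient_continuous R) => x0.
pose k : R := (Num.floor x0)%:~R.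
have kint : k \is a Num.int by exact: intr_int.
have := floor_itv x0; rewrite intrD -/k => k01.
(* [loop_lift] is constant outside of [0, 1]: on the right of k this is the current turn, on the
   left it is the previous turn translated by - j0. The formula is continuous across k without any
   case distinction. *)
pose g (x : R) := loop_lift (x - k) + loop_lift (1 + (x - k)) - loop_lift 1.
have cg : continuous g.
  have cs : continuous (fun x : R => x - k).
    by move=> x; apply: (@cvgB _ R^o); [exact: cvg_id|exact: cvg_cst].
  move=> x; apply: (@cvgB _ P); last exact: cvg_cst.
  apply: (@cvgD _ P).
    by apply: (@continuous_comp _ _ _ (fun x : R => x - k) loop_lift); [exact: cs|exact: continuous_loop_lift].
  apply: (@continuous_comp _ _ _ (fun x : R => 1 + (x - k)) loop_lift); last exact: continuous_loop_lift.
  by apply: (@cvgD _ R^o); [exact: cvg_cst|exact: cs].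
have eg x : `|x - x0| < k + 1 - x0 -> loop_curve (circle_proj x) = annulus_proj (g x).
  rewrite ltr_norml => xk; rewrite loop_curveE /g.
  have [kx|xk'] := leP k x.
    rewrite (@loop_lift_ge1 (1 + _)) ?addrK; last by rewrite lerDl subr_ge0.
    by rewrite (@loop_frac_uniq _ (x - k))//; [lra|rewrite opprB addrC subrK].
  rewrite (@loop_lift_le0 (x - k)); last by lra.
  rewrite (@loop_frac_uniq _ (1 + (x - k))); last 2 first.
  - by lra.
  - by rewrite (_ : x - (1 + (x - k)) = k - 1) ?rpredB ?rpred1//; ring.
  apply/annulus_projP; exists (- j0); rewrite shift_byE loop_lift1 shift_byE opprD addrACA addrA.
  rewrite subrr add0r; congr (_ + _).
  by apply: plane_eqP; rewrite /= ?oppr0// rmorphN.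
apply: (@cvg_trans _ ((@annulus_proj R \o g) x @[x --> x0])).
  apply: near_eq_cvg.
  have d0 : 0 < k + 1 - x0 by lra.
  apply/nbhs_ballP; exists (k + 1 - x0) => //= x; rewrite /ball /= distrC => /eg <-.
  by [].
have e0 : loop_curve (circle_proj x0) = annulus_proj (g x0).
  by apply: eg; rewrite subrr normr0; lra.
suff : (@annulus_proj R \o g) x @[x --> x0] --> annulus_proj (g x0) by rewrite -e0.
by apply: (@continuous_comp _ _ _ g (@annulus_proj R)); [exact: cg|exact: continuous_annulus_proj].
Qed.

Lemma loop_curve_inj : injective loop_curve.
Proof.
move=> s s'; rewrite /loop_curve => /annulus_projP[k e].
have h := loop_lift_inj (loop_frac_itv _) (loop_frac_itv _) e.
rewrite -(circle_proj_repr s) -(circle_proj_repr s'); apply/circle_projP.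
have -> : repr s - repr s' = (Num.floor (repr s))%:~R - (Num.floor (repr s'))%:~R :> R.
  by move: h; rewrite /loop_frac; lra.
by apply: rpredB; exact: intr_int.
Qed.

(** The number of turns of the first coordinate along the closed curve is an integer that varies
    continuously in a homotopy; it is j0 for the loop and 0 for a constant curve. *)
Lemma loop_curve_essential : ~ homotopic_to_point loop_curve.
Proof.
move=> [H [cH H0 [z H1]]].
pose w (y : R * R) : P := circle_dir (H (clamp y.1, circle_proj y.2)).1.
have cw : continuous w.
  have cHc : continuous (fun y : R * R => H (clamp y.1, circle_proj y.2)).
    apply: (continuous_comp_within (h := fun y : R * R => (clamp y.1, circle_proj y.2)) _ _ cH).
      move=> y; apply: (@continuous_pair _ _ _ (fun y : R * R => clamp y.1) (fun y : R * R => circle_proj y.2)).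
        by apply: (@continuous_comp _ _ _ fst (@clamp R)); [exact: cvg_fst|exact: continuous_clamp].
      by apply: (@continuous_comp _ _ _ snd (@circle_proj R)); [exact: cvg_snd|exact: continuous_circle_proj].
    by move=> y; exact: clamp_itv.
  move=> y; apply: (@continuous_comp _ _ _ (fun y => (H (clamp y.1, circle_proj y.2)).1) circle_dir); last exact: continuous_circle_dir.
  by apply: (@continuous_comp _ _ _ (fun y => H (clamp y.1, circle_proj y.2)) fst); [exact: cHc|exact: cvg_fst].
have w0 y : w y != 0 by exact: dir_neq0.
have [Th cTh hTh] := angle_lift_square cw w0.
have cT1 x : continuous (fun s => Th (s, x)).
  move=> s; apply: (@continuous_comp _ _ _ (fun s : R => (s, x)) Th); last exact: cTh.
  by apply: continuous_pair; [exact: cvg_id|exact: cvg_cst].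
have cT2 s : continuous (fun x => Th (s, x)).
  move=> x; apply: (@continuous_comp _ _ _ (fun x : R => (s, x)) Th); last exact: cTh.
  by apply: continuous_pair; [exact: cvg_cst|exact: cvg_id].
have p01 : circle_proj 1 = circle_proj 0 :> T by apply/circle_projP; rewrite subr0 rpred1.
have e1 : Th (1, 1) - Th (1, 0) = Th (0, 1) - Th (0, 0).
  apply: (@int_valued_ends _ (fun s => Th (s, 1) - Th (s, 0))).
    by move=> s; apply: (@cvgB _ R^o); exact: cT1.
  move=> s s01; apply: points_uniq (hTh s 0 s01 in01_0) _.
  by have := hTh s 1 s01 in01_1; rewrite /w /= p01.
have e2 : Th (1, 1) = Th (1, 0).
  have [x0 px0] := points_exists (w0 (1, 0)).
  have := @int_valued_level _ (cst x0) (fun x => Th (1, x)) (fun x => w (1, x)) 1 _ (cT2 1) _ in01_1.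
  move=> h; apply: (addIr (- x0)); apply: h; first by move=> t; exact: cvg_cst.
  move=> x x01; split; last exact: hTh in01_1 x01.
  by move: px0; rewrite /w /= clampE ?in01_1// !H1.
have e3 : Th (0, 1) - (loop_lift 1).1 = Th (0, 0) - (loop_lift 0).1.
  have cl : continuous (fun x => (loop_lift x).1 : R).
    by move=> x; exact: (continuous_fst_plane (@continuous_loop_lift x)).
  have := @int_valued_level _ (fun x => (loop_lift x).1) (fun x => Th (0, x)) (fun x => w (0, x)) 1 cl (cT2 0) _ in01_1.
  apply=> x x01; split; last exact: hTh in01_0 x01.
  have -> : w (0, x) = circle_dir (loop_curve (circle_proj x)).1.
    by rewrite /w -[clamp _]/(clamp 0) clampE ?in01_0// H0.
  rewrite loop_curveE (circle_dirE (loop_lift (loop_frac x)).1).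
  have [->|x1] := eqVneq x 1.
    have -> : loop_frac 1 = 0 by apply: loop_frac_uniq; [lra|rewrite subr0 rpred1].
    have -> : (loop_lift 1).1 = (loop_lift 0).1 + j0%:~R by rewrite loop_lift1.
    by rewrite -(dirDint (loop_lift 0).1 (intr_int R j0)); exact: points_dir.
  have -> : loop_frac x = x.
    apply: loop_frac_uniq; last by rewrite subrr rpred0.
    by move: x01 => /andP[-> ?] /=; rewrite lt_neqAle x1.
  exact: points_dir.
have e4 : (loop_lift 1).1 = (loop_lift 0).1 + j0%:~R by rewrite loop_lift1.
have : (j0%:~R : R) = 0 by lra.
by move/eqP; rewrite intr_eq0 (negbTE j0_neq0).
Qed.

Lemma loop_essential (U : set A) : W = @annulus_proj R @^-1` U -> essential U.
Proof.
move=> WU; exists loop_curve.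
  split; last exact: loop_curve_essential.
  by apply: circle_embedding; [exact: annulus_hausdorff|exact: loop_curve_inj|exact: continuous_loop_curve].
move=> _ [s _ <-]; have : W (loop_lift (loop_frac (repr s))).
  by apply: loop_lift_in; have := loop_frac_itv (repr s); lra.
by rewrite WU.
Qed.

End EssentialCurve.

Lemma essential_of_connected (R : realType) (U : set (annulus R)) (K : set (plane R)) p j :
  open U -> connected K -> K `<=` @annulus_proj R @^-1` U ->
  K p -> K (shift_by j p) -> j != 0 -> essential U.
Proof.
move=> /open_annulus oU cK KU Kp Kjp j0.
have [N0 h] := grid_related_connected oU cK KU Kp Kjp.
pose N := maxn N0 3; have N2 : (2 < N)%N by rewrite leq_max orbT.
have [s ps ls] := h N (leq_maxl _ _).
set W := _ @^-1` _ in ps.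
have ex : exists L, `[< grid_loop W N L >].
  exists (size s); apply/asboolP; exists (grid_floor N p), s, j; split => //.
  rewrite ls /grid_floor /grid_shift /=; congr pair.
  rewrite mulrDr (_ : N%:R * j%:~R = (j * N%:Z)%:~R); last by rewrite rmorphM /= mulrC.
  rewrite floorDrz ?intr_int//; congr (_ + _); apply: floor_def.
  by rewrite lexx intrD ltrDl ltr01.
case: (ex_minnP ex) => L /asboolP[u [s1 [j1 [ps1 ls1 j1n sz]]]] mn.
have lm L' : grid_loop W N L' -> (size s1 <= L')%N.
  by move=> g; rewrite sz; apply: mn; apply/asboolP.
exact: (loop_essential N2 ps1 ls1 j1n lm erefl).
Qed.

(** * Birkhoff averages *)

Section Ergodic.
Context {d : measure_display} {X : measurableType d} {R : realType}.
Variable mu : {finite_measure set X -> \bar R}.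
Variable T : X -> X.
Hypothesis T_meas : measurable_fun setT T.
Hypothesis T_inv : forall B, measurable B -> mu (T @^-1` B) = mu B.
Implicit Types (g phi : X -> R) (E : set X).

Definition bounded_measurable g : Prop :=
  measurable_fun setT g /\ exists C, forall x, `|g x| <= C.

Definition birkhoff phi (n : nat) (x : X) : R := \sum_(i < n) phi (iter i T x).

(** The maximum of the Birkhoff sums of lengths 0 to n, in the recursive form that the maximal
    inequality uses. *)
Fixpoint birkhoff_max g (n : nat) (x : X) : R :=
  if n is n'.+1 then Num.max 0 (g x + birkhoff_max g n' (T x)) else 0.

Local Notation expect g := (\int[mu]_x (g : X -> R) x)%R (only parsing).

Lemma bounded_integrable g : bounded_measurable g -> mu.-integrable setT (EFin \o g).
Proof.
move=> [mg [C gC]]; apply: measurable_bounded_integrable => //.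
  by have /fin_numPlt/andP[] := fin_num_measure mu setT measurableT.
exists C; split; first exact: num_real.
by move=> D CD x _; exact: le_trans (gC x) (ltW CD).
Qed.

Lemma bounded_measurableD g h : bounded_measurable g -> bounded_measurable h ->
  bounded_measurable (fun x => g x + h x).
Proof.
move=> [mg [C gC]] [mh [D hD]]; split; first exact: measurable_funD.
by exists (C + D) => x; apply: le_trans (ler_normD _ _) _; exact: lerD.
Qed.

Lemma bounded_measurableM g h : bounded_measurable g -> bounded_measurable h ->
  bounded_measurable (fun x => g x * h x).
Proof.
move=> [mg [C gC]] [mh [D hD]]; split; first exact: measurable_funM.
by exists (C * D) => x; rewrite normrM ler_pM.
Qed.

Lemma bounded_measurable_cst (c : R) : bounded_measurable (fun _ => c).
Proof. by split; [exact: measurable_cst|exists `|c|]. Qed.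

Lemma bounded_measurableN g : bounded_measurable g -> bounded_measurable (fun x => - g x).
Proof.
move=> [mg [C gC]]; split; first exact: measurableT_comp.
by exists C => x; rewrite normrN.
Qed.

Lemma bounded_measurable_indic E : measurable E -> bounded_measurable (\1_E : X -> R).
Proof.
move=> mE; split; first exact: measurable_indic.
by exists 1 => x; rewrite indicE; case: (_ \in _); rewrite ?normr1 ?normr0.
Qed.

Lemma bounded_measurable_comp g : bounded_measurable g -> bounded_measurable (g \o T).
Proof.
move=> [mg [C gC]]; split; first exact: measurableT_comp.
by exists C => x; exact: gC.
Qed.

Lemma bounded_measurable_iter g n : bounded_measurable g -> bounded_measurable (fun x => g (iter n T x)).
Proof.
elim: n g => [//|n IH] g bg.
by have := IH _ (bounded_measurable_comp bg).
Qed.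

Lemma bounded_measurable_birkhoff phi n : bounded_measurable phi -> bounded_measurable (birkhoff phi n).
Proof.
move=> bphi; elim: n => [|n IH].
  rewrite (_ : birkhoff phi 0 = fun _ => 0); first exact: bounded_measurable_cst.
  by apply/funext => x; rewrite /birkhoff big_ord0.
rewrite (_ : birkhoff phi n.+1 = fun x => birkhoff phi n x + phi (iter n T x)).
  exact: bounded_measurableD IH (bounded_measurable_iter n bphi).
by apply/funext => x; rewrite /birkhoff big_ord_recr.
Qed.

Lemma bounded_measurable_birkhoff_max g n : bounded_measurable g -> bounded_measurable (birkhoff_max g n).
Proof.
move=> bg; elim: n => [|n IH]; first exact: bounded_measurable_cst.
have [m1 [C hC]] := bounded_measurableD bg (bounded_measurable_comp IH).
split; first by apply: measurable_maxr => //; exact: measurable_cst.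
exists C => x /=; have := hC x; rewrite !ler_norml /= => /andP[h1 h2].
by rewrite le_max ge_max; apply/andP; split; [lra|apply/andP; split; [lra|exact: h2]].
Qed.

Lemma Rintegral_invariant g : bounded_measurable g -> expect (g \o T) = expect g.
Proof.
move=> bg; rewrite /Rintegral; congr fine.
have [mg _] := bg.
have mEg : measurable_fun setT (fun x => (g x)%:E) by exact/measurable_EFinP.
have := @integral_pushforward _ _ X X R T T_meas mu setT (fun x => (g x)%:E) mEg _ measurableT.
rewrite preimage_setT => <-; last exact: (bounded_integrable (bounded_measurable_comp bg)).
apply: eq_measure_integral => B mB _.
exact: T_inv.
Qed.

Lemma birkhoffS phi n x : birkhoff phi n.+1 x = phi x + birkhoff phi n (T x).
Proof.
rewrite /birkhoff big_ord_recl /=; congr (_ + _).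
by apply: eq_bigr => i _; rewrite -iterSr.
Qed.

Lemma birkhoff_max_ge0 g n x : 0 <= birkhoff_max g n x.
Proof. by case: n => //= n; rewrite le_max lexx. Qed.

Lemma birkhoff_max_mono g n x : birkhoff_max g n x <= birkhoff_max g n.+1 x.
Proof.
elim: n x => [|n IH] x; first exact: birkhoff_max_ge0.
by rewrite [leRHS]/= [leLHS]/= ge_max !le_max lexx lerD2l IH orbT.
Qed.

Lemma birkhoff_max_le g n m x : (n <= m)%N -> birkhoff_max g n x <= birkhoff_max g m x.
Proof.
move=> /subnK <-; elim: (m - n)%N => [//|k IH].
by rewrite addSn; exact: le_trans IH (birkhoff_max_mono _ _ _).
Qed.

Lemma birkhoff_le_max g n x : birkhoff g n x <= birkhoff_max g n x.
Proof.
elim: n x => [|n IH] x; first by rewrite /birkhoff big_ord0.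
by rewrite birkhoffS /= le_max lerD2l IH orbT.
Qed.

(* Garsia's argument: where the maximum is positive it is at most g plus the
   maximum taken along the orbit of T x. *)
Lemma maximal_ergodic g E : bounded_measurable g -> measurable E -> T @^-1` E = E ->
  (forall x, E x -> exists n, 0 < birkhoff g n x) -> 0 <= expect (fun x => g x * \1_E x).
Proof.
move=> bg mE TE hE.
have b1E := bounded_measurable_indic mE.
have bgE := bounded_measurableM bg b1E.
pose P n := E `&` [set x | 0 < birkhoff_max g n x].
have mP n : measurable (P n).
  have [mM _] := bounded_measurable_birkhoff_max n bg.
  have -> : P n = E `\` (E `&` [set x | birkhoff_max g n x <= 0]).
    rewrite setDIr setDv set0U; apply/seteqP; split => x [xE Mx]; split => //=; apply/negP; rewrite -?ltNge//.
    by move: Mx => /= /negP; rewrite -ltNge => ->.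
  apply: measurableD => //; apply: measurable_fun_le => //.
  exact: measurable_funTS.
have b1P n := bounded_measurable_indic (mP n).
have garsia n : 0 <= expect (fun x => g x * \1_(P n) x).
  have bM := bounded_measurable_birkhoff_max n bg.
  have bME := bounded_measurableM bM b1E.
  have bMET := bounded_measurable_comp bME.
  have := Rintegral_invariant bME => inv.
  have : expect (fun x => birkhoff_max g n x * \1_E x - (birkhoff_max g n (T x) * \1_E (T x))) <=
         expect (fun x => g x * \1_(P n) x).
    apply: le_Rintegral => //.
    - have bm1 := bounded_measurableD bME (bounded_measurableM (bounded_measurable_cst (-1)) bMET).
      have := bounded_integrable bm1.
      by congr (mu.-integrable _ _); apply/funext => x /=; rewrite mulN1r.
    - exact: (bounded_integrable (bounded_measurableM bg (b1P n))).
    - move=> x _; have eT : \1_E (T x) = \1_E x :> R.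
        have [xE|nxE] := pselect (E x); rewrite !indicE.
          by rewrite (mem_set xE) mem_set// -[E (T x)]/((T @^-1` E) x) TE.
        by rewrite (memNset nxE) memNset// -[E (T x)]/((T @^-1` E) x) TE.
      rewrite eT.
      have [xE|nEx] := pselect (E x); last first.
        rewrite !indicE (memNset nEx) !mulr0 subrr memNset ?mulr0//.
        by move=> [].
      rewrite [\1_E x]indicE (mem_set xE) !mulr1 indicE.
      have M0 := birkhoff_max_ge0 g n (T x).
      have [px|px] := ltP 0 (birkhoff_max g n x).
        rewrite (mem_set (conj xE px : P n x)) mulr1.
        case: (n) px => [|m]; first by rewrite ltxx.
        move=> /=; rewrite lt_max ltxx /= => px; rewrite max_r ?(ltW px)//.
        rewrite lerBlDr lerD2l.
        exact: (birkhoff_max_mono g m (T x)).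
      rewrite memNset ?mulr0; last by move=> [_]; rewrite /= ltNge px.
      by have := birkhoff_max_ge0 g n x; lra.
  apply: le_trans; rewrite RintegralB//.
  - by rewrite -[X in _ - X]/(expect ((fun x => birkhoff_max g n x * \1_E x) \o T)) inv subrr.
  - exact: bounded_integrable.
  - exact: (bounded_integrable bMET).
have [_ [C gC]] := bg.
have C0 : 0 <= C by apply: le_trans (normr_ge0 _) (gC point).
(* Every point of E has a positive Birkhoff sum, so these remainders decrease to the empty set; on
   them the crude bound - C for g suffices. *)
have lim0 : fine (mu (E `\` P n)) @[n --> \oo] --> (0 : R).
  have capE : \bigcap_n (E `\` P n) = set0.
    apply/seteqP; split => // x h; have [xE _] := h 0%N I.
    have [n Sn] := hE x xE.
    have [_ []] := h n I; split => //=.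
    exact: lt_le_trans Sn (birkhoff_le_max g n x).
  have := @nonincreasing_cvg_mu _ _ _ mu (fun n => E `\` P n).
  rewrite capE measure0 => h.
  have /fine_cvgP[_] : (mu \o (fun n => E `\` P n)) x @[x --> \oo] --> (0%R)%:E.
    apply: h => //.
    - have /fin_numPlt/andP[_] := fin_num_measure mu (E `\` P 0%N) (measurableD mE (mP 0%N)).
      by [].
    - by move=> n; exact: measurableD.
    - move=> n m nm; apply/subsetPset => x [xE nP]; split => // -[_ px]; apply: nP; split => //=.
      exact: lt_le_trans px (birkhoff_max_le g x nm).
  by [].
have bound n : - (C * fine (mu (E `\` P n))) <= expect (fun x => g x * \1_E x).
  have bD := bounded_measurable_indic (measurableD mE (mP n)).
  have eD x : g x * \1_E x = g x * \1_(P n) x + g x * \1_(E `\` P n) x.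
    rewrite -mulrDr; congr (_ * _); rewrite !indicE -natrD; congr (_ %:R).
    have [xE|nEx] := pselect (E x); last first.
      by rewrite !memNset// => -[].
    have [px|px] := pselect (P n x).
      by rewrite (mem_set xE) (mem_set px) memNset// => -[].
    by rewrite (mem_set xE) (memNset px) (@mem_set _ (E `\` P n)).
  rewrite (eq_Rintegral _ (fun x _ => eD x)) RintegralD//; first last.
  - exact: (bounded_integrable (bounded_measurableM bg bD)).
  - exact: (bounded_integrable (bounded_measurableM bg (b1P n))).
  have h1 : - (C * fine (mu (E `\` P n))) = expect (fun x => - C * \1_(E `\` P n) x).
    rewrite RintegralZl//; last exact: (bounded_integrable bD).
    rewrite mulNr; congr (- (_ * _)).
    by rewrite /Rintegral integral_indic ?setIT//; exact: measurableD.
  rewrite h1 -[leLHS]add0r; apply: lerD; first exact: garsia.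
  apply: le_Rintegral => //.
  - exact: (bounded_integrable (bounded_measurableM (bounded_measurable_cst (- C)) bD)).
  - exact: (bounded_integrable (bounded_measurableM bg bD)).
  - move=> x _; rewrite ler_wpM2r//; have := gC x; rewrite ler_norml; by move=> /andP[].
have lim1 : - (C * fine (mu (E `\` P n))) @[n --> \oo] --> (0 : R).
  rewrite -[X in _ --> X]oppr0 -[X in - X](mulr0 C); apply: (@cvgN _ R^o).
  by apply: (@cvgM R nat); [exact: cvg_cst|exact: lim0].
apply: (cvgr_to_le lim1); exact: nearW.
Qed.

Lemma archi_linear (a b : R) : 0 < a -> exists n0 : nat, forall n, (n0 <= n)%N -> b <= a * n%:R.
Proof.
move=> a0; exists (Num.bound (`|b| / a)) => n hn.
have h : `|b| / a < n%:R.
  apply: lt_le_trans (archi_boundP _) _; first by rewrite divr_ge0// ltW.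
  by rewrite ler_nat.
rewrite ltr_pdivrMr// mulrC in h.
exact: le_trans (ler_norm _) (ltW h).
Qed.

(* [low_frequency a u] holds when the lower limit of [u n / n] is less than [a]. *)
Definition low_frequency (a : R) (u : nat -> R) : Prop :=
  exists k : nat, forall N, exists2 n, (N <= n)%N & u n <= (a - k.+1%:R^-1) * n%:R.

(** The index shift and the bounded error are absorbed, for large n, by reducing the gap from 1 / (k
    + 1) to 1 / (k + 2). *)
Lemma low_frequency_shift a C (u w : nat -> R) : (forall n, `|u n.+1 - w n| <= C) ->
  low_frequency a u <-> low_frequency a w.
Proof.
move=> uw.
have key (k : nat) : exists n0 : nat, forall n, (n0 <= n)%N ->
    C + `|a| + 2 <= (k.+1%:R^-1 - k.+2%:R^-1) * n%:R.
  apply: archi_linear; rewrite subr_gt0 ltf_pV2 ?posrE// ltr_nat//.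
have inv1 (k : nat) : 0 <= (k.+1%:R^-1 : R) <= 1.
  by rewrite invr_ge0 ler0n invf_le1// ler1n.
split=> -[k hk]; have [n0 hn0] := key k; exists k.+1 => N.
  have [[//|n] hn un] := hk (maxn N n0).+1.
  have nN : (maxn N n0 <= n)%N by [].
  exists n; first by rewrite (leq_trans _ nN)// leq_maxl.
  have := hn0 n (leq_trans (leq_maxr _ _) nN).
  have := uw n; rewrite ler_norml => /andP[uw1 uw2].
  rewrite -[n.+1%:R]natr1 in un.
  have := ler_norm a; have := inv1 k; move: un.
  set i := k.+1%:R^-1; set i' := k.+2%:R^-1; lra.
have [n hn wn] := hk (maxn N n0).
exists n.+1; first by rewrite (leq_trans _ (leqnSn _))// (leq_trans _ hn)// leq_maxl.
have := hn0 n (leq_trans (leq_maxr _ _) hn).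
have := uw n; rewrite ler_norml => /andP[uw1 uw2].
rewrite -[n.+1%:R]natr1.
have := ler_norm (- a); rewrite normrN; have := inv1 k.+1; move: wn.
set i := k.+1%:R^-1; set i' := k.+2%:R^-1; lra.
Qed.

Definition low_set phi (a : R) : set X := [set x | low_frequency a (fun n => birkhoff phi n x)].

Lemma low_set_measurable phi a : bounded_measurable phi -> measurable (low_set phi a).
Proof.
move=> bphi.
have -> : low_set phi a = \bigcup_(k in [set: nat]) \bigcap_(N in [set: nat]) \bigcup_(n in [set n | (N <= n)%N])
    (setT `&` [set x | birkhoff phi n x <= (a - k.+1%:R^-1) * n%:R]).
  apply/seteqP; split => x.
    by move=> [k hk]; exists k => // N _; have [n Nn h] := hk N; exists n.
  by move=> [k _ hk]; exists k => N; have [n Nn [_ h]] := hk N I; exists n.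
apply: bigcupT_measurable => k; apply: bigcapT_measurable => N; apply: bigcup_measurable => n _.
apply: measurable_fun_le => //.
by have [] := bounded_measurable_birkhoff n bphi.
Qed.

Lemma low_set_invariant phi a : bounded_measurable phi -> T @^-1` low_set phi a = low_set phi a.
Proof.
move=> [_ [C hC]]; apply/seteqP; split => x /=.
  apply: (iffRL (low_frequency_shift a (C := C) _)) => n.
  by rewrite birkhoffS addrK; exact: hC.
apply: (iffLR (low_frequency_shift a (C := C) _)) => n.
by rewrite birkhoffS addrK; exact: hC.
Qed.

Lemma birkhoffB phi psi (c : R) n x : birkhoff (fun x => phi x + c * psi x) n x =
  birkhoff phi n x + c * birkhoff psi n x.
Proof. by rewrite /birkhoff big_split /= mulr_sumr. Qed.

Lemma birkhoff_cst (c : R) n x : birkhoff (fun _ => c) n x = c * n%:R.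
Proof. by rewrite /birkhoff sumr_const card_ord mulr_natr. Qed.

(** The maximal inequality for a - phi, which has a positive Birkhoff sum at every point of E. *)
Lemma low_set_integral phi a E : bounded_measurable phi -> measurable E -> T @^-1` E = E ->
  E `<=` low_set phi a ->
  expect (fun x => phi x * \1_E x) <= a * fine (mu E).
Proof.
move=> bphi mE TE Elow.
pose g x := a + (-1) * phi x.
have bg : bounded_measurable g.
  exact: bounded_measurableD (bounded_measurable_cst a) (bounded_measurableM (bounded_measurable_cst (-1)) bphi).
have b1E := bounded_measurable_indic mE.
have := @maximal_ergodic g E bg mE TE.
have eD x : g x * \1_E x = a * \1_E x - phi x * \1_E x.
  by rewrite /g mulN1r mulrBl.
rewrite (eq_Rintegral _ (fun x _ => eD x)) RintegralB//; first last.
- exact: (bounded_integrable (bounded_measurableM bphi b1E)).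
- exact: (bounded_integrable (bounded_measurableM (bounded_measurable_cst a) b1E)).
rewrite RintegralZl//; last exact: (bounded_integrable b1E).
rewrite [X in a * X](_ : _ = fine (mu E)); last by rewrite /Rintegral integral_indic// setIT.
rewrite subr_ge0; apply => x Ex.
have [k hk] := Elow x Ex; have [n n1 h] := hk 1%N; exists n.
rewrite (birkhoffB (fun _ => a)) birkhoff_cst mulN1r subr_gt0; apply: le_lt_trans h _.
by rewrite ltr_pM2r ?ltr0n// ltrBlDr ltrDl invr_gt0.
Qed.

(** On this invariant set the integral of phi is at most a times the measure and at least b times
    the measure. *)
Lemma low_high_negligible phi a b : a < b -> bounded_measurable phi ->
  mu (low_set phi a `&` low_set (fun x => - phi x) (- b)) = 0%E.
Proof.
move=> ab bphi.
have bN := bounded_measurableN bphi.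
set E := _ `&` _.
have mE : measurable E by apply: measurableI; exact: low_set_measurable.
have TE : T @^-1` E = E by rewrite preimage_setI !low_set_invariant.
have h1 := low_set_integral bphi mE TE (@subIsetl _ _ _).
have h2 := low_set_integral bN mE TE (@subIsetr _ _ _).
have b1E := bounded_measurable_indic mE.
have e : expect (fun x => - phi x * \1_E x) = - expect (fun x => phi x * \1_E x).
  have eD x : - phi x * \1_E x = (-1) * (phi x * \1_E x) by rewrite mulN1r mulNr.
  rewrite (eq_Rintegral _ (fun x _ => eD x)) RintegralZl// ?mulN1r//.
  exact: (bounded_integrable (bounded_measurableM bphi b1E)).
rewrite e in h2.
have m0 : 0 <= fine (mu E) by rewrite fine_ge0.
have : fine (mu E) = 0 by apply/eqP; rewrite eq_le m0 andbT; nra.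
by move=> h; rewrite -[LHS]fineK ?h// fin_num_measure.
Qed.

(** A quantitative recurrence theorem. The set Z of points with zero lower frequency of visits is
    invariant, and the measure of V in Z is at most that of Z divided by k + 1, for every k. *)
Lemma visit_frequency V : measurable V ->
  mu.-negligible (V `&` [set x | ~ exists2 c : R, 0 < c & exists N, forall n, (N <= n)%N ->
     c * n%:R <= birkhoff \1_V n x]).
Proof.
move=> mV; have b1V := bounded_measurable_indic mV.
pose Z := \bigcap_(k in [set: nat]) low_set \1_V k.+1%:R^-1.
have mZ : measurable Z by apply: bigcapT_measurable => k; exact: low_set_measurable.
have TZ : T @^-1` Z = Z.
  by rewrite preimage_bigcap; apply: eq_bigcapr => k _; exact: low_set_invariant.
have e : expect (fun x => \1_V x * \1_Z x) = fine (mu (V `&` Z)).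
  have eD x : \1_V x * \1_Z x = \1_(V `&` Z) x :> R by rewrite indicI.
  rewrite (eq_Rintegral _ (fun x _ => eD x)) /Rintegral integral_indic// ?setIT//.
  exact: measurableI.
have fz : fine (mu (V `&` Z)) = 0.
  apply/eqP; rewrite eq_le fine_ge0 ?andbT// leNgt; apply/negP => h.
  have h1 k : fine (mu (V `&` Z)) <= k.+1%:R^-1 * fine (mu Z).
    by rewrite -e; apply: low_set_integral => // x hx; exact: hx.
  have [n0 hn0] := @archi_linear _ (fine (mu Z) + 1) h.
  have := hn0 n0.+1 (leqnSn _); have := h1 n0.
  rewrite mulrC ler_pdivlMr// => h2 h3; have := le_trans h3 h2; lra.
have fz' : mu (V `&` Z) = 0%E.
  by rewrite -[LHS]fineK ?fz// fin_num_measure//; exact: measurableI.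
exists (V `&` Z); split => //; first exact: measurableI.
move=> x [Vx nx]; split => // k _; apply: contrapT => nlow; apply: nx.
(* Half of the threshold 1 / (k + 1): at index 2k + 1 the gap in [low_frequency] is the other
   half. *)
exists (k.+1%:R^-1 / 2); first by rewrite divr_gt0.
apply: contrapT => nN; apply: nlow; exists (k.*2.+1) => N.
apply: contrapT => nn; apply: nN; exists N => n Nn.
rewrite leNgt; apply/negP => h; apply: nn; exists n => //; apply: le_trans (ltW h) _.
rewrite ler_wpM2r// -doubleS -muln2 natrM invfM.
by set i := k.+1%:R^-1; lra.
Qed.

(** Distinct lower and upper limits would be separated by consecutive multiples of some 1 / (k + 1),
    which puts x in one of countably many null sets. *)
Lemma birkhoff_converges phi : bounded_measurable phi -> (forall x, 0 <= phi x) ->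
  mu.-negligible [set x | ~ exists l : R, forall e, 0 < e -> exists N : nat, forall n, (N <= n)%N ->
     `|birkhoff phi n x - l * n%:R| <= e * n%:R].
Proof.
move=> bphi p0.
pose B (k j : nat) : set X := low_set phi (j%:R / k.+1%:R) `&`
  low_set (fun x => - phi x) (- (j.+1%:R / k.+1%:R)).
have bN := bounded_measurableN bphi.
have nB k j : mu.-negligible (B k j).
  exists (B k j); split => //.
    by apply: measurableI; exact: low_set_measurable.
  by apply: low_high_negligible => //; rewrite ltr_pM2r ?invr_gt0// ltr_nat.
apply: (@negligibleS _ _ _ _ (\bigcup_k \bigcup_j B k j)); last first.
  by apply: negligible_bigcup => k; exact: negligible_bigcup.
move=> x /= nl; apply: contrapT => nb; apply: nl.
have {}nb k j : ~ B k j x by move=> h; apply: nb; exists k => //; exists j.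
have [_ [C hC]] := bphi.
have sN n : birkhoff (fun x => - phi x) n x = - birkhoff phi n x.
  by rewrite /birkhoff sumrN.
have s0 n : 0 <= birkhoff phi n x by apply: sumr_ge0 => i _; exact: p0.
have sC n : birkhoff phi n x <= C * n%:R.
  rewrite -(birkhoff_cst C n x); apply: ler_sum => i _; apply: le_trans (hC _).
  exact: ler_norm.
(* The supremum of A is the lower limit of the averages, the candidate for l. *)
pose A : set R := [set a | exists N : nat, forall n, (N <= n)%N -> a * n%:R <= birkhoff phi n x].
have A0 : A 0 by exists 0%N => n _; rewrite mul0r.
have supA : has_sup A.
  split; first by exists 0.
  exists C => a [N hN]; have := le_trans (hN N.+1 (leqnSn _)) (sC N.+1).
  by rewrite ler_pM2r ?ltr0n.
exists (sup A) => e e0.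
have [N1 h1] : exists N : nat, forall n, (N <= n)%N -> (sup A - e) * n%:R <= birkhoff phi n x.
  have [a [N hN] ha] := sup_adherent e0 supA.
  exists N => n Nn; apply: le_trans (hN n Nn); rewrite ler_wpM2r// ltW//.
have l0 : 0 <= sup A by apply: sup_upper_bound.
(* 3 / (k + 1) pays for going from [sup A] to (j + 1) / (k + 1), at most two steps, and for the gap
   1 / (k + 1) in [low_frequency]. *)
pose k := Num.bound (3 / e).
have k3 : 3 / k.+1%:R < e.
  have : 3 / e < k%:R by apply: archi_boundP; rewrite divr_ge0// ltW.
  rewrite ltr_pdivrMr// => h; rewrite ltr_pdivrMr// -[k.+1%:R]natr1 mulrDr mulr1 [e * _]mulrC.
  by apply: lt_le_trans h _; rewrite lerDl ltW.
pose j := (Num.truncn (sup A * k.+1%:R)).+1.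
have kp : 0 < k.+1%:R :> R by [].
have /andP[j0 j1] := truncn_itv (mulr_ge0 l0 (ltW kp)).
have la : sup A < j%:R / k.+1%:R by rewrite ltr_pdivlMr.
have lb : j.+1%:R / k.+1%:R <= sup A + 2 / k.+1%:R.
  by rewrite ler_pdivrMr// mulrDl divfK ?gt_eqF// /j -addn2 natrD; lra.
have low : low_set phi (j%:R / k.+1%:R) x.
  have [i hi] : exists i : nat, i.+1%:R^-1 < j%:R / k.+1%:R - sup A.
    have dp : 0 < j%:R / k.+1%:R - sup A by rewrite subr_gt0.
    have [i _ h] := near_infty_natSinv_lt (PosNum dp).
    by exists i; apply: (h i) => /=.
  exists i; apply: contrapT => nlow.
  have : A (j%:R / k.+1%:R - i.+1%:R^-1).
    apply: contrapT => nA; apply: nlow => N; apply: contrapT => nn; apply: nA.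
    exists N => n Nn; rewrite leNgt; apply/negP => h; apply: nn; exists n => //; exact: ltW.
  by move=> /(sup_upper_bound supA); rewrite lerBlDl -lerBlDr leNgt hi.
have nhigh : ~ low_set (fun x => - phi x) (- (j.+1%:R / k.+1%:R)) x by move=> h; exact: (nb k j).
have [N2 h2] : exists N : nat, forall n, (N <= n)%N -> birkhoff phi n x <= (sup A + e) * n%:R.
  apply: contrapT => nN; apply: nhigh; exists k => N; apply: contrapT => nn; apply: nN.
  exists N => n Nn; rewrite leNgt; apply/negP => h; apply: nn; exists n => //.
  rewrite sN lerNl -mulNr opprB opprK; apply: le_trans (ltW h); rewrite ler_wpM2r//.
  move: lb k3; set i := k.+1%:R^-1; set b := j.+1%:R * i => lb k3.
  by clear -lb k3; lra.
exists (maxn N1 N2) => n; rewrite geq_max => /andP[n1 n2].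
have := h1 n n1; have := h2 n n2; rewrite ler_norml; lra.
Qed.

End Ergodic.

(** * Borel sets and area on the annulus *)

Definition borel_annulus (R : realType) : Type :=
  g_sigma_algebraType [set B : set (annulus R) | open B].

HB.instance Definition _ (R : realType) :=
  Measurable.copy (borel_annulus R) (g_sigma_algebraType [set B : set (annulus R) | open B]).

Section Area.
Context {R : realType}.
Local Notation A := (annulus R).
Local Notation P := (plane R).
Local Notation X := (borel_annulus R).
Local Notation MR := (measurableTypeR R).
Local Notation area := (@lebesgue_measure R \x @lebesgue_measure R)%E.

Lemma borel_open (B : set A) : open B -> measurable (B : set X).
Proof. exact: sub_sigma_algebra. Qed.

(** The product sigma-algebra is built from rectangles, so an open set is written as a countable
    union of squares with rational centres. *)
Lemma open_plane_measurable (B : set P) : open B -> measurable (B : set (MR * MR)).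
Proof.
move=> oB.
pose box (q r : rat) (n : nat) : set (MR * MR) :=
  ball (ratr q : R) n.+1%:R^-1 `*` ball (ratr r : R) n.+1%:R^-1.
have -> : B = \bigcup_q \bigcup_r \bigcup_(n in [set n | box q r n `<=` B]) box q r n.
  apply/seteqP; split; last by move=> p [q _] [r _] [n qB] /qB.
  move=> p Bp; move: oB; rewrite openE => /(_ _ Bp)/nbhs_ballP[e /= e0 eB].
  have e20 : 0 < e / 2 by rewrite divr_gt0.
  have [n _ hn] := near_infty_natSinv_lt (PosNum e20).
  have {}hn : n.+1%:R^-1 < e / 2 by exact: (hn n (leqnn n)).
  have dense x : exists q : rat, ball (ratr q : R) n.+1%:R^-1 x.
    have /rat_in_itvoo[q] : x < x + n.+1%:R^-1 by rewrite ltrDl.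
    by rewrite in_itv /= => /andP[q1 q2]; exists q; rewrite /ball /= ltr_norml; move: q1 q2; set i := n.+1%:R^-1; lra.
  have [q hq] := dense p.1; have [r hr] := dense p.2.
  exists q => //; exists r => //; exists n; last by split.
  move=> w [w1 w2]; apply: eB; split.
    apply: le_ball (ball_triangle (ball_sym hq) w1); move: hn; set i := n.+1%:R^-1; lra.
  apply: le_ball (ball_triangle (ball_sym hr) w2); move: hn; set i := n.+1%:R^-1; lra.
apply: bigcupT_measurable_rat => q; apply: bigcupT_measurable_rat => r.
apply: bigcup_measurable => n _; apply: measurableX; apply: open_measurable; exact: ball_open.
Qed.

Lemma measurable_from_open (d : measure_display) (Y : measurableType d) (g : Y -> A) :
  (forall B, open B -> measurable (g @^-1` B)) -> measurable_fun setT (g : Y -> X).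
Proof.
move=> h; apply: (@measurability _ _ Y X setT g [set B : set (annulus R) | open B]) => //.
by move=> _ [B oB <-]; rewrite setTI; exact: h.
Qed.

Lemma measurable_annulus_proj : measurable_fun setT (@annulus_proj R : MR * MR -> X).
Proof.
apply: measurable_from_open => B oB.
by apply: open_plane_measurable; apply: open_comp => // p _; exact: continuous_annulus_proj.
Qed.

Lemma continuous_measurable_annulus (g : A -> A) : continuous g -> measurable_fun setT (g : X -> X).
Proof.
move=> cg; apply: measurable_from_open => B oB; apply: borel_open.
by apply: open_comp => // p _; exact: cg.
Qed.

Definition fundamental_domain : set (MR * MR) := `[0, 1[ `*` setT.

Lemma measurable_fundamental_domain : measurable fundamental_domain.
Proof. by apply: measurableX => //; exact: measurable_itv. Qed.

Definition borel_area : set X -> \bar R := @annulus_lebesgue R.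

Lemma borel_areaE B : borel_area B = area (fundamental_domain `&` @annulus_proj R @^-1` B).
Proof.
rewrite /borel_area /annulus_lebesgue; congr (area _).
by apply/seteqP; split => p /=; rewrite /fundamental_domain /= in_itv /= => -[]// [].
Qed.

Lemma measurable_unfold B : measurable (B : set X) ->
  measurable (fundamental_domain `&` @annulus_proj R @^-1` B).
Proof.
move=> mB; apply: measurableI; first exact: measurable_fundamental_domain.
by rewrite -[X in measurable X]setTI; exact: measurable_annulus_proj.
Qed.

Lemma borel_area0 : borel_area set0 = 0%E.
Proof. by rewrite borel_areaE preimage_set0 setI0 measure0. Qed.

Lemma borel_area_ge0 B : (0 <= borel_area B)%E.
Proof. by rewrite borel_areaE measure_ge0. Qed.

Lemma borel_area_sigma_additive : semi_sigma_additive borel_area.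
Proof.
move=> F mF tF mUF; rewrite borel_areaE preimage_bigcup setI_bigcupr.
under eq_fun do under eq_bigr do rewrite borel_areaE.
apply: measure_semi_sigma_additive => /=.
- by move=> n; exact: measurable_unfold.
- apply/trivIsetP => /= i j _ _ ij; rewrite setIACA setIid -preimage_setI.
  by move/trivIsetP : tF => /(_ _ _ _ _ ij) ->//; rewrite preimage_set0 setI0.
- by rewrite -setI_bigcupr -preimage_bigcup; exact: measurable_unfold.
Qed.

HB.instance Definition _ := isMeasure.Build _ _ _
  borel_area borel_area0 borel_area_ge0 borel_area_sigma_additive.

Lemma borel_area_open_gt0 (B : set A) : open B -> B !=set0 -> (0 < borel_area B)%E.
Proof.
move=> oB [z Bz].
have [q Bq /andP[q0 q1]] : exists2 q : P, (@annulus_proj R @^-1` B) q & 0 <= q.1 < 1.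
  exists (shift_by (- Num.floor (plane_of z).1) (plane_of z)).
    by rewrite /= annulus_proj_shift annulus_proj_plane_of.
  have key (x : R) : 0 <= x + (- Num.floor x)%:~R < 1.
    rewrite mulrNz; have /andP[] := floor_itv x; rewrite intrD.
    by move: (Num.floor x)%:~R => y; lra.
  exact: key.
have oB' : open (@annulus_proj R @^-1` B) by apply/open_annulus.
move: (oB'); rewrite openE => /(_ _ Bq)/nbhs_ballP[e /= e0 eB].
(* The side is limited so that the square with lower left corner q stays in the preimage of B and in
   the fundamental domain. *)
pose h := Num.min (e / 2) (1 - q.1).
have h0 : 0 < h by rewrite lt_min divr_gt0// subr_gt0.
have [h1 h2] : h <= e / 2 /\ h <= 1 - q.1.
  by rewrite /h !ge_min !lexx orbT.
pose box : set (MR * MR) := `[q.1, q.1 + h[ `*` `[q.2, q.2 + h[.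
have mbox : measurable box by apply: measurableX; exact: measurable_itv.
have boxE : area box = (h * h)%:E.
  rewrite product_measure1E; [|exact: measurable_itv..].
  have itvE (x : R) : lebesgue_measure `[x, x + h[ = h%:E.
    by rewrite lebesgue_measure_itv /= lte_fin ltrDl h0 -EFinD addrAC subrr add0r.
  by rewrite EFinM; congr (_ * _)%E; exact: itvE.
apply: (@lt_le_trans _ _ (area box)); first by rewrite boxE lte_fin mulr_gt0.
rewrite borel_areaE; apply: le_measure; rewrite ?inE//.
  exact: (measurable_unfold (borel_open oB)).
move=> w [/=]; rewrite !in_itv /= => /andP[a1 a2] /andP[b1 b2]; split.
  split; last by [].
  by rewrite /= in_itv /=; apply/andP; split; lra.
by apply: eB; split; rewrite /ball /= ltr_norml; apply/andP; split; lra.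
Qed.

End Area.

(** * Limits of frequencies *)

Section FrequencyLimits.
Context {R : realType}.
Implicit Types (u : nat -> R) (h : nat -> nat).

(** The Cauchy criterion with countably many thresholds, which makes the set of points of negative
    torsion measurable. *)
Lemma cvg_positive_limitP u :
  (exists2 l : R, 0 < l & u n @[n --> \oo] --> l) <->
  (forall k : nat, exists N : nat, forall n m, (N <= n)%N -> (N <= m)%N -> `|u n - u m| <= k.+1%:R^-1) /\
  (exists k N : nat, forall n, (N <= n)%N -> k.+1%:R^-1 <= u n).
Proof.
have invp (k : nat) : 0 < (k.+1%:R^-1 : R) by rewrite invr_gt0.
split.
  move=> [l l0 /cvgrPdist_le ul]; split.
    move=> k; have k20 : 0 < k.+1%:R^-1 / 2 :> R by rewrite divr_gt0.
    have [N _ hN] := ul _ k20; exists N => n m Nn Nm.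
    have := hN n Nn; have := hN m Nm; rewrite /= !ler_norml.
    by set i := k.+1%:R^-1; lra.
  have l20 : 0 < l / 2 by rewrite divr_gt0.
  have [k _ hk] := near_infty_natSinv_lt (PosNum l20).
  have {}hk : k.+1%:R^-1 < l / 2 by exact: (hk k (leqnn k)).
  have [N _ hN] := ul _ l20; exists k, N => n Nn.
  have := hN n Nn; rewrite /= !ler_norml.
  by move: hk; set i := k.+1%:R^-1; lra.
move=> [cu [k [N0 hk]]].
have /cvg_ex[l ul] : cvg (u n @[n --> \oo]).
  apply: cauchy_cvg; apply: cauchy_exP => _/posnumP[e].
  have [j _ hj] := near_infty_natSinv_lt e.
  have {}hj : j.+1%:R^-1 < e%:num by exact: (hj j (leqnn j)).
  have [N hN] := cu j; exists (u N); exists N => // n Nn.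
  rewrite /ball /=; exact: le_lt_trans (hN _ _ (leqnn N) Nn) hj.
exists l => //; apply: lt_le_trans (invp k) _.
by apply: (cvgr_to_ge ul); exists N0.
Qed.

(** Euclidean division of n by L. An error of 1 per block amounts to n / L, the convergence of s
    costs half of it, and the incomplete block is negligible for large n. *)
Lemma frequency_approx h (L : nat) (s : nat -> R) (l : R) : (0 < L)%N ->
  (forall n k, (h n <= h (n + k) <= h n + k)%N) ->
  (forall n, `|(h (n * L)%N)%:R - s n| <= n%:R) ->
  (forall e : R, 0 < e -> exists N : nat, forall n, (N <= n)%N -> `|s n - l * n%:R| <= e * n%:R) ->
  exists N : nat, forall n, (N <= n)%N -> `|(h n)%:R - l / L%:R * n%:R| <= 3 / L%:R * n%:R.
Proof.
move=> L0 hh hs sl.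
have Lp : 0 < L%:R :> R by rewrite ltr0n.
have hL : 0 < 2^-1 :> R by rewrite invr_gt0.
have [N1 h1] := sl _ hL.
have [N2 h2] := @archi_linear R (2^-1 / L%:R) ((1 + `|l / L%:R|) * L%:R) (divr_gt0 hL Lp).
exists (maxn (N1 * L)%N N2) => n; rewrite geq_max => /andP[n1 n2].
pose q := (n %/ L)%N; pose r := (n %% L)%N.
have nE : n = (q * L + r)%N := divn_eq n L.
have rL : (r < L)%N by rewrite ltn_mod.
have qN : (N1 <= q)%N by rewrite leq_divRL.
have /andP[m1 m2] := hh (q * L)%N r; rewrite -nE in m1 m2.
have m1' : (h (q * L)%N)%:R <= (h n)%:R :> R by rewrite ler_nat.
have m2' : (h n)%:R <= (h (q * L)%N)%:R + r%:R :> R by rewrite -natrD ler_nat.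
have rL' : r%:R <= L%:R :> R by rewrite ler_nat ltnW.
have nE' : n%:R = q%:R * L%:R + r%:R :> R by rewrite {1}nE natrD natrM.
have a1 := hs q; have a2 := h1 q qN; have a3 := h2 n n2.
have r0 : 0 <= r%:R :> R by [].
have q0 : 0 <= q%:R :> R by [].
have e1 : l / L%:R * n%:R = l * q%:R + l / L%:R * r%:R.
  by rewrite nE' mulrDr; congr (_ + _); rewrite mulrAC -!mulrA mulfV ?mulr1// gt_eqF.
have e3 : q%:R <= L%:R^-1 * n%:R :> R.
  by rewrite ler_pdivlMl// mulrC nE' lerDl.
have e4 : `|l / L%:R * r%:R| <= `|l / L%:R| * L%:R.
  by rewrite normrM ler_wpM2l// ger0_norm.
move: a1 a2 a3 e4; rewrite e1 -[3 / _ * _]mulrA -[2^-1 / _ * _]mulrA !ler_norml mulrDl mul1r.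
move: (h n)%:R (h _)%:R m1' m2' (s q) (l * q%:R) (l / L%:R * r%:R) (`|_| * _) (L%:R^-1 * _) e3.
by move: q0 => q0 hn hq m1' m2' sq lq lr x y; lra.
Qed.

Lemma frequency_cvg h : (forall n k, (h n <= h (n + k) <= h n + k)%N) ->
  (forall e : R, 0 < e -> exists r : R, exists N : nat, forall n, (N <= n)%N -> `|(h n)%:R - r * n%:R| <= e * n%:R) ->
  cvg ((h n)%:R / n%:R @[n --> \oo] : set_system R).
Proof.
move=> hh happ; apply: cauchy_cvg; apply: cauchy_exP => _/posnumP[e].
have e20 : 0 < e%:num / 2 :> R by rewrite divr_gt0.
have [r [N hN]] := happ _ e20; exists r; exists N.+1 => // n Nn.
have n0 : 0 < n%:R :> R by rewrite ltr0n; exact: leq_ltn_trans Nn.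
have := hN n (ltnW Nn); rewrite /ball /= => hn.
rewrite distrC -(ltr_pM2r n0) -[X in _ * X](gtr0_norm n0) -normrM mulrBl divfK ?gt_eqF//.
apply: le_lt_trans hn _; rewrite ltr_pM2r// ltr_pdivrMr//.
by rewrite mulr_natr mulr2n ltrDl.
Qed.

End FrequencyLimits.

(** * Torsion on a periodic open set *)

Section PeriodicOpenSet.
Context {R : realType}.
Local Notation A := (annulus R).
Local Notation P := (plane R).
Local Notation X := (borel_annulus R).
Variable f : A -> A.
Hypothesis f_twist : positive_twist_map f.
Hypothesis f_leb : preserves_lebesgue f.

Lemma twist_iter_C1 n : annulus_C1 (iter n f).
Proof. by have [[g [_ _ cf _]] _ _] := f_twist; exact: annulus_C1_iter. Qed.

Lemma twist_iter_inj n : injective (iter n f).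
Proof.
have [[g [fg _ _ _]] _ _] := f_twist.
by elim: n => [//|n IH] x y /= /(can_inj fg)/IH.
Qed.

Lemma twist_iter_continuous n : continuous (iter n f).
Proof. exact: annulus_C1_continuous (twist_iter_C1 n). Qed.

Lemma twist_iter_open n (B : set A) : open B -> open (iter n f @` B).
Proof.
have [[g [fg gf _ cg]] _ _] := f_twist.
move=> oB; elim: n => [|n IH]; first by rewrite (_ : iter 0 f @` B = B)// image_id.
have -> : iter n.+1 f @` B = g @^-1` (iter n f @` B).
  apply/seteqP; split => [_ [z Bz <-]|z [w Bw e]]; first by exists z => //=; rewrite fg.
  by exists w => //=; rewrite e gf.
by apply: open_comp => // z _; exact: annulus_C1_continuous.
Qed.

Lemma twist_iter_measurable n : measurable_fun setT (iter n f : X -> X).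
Proof. exact: continuous_measurable_annulus (twist_iter_continuous (n := n)). Qed.

Lemma twist_iter_preimage_measurable n (B : set X) : measurable B -> measurable (iter n f @^-1` B : set X).
Proof. by move=> mB; rewrite -[X in measurable X]setTI; exact: twist_iter_measurable. Qed.

Lemma twist_iter_area n (B : set X) : measurable B -> borel_area (iter n f @^-1` B) = borel_area B.
Proof.
move=> mB; elim: n => [//|n IH].
rewrite -IH /borel_area -(f_leb (twist_iter_preimage_measurable n mB)); congr (annulus_lebesgue _).
by apply/seteqP; split => z; rewrite /= -iterSr.
Qed.

Lemma half_turns_mono n k z : (half_turns f n z <= half_turns f (n + k) z <= half_turns f n z + k)%N.
Proof.
elim: k => [|k /andP[IH1 IH2]]; first by rewrite !addn0 leqnn.
rewrite addnS /=; apply/andP; split; first exact: leq_trans IH1 (leq_addr _ _).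
by rewrite [leqRHS]addnS -[leqRHS]addn1 leq_add// leq_b1.
Qed.

(** Each junction between blocks of length L adds 0 or 1 to the count. *)
Lemma birkhoff_half_turns L n z :
  birkhoff (iter L f : X -> X) (fun x => (half_turns f L x)%:R : R) n z <= (half_turns f (n * L) z)%:R <=
  birkhoff (iter L f : X -> X) (fun x => (half_turns f L x)%:R : R) n z + n%:R.
Proof.
elim: n => [|n IH]; first by rewrite /birkhoff big_ord0 mul0n /= addr0 lexx.
rewrite /birkhoff big_ord_recr /= -iterM.
move: IH; rewrite /birkhoff.
have := twist_half_turns_super f_twist (n * L) L z.
have := twist_half_turns_sub f_twist (n * L) L z.
rewrite -mulSnr -(ler_nat R) -(ler_nat R) -natr1 natrD -[n.+1%:R]natr1.
by move: (\sum_(i < n) _) => s; lra.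
Qed.

Lemma vertical_image_continuous n : continuous (vertical_image f n : A -> R^o).
Proof.
move=> z; apply: (@continuous_comp _ _ _ (fun z => tangent_map (iter n f) z ((0, 1) : P)) fst).
  exact: continuous_tangent (twist_iter_C1 n) z.
exact: cvg_fst.
Qed.

Lemma vertical_image_neg_open n : open [set z | vertical_image f n z < 0].
Proof.
apply: (@open_comp _ _ (vertical_image f n : A -> R^o) [set x | x < 0]); last exact: open_lt.
by move=> z _; exact: vertical_image_continuous.
Qed.

Lemma vertical_image_pos_open n : open [set z | 0 < vertical_image f n z].
Proof.
apply: (@open_comp _ _ (vertical_image f n : A -> R^o) [set x | 0 < x]); last exact: open_gt.
by move=> z _; exact: vertical_image_continuous.
Qed.

(** The recursion defining the count only tests strict signs of [vertical_image], and these define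
    open sets. *)
Lemma half_turns_level_measurable n m : measurable ([set z | half_turns f n z = m] : set X).
Proof.
elim: n m => [|n IH] m.
  have -> : [set z | half_turns f 0 z = m] = if m is 0%N then setT else set0.
    by case: m => [|m]; apply/seteqP; split.
  by case: m.
pose neg (k : nat) : set X := [set z | (-1) ^+ k * vertical_image f n.+1 z < 0].
have mneg k : measurable (neg k).
  apply: borel_open; rewrite /neg -signr_odd; case: (odd k); last first.
    by under eq_set do rewrite expr0 mul1r; exact: vertical_image_neg_open.
  by under eq_set do rewrite expr1 mulN1r oppr_lt0; exact: vertical_image_pos_open.
have -> : [set z | half_turns f n.+1 z = m] =
  ([set z | half_turns f n z = m] `\` neg m) `|`
  \bigcup_(k in [set k | k.+1 = m]) ([set z | half_turns f n z = k] `&` neg k).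
  apply/seteqP; split => z /=.
    case: (boolP (_ < _)) => h; rewrite ?addn1 ?addn0 => e; [right|left].
      by exists (half_turns f n z).
    by split => //; rewrite /neg /= -e; exact/negP.
  case=> [[e h]|[k km [/= e h]]].
    by rewrite e (negbTE (introN idP h)) addn0.
  by rewrite e; rewrite /neg /= in h; rewrite h addn1.
apply: measurableU; first exact: measurableD.
by apply: bigcup_measurable => k _; exact: measurableI.
Qed.

Lemma half_turns_measurable n : measurable_fun setT (fun z : X => (half_turns f n z)%:R : R).
Proof.
move=> _ B _; rewrite setTI.
have -> : (fun z : X => (half_turns f n z)%:R : R) @^-1` B =
  \bigcup_(m in [set m | B m%:R]) [set z | half_turns f n z = m].
  by apply/seteqP; split => z /=; [exists (half_turns f n z)|move=> [m Bm /= ->]].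
by apply: bigcup_measurable => m _; exact: half_turns_level_measurable.
Qed.

Lemma half_turns_bounded_measurable n : bounded_measurable (fun z : X => (half_turns f n z)%:R : R).
Proof.
split; first exact: half_turns_measurable.
by exists n%:R => z; rewrite ger0_norm// ler_nat half_turns_le.
Qed.

Lemma negative_torsionP z : negative_torsion f z <->
  exists2 l : R, 0 < l & (half_turns f n z)%:R / n%:R @[n --> \oo] --> l.
Proof.
have e (g : nat -> nat) : (fun n => - ((g n)%:R / 2 / n%:R)) = (fun n => - 2^-1 * ((g n)%:R / n%:R)) :> (nat -> R).
  by apply/funext => n; rewrite mulNr mulrA [2^-1 * _]mulrC.
have e' (g : nat -> nat) : (fun n => (g n)%:R / n%:R) = (fun n => - 2 * (- 2^-1 * ((g n)%:R / n%:R))) :> (nat -> R).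
  by apply/funext => n; rewrite mulrA mulrNN divff// mul1r.
split.
  move=> [tau t0 /(is_torsion_half_turns f_twist)]; rewrite e => h; exists (- 2 * tau); first lra.
  by rewrite e'; apply: (@cvgM R nat); [exact: cvg_cst|exact: h].
move=> [l l0 h]; exists (- 2^-1 * l); first lra.
by apply/(is_torsion_half_turns f_twist); rewrite e; apply: (@cvgM R nat); [exact: cvg_cst|exact: h].
Qed.

Lemma negative_torsion_measurable : measurable (negative_torsion f : set X).
Proof.
pose u (n : nat) (z : X) : R := (half_turns f n z)%:R / n%:R.
have mu n : measurable_fun setT (u n).
  by apply: measurable_funM; [exact: half_turns_measurable|exact: measurable_cst].
have -> : negative_torsion f =
  (\bigcap_(k in [set: nat]) \bigcup_(N in [set: nat]) \bigcap_(n in [set n | (N <= n)%N])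
     \bigcap_(m in [set m | (N <= m)%N]) (setT `&` [set z | `|u n z - u m z| <= k.+1%:R^-1])) `&`
  (\bigcup_(k in [set: nat]) \bigcup_(N in [set: nat]) \bigcap_(n in [set n | (N <= n)%N])
     (setT `&` [set z | k.+1%:R^-1 <= u n z])).
  apply/seteqP; split => z.
    move=> /negative_torsionP/cvg_positive_limitP[h1 [k [N h2]]]; split.
      by move=> j _; have [i hi] := h1 j; exists i => // n Nn m Nm; split => //; exact: hi.
    by exists k => //; exists N => // n Nn; split => //; exact: h2.
  move=> [h1 [k _ [N _ h2]]]; apply/negative_torsionP/cvg_positive_limitP; split.
    by move=> j; have [i _ hi] := h1 j I; exists i => n m Nn Nm; have [] := hi n Nn m Nm.
  by exists k, N => n Nn; have [] := h2 n Nn.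
apply: measurableI.
  apply: bigcapT_measurable => k; apply: bigcupT_measurable => N.
  apply: bigcap_measurableType => n _; apply: bigcap_measurableType => m _.
  apply: measurable_fun_le => //; apply: measurableT_comp => //.
  exact: measurable_funB.
apply: bigcupT_measurable => k; apply: bigcupT_measurable => N.
by apply: bigcap_measurableType => n _; exact: measurable_fun_le.
Qed.

Variables (U : set A) (M : nat).
Hypothesis U_open : open U.
Hypothesis M_gt0 : (0 < M)%N.
Hypothesis U_periodic : iter M f @` U = U.
Hypothesis U_finite : (annulus_lebesgue U < +oo)%E.

Lemma periodic_preimage K : iter (K * M) f @^-1` U = U.
Proof.
elim: K => [//|K IH]; rewrite -[RHS]IH; apply/seteqP; split => z /=.
  rewrite mulSn iterD -{1}U_periodic => -[w Uw /(@twist_iter_inj M) <-//].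
by rewrite mulSn iterD => h; rewrite -U_periodic; exists (iter (K * M) f z).
Qed.

Let mU : measurable (U : set X) := borel_open U_open.

Let U_finite' : (borel_area U < +oo)%E := U_finite.

(** Area restricted to U: it is finite, and invariant under the iterates whose order is a multiple
    of M. *)
Let mu : {finite_measure set X -> \bar R} := mfrestr mU U_finite'.

Lemma muE B : mu B = borel_area (B `&` U).
Proof. by []. Qed.

Lemma mu_invariant K (B : set X) : measurable B -> mu (iter (K * M) f @^-1` B) = mu B.
Proof.
move=> mB; rewrite !muE -[X in _ `&` X](periodic_preimage K) -preimage_setI.
by rewrite twist_iter_area//; exact: measurableI.
Qed.

(** Averages over blocks of length (K + 1) M give the frequency of half turns up to 3 / ((K + 1) M).
    Outside of a countable union of null sets this holds for every K, so the frequencies are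
    Cauchy. *)
Lemma half_turns_converge :
  mu.-negligible [set z | ~ cvg ((half_turns f n z)%:R / n%:R @[n --> \oo] : set_system R)].
Proof.
pose T K : X -> X := iter (K.+1 * M) f.
pose phi K (z : X) : R := (half_turns f (K.+1 * M) z)%:R.
pose bad K := [set z : X | ~ exists l : R, forall e, 0 < e -> exists N : nat, forall n, (N <= n)%N ->
     `|birkhoff (T K) (phi K) n z - l * n%:R| <= e * n%:R].
apply: (@negligibleS _ _ _ _ (\bigcup_K bad K)); last first.
  apply: negligible_bigcup => K.
  apply: (@birkhoff_converges _ _ _ mu (T K)) => //; first exact: twist_iter_measurable.
  - by move=> B mB; exact: mu_invariant.
  - exact: half_turns_bounded_measurable.
move=> z /= nc; apply: contrapT => nb; apply: nc; apply: frequency_cvg.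
  by move=> n k; exact: half_turns_mono.
move=> e e0; have [K0 hK] := archi_linear 3 e0; pose K := K0.
have /contrapT[l hl] : ~ bad K z by move=> h; apply: nb; exists K.
have L0 : (0 < K.+1 * M)%N by rewrite muln_gt0.
have [//|n|N hN] := @frequency_approx _ (half_turns f ^~ z) (K.+1 * M)%N _ l L0 _ _ hl.
- by move=> n k; exact: half_turns_mono.
- have /andP[] := birkhoff_half_turns (K.+1 * M) n z; rewrite -/(T K) -/(phi K).
  by rewrite ler_norml; lra.
exists (l / (K.+1 * M)%:R), N => n Nn; apply: le_trans (hN n Nn) _.
rewrite ler_wpM2r// ler_pdivrMr ?ltr0n//; apply: le_trans (hK K.+1 (leqnSn _)) _.
by rewrite ler_wpM2l ?(ltW e0)// ler_nat leq_pmulr.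
Qed.

(* Each visit to the set costs at least one more half turn, and visits occur
   with positive frequency. *)
Lemma negative_torsion_ae n : (0 < n)%N ->
  mu.-negligible ([set z | vertical_image f n z < 0] `\` negative_torsion f).
Proof.
move=> n0; pose V : set A := [set w | vertical_image f n w < 0]; rewrite -/V.
have mV : measurable (V : set X) by apply: borel_open; exact: vertical_image_neg_open.
(* A multiple of M, so that T preserves [mu], and at least n, so that a visit to V shows up as a
   half turn within one block. *)
pose L := (n * M)%N; pose T : X -> X := iter L f.
have L0 : (0 < L)%N by rewrite muln_gt0 n0.
have mT : measurable_fun setT T by exact: twist_iter_measurable.
have Tinv B : measurable B -> mu (T @^-1` B) = mu B by move=> mB; exact: mu_invariant.
have nv := @visit_frequency _ _ _ mu T mT Tinv V mV.
apply: (negligibleS _ (negligibleU half_turns_converge nv)).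
move=> z [Vz nz]; apply: contrapT => /not_orP[/contrapT/cvg_ex[l hl] nn]; apply: nz.
have [c c0 [N hN]] : exists2 c : R, 0 < c & exists N, forall n, (N <= n)%N -> c * n%:R <= birkhoff T \1_V n z.
  by apply: contrapT => h; apply: nn.
apply/negative_torsionP; exists l => //.
have Lp : 0 < L%:R :> R by rewrite ltr0n.
apply: (@lt_le_trans _ _ (c / L%:R)); first by rewrite divr_gt0.
rewrite leNgt; apply/negP => lc.
have gap : 0 < c / L%:R - l by rewrite subr_gt0.
have /cvgrPdist_lt/(_ _ gap)[N1 _ h1] := hl.
pose m := (maxn N N1).+1.
have m1 : (N1 <= m * L)%N.
  by apply: leq_trans (leq_pmulr _ L0); rewrite leqW// leq_maxr.
have m0 : 0 < m%:R :> R by rewrite ltr0n.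
have := h1 _ m1; rewrite /= ltr_norml => /andP[h2 _].
have h3 : c * m%:R <= birkhoff T \1_V m z by apply: hN; rewrite leqW// leq_maxl.
have h4 : birkhoff T \1_V m z <= birkhoff T (fun x => (half_turns f L x)%:R : R) m z.
  rewrite /birkhoff; apply: ler_sum => i _; rewrite indicE; case: (boolP (_ \in V)) => // /set_mem Vi.
  rewrite ler_nat; apply: leq_trans (twist_half_turns_gt0 f_twist n0 Vi) _.
  have /subnKC <- : (n <= L)%N by rewrite leq_pmulr.
  by have /andP[] := half_turns_mono n (L - n) (iter i T z).
have /andP[h5 _] := birkhoff_half_turns L m z.
have h6 : c / L%:R <= (half_turns f (m * L) z)%:R / (m * L)%:R.
  rewrite (natrM _ m L) invfM mulrA; apply: ler_wpM2r; first by rewrite invr_ge0 ltW.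
  by rewrite ler_pdivlMr//; exact: le_trans h3 (le_trans h4 h5).
lra.
Qed.

(** The points of V whose vertical goes to the left under f^n form a nonempty open set, of positive
    area, and almost all of them have negative torsion. *)
Lemma negative_torsion_area (V : set A) n z : open V -> V `<=` U -> (0 < n)%N -> V z ->
  vertical_image f n z < 0 -> (0 < borel_area (V `&` negative_torsion f))%E.
Proof.
move=> oV VU n0 Vz nz.
pose W := V `&` [set z | vertical_image f n z < 0].
have oW : open W by apply: openI => //; exact: vertical_image_neg_open.
have [N [mN N0 WN]] := negative_torsion_ae n0.
have mV := borel_open oV.
have mVS : measurable (V `&` negative_torsion f : set X).
  by apply: measurableI => //; exact: negative_torsion_measurable.
have pW : (0 < borel_area W)%E by apply: borel_area_open_gt0 => //; exists z.
have : (borel_area W <= borel_area (V `&` negative_torsion f) + borel_area (N `&` U))%E.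
  apply: (le_trans _ (@measureU2 _ _ _ borel_area _ _ mVS (measurableI _ _ mN mU))).
  apply: le_measure; rewrite ?inE//; first exact: borel_open.
    by apply: measurableU => //; exact: measurableI.
  move=> w [Vw nw]; have [nt|nt] := pselect (negative_torsion f w); first by left.
  by right; split; [exact: WN|exact: VU].
rewrite -[X in (_ + X)%E]/(mu N) N0 adde0; exact: lt_le_trans.
Qed.

End PeriodicOpenSet.

(** Recurrence in the product: disjoint sets of one positive measure would exhaust the finite
    measure of X x X. *)
Lemma disjoint_products_null (d : measure_display) (X : measurableType d) (R : realType)
    (mu : {finite_measure set X -> \bar R}) (E E' : nat -> set X) :
  (forall n, measurable (E n)) -> (forall n, measurable (E' n)) ->
  (forall n, mu (E n) = mu (E 0%N)) -> (forall n, mu (E' n) = mu (E' 0%N)) ->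
  trivIset setT (fun n => E n `*` E' n) -> ~ (0 < mu (E 0%N) /\ 0 < mu (E' 0%N))%E.
Proof.
move=> mE mE' eE eE' tE [p p'].
have fin B : measurable B -> mu B \is a fin_num by exact: fin_num_measure.
pose a := fine (mu (E 0%N)); pose a' := fine (mu (E' 0%N)); pose c := fine (mu setT).
have aE : mu (E 0%N) = a%:E by rewrite fineK ?fin.
have aE' : mu (E' 0%N) = a'%:E by rewrite fineK ?fin.
have cE : mu setT = c%:E by rewrite fineK ?fin.
have a0 : 0 < a * a' by move: p p'; rewrite aE aE' !lte_fin; exact: mulr_gt0.
have key N : N%:R * (a * a') <= c * c.
  have mEE n : measurable (E n `*` E' n) by exact: measurableX.
  have := @measure_bigsetU _ _ _ (mu \x mu)%E (fun n => E n `*` E' n) mEE tE N.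
  have t n : (mu \x mu)%E (E n `*` E' n) = (a * a')%:E.
    by rewrite EFinM -aE -aE' -(eE n) -(eE' n); exact: product_measure1E.
  rewrite (eq_bigr _ (fun i _ => t (nat_of_ord i))) sumEFin sumr_const card_ord => e.
  rewrite mulr_natl -lee_fin -e; apply: (@le_trans _ _ ((mu \x mu)%E setT)).
    by apply: le_measure; rewrite ?inE//; apply: bigsetU_measurable.
  by rewrite -setXTT EFinM -cE product_measure1E.
have [N hN] := archi_linear (c * c + 1) a0.
by have := hN N (leqnn N); have := key N; rewrite mulrC; lra.
Qed.

(** * Leftward iterates of the vertical *)

Section TwistBoxes.
Context {R : realType}.
Local Notation A := (annulus R).
Local Notation P := (plane R).

Lemma ball_segment (p w w' : P) (r c : R) : 0 <= c <= 1 -> ball p r w -> ball p r w' ->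
  ball p r (w + c *: (w' - w)).
Proof.
move=> c01; have key (x y y' : R) : `|x - y| < r -> `|x - y'| < r -> `|x - (y + c * (y' - y))| < r.
  have -> : x - (y + c * (y' - y)) = (1 - c) * (x - y) + c * (x - y') by ring.
  move=> h h'; apply: le_lt_trans (ler_normD _ _) _; rewrite !normrM.
  have /andP[c0 c1] := c01; rewrite (ger0_norm c0) (@ger0_norm _ (1 - c)) ?subr_ge0//.
  have [m [mr hm hm']] : exists m, [/\ m < r, `|x - y| <= m & `|x - y'| <= m].
    by exists (Num.max `|x - y| `|x - y'|); rewrite gt_max h h' !le_max !lexx orbT.
  by apply: le_lt_trans mr; nra.
by move=> [b1 b2] [b1' b2']; split; exact: key.
Qed.

Lemma connected_ball (p : P) (r : R) : connected (ball p r : set P).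
Proof.
have [r0|r0] := ltP 0 r; last first.
  rewrite (_ : ball p r = set0); first exact: connected0.
  by apply/seteqP; split => // w [/(le_lt_trans (normr_ge0 _))]; rewrite ltNge r0.
pose seg (w : P) (t : R) : P := p + t *: (w - p).
have -> : ball p r = \bigcup_(w in ball p r) (seg w @` `[0, 1]).
  apply/seteqP; split => w.
    move=> wb; exists w => //; exists 1; first by rewrite /= in_itv /= ler01 lexx.
    by rewrite /seg scale1r addrC subrK.
  move=> [w' w'b [t]] /=; rewrite in_itv /= => t01 <-.
  by apply: ball_segment => //; exact: ballxx.
apply: bigcup_connected.
  exists p => w _; exists 0; first by rewrite /= in_itv /= lexx ler01.
  by rewrite /seg scale0r addr0.
move=> w _; apply: connected_continuous_connected; first exact: segment_connected.
apply: continuous_subspaceT => t; apply: (@cvgD _ P); first exact: cvg_cst.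
by apply: (@cvgZr_tmp _ P); exact: cvg_id.
Qed.

Variable f : A -> A.
Hypothesis f_twist : positive_twist_map f.

(* If no iterate sends a vertical vector of [V] to the left, a vector tilted
   slightly to the left of the vertical is sent to the right by every iterate,
   so that two small squares along it are exchanged at once and forever. *)
Lemma exchanged_squares (V : set A) (F : P -> P) : open V -> V !=set0 -> is_lift f F ->
  (forall z n, V z -> (0 < n)%N -> 0 <= vertical_image f n z) ->
  exists Q B B' : set P, [/\ connected Q, Q `<=` @annulus_proj R @^-1` V,
    [/\ open B, B !=set0 & B `<=` Q], [/\ open B', B' !=set0 & B' `<=` Q] &
    forall w w', B w -> B' w' -> w'.1 < w.1 /\
      forall n, (0 < n)%N -> (iter n F w).1 < (iter n F w').1].
Proof.
move=> oV [z Vz] lF hV.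
have [[g [_ _ cf _]] _ tw] := f_twist.
have cF := C1_lift cf lF.
pose p := plane_of z.
have Vp : V (annulus_proj p) by rewrite annulus_proj_plane_of.
pose a := ('d F p ((1, 0) : P)).1; pose b := ('d F p ((0, 1) : P)).1.
have b0 : 0 < b by apply: twist_fst_gt0 => //; exact: tw.
(* A leftward tilt so small that the first coordinate b - del a of the image of (- del, 1) remains
   positive. *)
pose del := b / (`|a| + b + 1).
have den : 0 < `|a| + b + 1 by have := normr_ge0 a; lra.
have del0 : 0 < del by rewrite divr_gt0.
have del1 : del <= 1 by rewrite ler_pdivrMr//; have := normr_ge0 a; lra.
have adel : del * a < b.
  have : del * (`|a| + b + 1) = b by rewrite divfK// gt_eqF.
  by have := ler_norm a; nra.
pose u0 : P := (- del, 1).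
have Du0 : 0 < ('d F p u0).1.
  have -> : ('d F p u0).1 = - del * a + b.
    have e := linear_plane ('d F p) u0.
    by rewrite e /= !scaleRE mul1r.
  lra.
have [r /andP[r0 r1] [rV rD]] : exists2 r : R, 0 < r <= del &
    (ball p r `<=` @annulus_proj R @^-1` V) /\
    (forall q u : P, ball p r q -> ball u0 r u -> 0 < ('d F q u).1).
  have c1 : {for (p, u0), continuous (fun y : P * P => 'd F (y.1 : P) (y.2 : P) : P)}.
    exact: (@continuous_diff_pair R F _ (fun y : P * P => y.1 : P) (fun y : P * P => y.2 : P) (p, u0) cF cvg_fst cvg_snd).
  have c2 : {for (p, u0), continuous (fun y : P * P => ('d F (y.1 : P) (y.2 : P)).1 : R^o)}.
    by apply: (@continuous_comp _ _ _ (fun y : P * P => 'd F (y.1 : P) (y.2 : P) : P) fst); [exact: c1|exact: cvg_fst].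
  have := c2 _ (open_nbhs_nbhs (conj (@open_gt R 0) Du0)).
  move=> /nbhs_ballP[r1 /= r10 h1].
  have oV' : open (@annulus_proj R @^-1` V) by apply/open_annulus.
  move: oV'; rewrite openE => /(_ p Vp)/nbhs_ballP[r2 /= r20 h2].
  exists (Num.min del (Num.min r1 r2)).
    by rewrite !lt_min del0 r10 r20 ge_min lexx.
  split; first by move=> q qb; apply: h2; apply: le_ball qb; rewrite !ge_min lexx !orbT.
  move=> q u qb ub; apply: (h1 (q, u)); split; [apply: le_ball qb|apply: le_ball ub];
    by rewrite !ge_min lexx orbT.
(* A point of B' minus a point of B, divided by eps, is within 2 rho / eps = r of u0; as r is at
   most [del], such a vector still points to the left. *)
pose eps := r / 2; pose rho := r * r / 4.
have r1' : r <= 1 by lra.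
have eps0 : 0 < eps by rewrite divr_gt0.
have rho0 : 0 < rho by rewrite divr_gt0// mulr_gt0.
have rho_r : rho <= r / 4 by rewrite /rho; nra.
pose p' : P := p + eps *: u0.
have BQ : ball p rho `<=` ball p r by apply: le_ball; lra.
have BQ' : ball p' rho `<=` ball p r.
  have key (x v y : R) : -1 <= v <= 1 -> `|x + eps * v - y| < rho -> `|x - y| < r.
    move=> v1; rewrite !ltr_norml /eps => h.
    have : - (r / 2) <= r / 2 * v <= r / 2 by apply/andP; split; nra.
    by move: h; set t := r / 2 * v; lra.
  by move=> w [w1 w2]; split; [apply: (key _ u0.1) => //=; lra|apply: (key _ u0.2) => //=; lra].
exists (ball p r), (ball p rho), (ball p' rho); split => //.
- exact: connected_ball.
- by split; [exact: ball_open|exists p; exact: ballxx|].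
- by split; [exact: ball_open|exists p'; exact: ballxx|].
move=> w w' wB w'B.
pose u : P := eps^-1 *: (w' - w).
have uE : w' - w = eps *: u by rewrite scalerA divff ?scale1r// gt_eqF.
have ub : ball u0 r u.
  have key (x y y' v : R) : `|x - y| < rho -> `|x + eps * v - y'| < rho -> `|v - eps^-1 * (y' - y)| < r.
    move=> h h'; have -> : v - eps^-1 * (y' - y) = eps^-1 * ((x + eps * v - y') - (x - y)).
      by field; rewrite gt_eqF.
    rewrite normrM gtr0_norm ?invr_gt0// mulrC ltr_pdivrMr//.
    apply: le_lt_trans (ler_normB _ _) _; rewrite /eps; rewrite /rho in h h'; lra.
  by move: wB w'B => [w1 w2] [w1' w2']; split; [exact: (key p.1)|exact: (key p.2)].
have u_neg : u.1 < 0.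
  have key (x : R) : `|- del - x| < r -> x < 0 by rewrite ltr_norml => /andP[+ _]; lra.
  by case: ub => ub1 _; exact: key ub1.
split.
  have e : w'.1 - w.1 = eps * u.1 := congr1 fst uE.
  by rewrite -subr_lt0 e pmulr_rlt0.
move=> n n0; rewrite -subr_gt0.
have cFn := C1_lift (annulus_C1_iter n cf) (lift_iter n lF).
have dfst (q : P) : is_diff q (fst : P -> R^o) (fst : P -> R^o) by exact: is_diff_fst.
(* The order of the images is read at one intermediate point, which lies in the ball over V, so that
   [twist_tilted_stays_right] applies there. *)
have [c /andP[c0 c1] e] := @MVT_plane R (iter n F) fst w w' dfst cFn.1.
rewrite [X in 0 < X]e.
set q := w + c *: (w' - w) in e *.
have qQ : ball p r q by apply: ball_segment; [rewrite !ltW|exact: BQ|exact: BQ'].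
have eT := tangentE q (w' - w) (annulus_C1_iter n cf) (lift_iter n lF).
rewrite -eT uE.
have eZ : (tangent_map (iter n f) (annulus_proj q) (eps *: u)).1 =
    eps * (tangent_map (iter n f) (annulus_proj q) u).1 :=
  congr1 fst (tangentZ (iter n f) (annulus_proj q) eps u).
rewrite eZ; apply: mulr_gt0; first exact: eps0.
have e1 : 0 < (tangent_map f (annulus_proj q) u).1.
  have e1 := tangentE q u cf lF.
  by rewrite e1; exact: rD.
apply: (twist_tilted_stays_right f_twist _ u_neg e1 n0) => k k0.
exact: (hV _ _ (rV _ qQ) k0).
Qed.

End TwistBoxes.

Section LeftwardIterate.
Context {R : realType}.
Local Notation A := (annulus R).
Local Notation P := (plane R).
Local Notation X := (borel_annulus R).
Variable f : A -> A.
Hypothesis f_twist : positive_twist_map f.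
Hypothesis f_leb : preserves_lebesgue f.
Variables (U : set A) (M : nat).
Hypothesis U_open : open U.
Hypothesis M_gt0 : (0 < M)%N.
Hypothesis U_periodic : iter M f @` U = U.
Hypothesis U_non_essential : ~ essential U.

(* A return of both squares at once forces both lifts to undergo the same
   translation, as [U] is not essential; but iterating exchanges their order. *)
Lemma exchanged_squares_return (F : P -> P) (Q B B' : set P) k : is_lift f F -> connected Q ->
  Q `<=` @annulus_proj R @^-1` U -> B `<=` Q -> B' `<=` Q ->
  (forall w w', B w -> B' w' -> w'.1 < w.1 /\ forall n, (0 < n)%N -> (iter n F w).1 < (iter n F w').1) ->
  (0 < k)%N -> forall u w u' w', B u -> B w -> B' u' -> B' w' ->
  iter (k * M) f (annulus_proj u) = annulus_proj w ->
  iter (k * M) f (annulus_proj u') = annulus_proj w' -> False.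
Proof.
move=> lF cQ QU BQ BQ' ex k0 u w u' w' Bu Bw Bu' Bw' eu eu'.
set L := (k * M)%N in eu eu'.
have L0 : (0 < L)%N by rewrite muln_gt0 k0.
have [cFL hFL] := lift_iter L lF.
have [j ej] : exists j, iter L F u = shift_by j w by apply/annulus_projP; rewrite hFL.
have [j' ej'] : exists j, iter L F u' = shift_by j w' by apply/annulus_projP; rewrite hFL.
have jj : j' = j.
  apply: contrapT => jj; apply: U_non_essential.
  (* The two pieces meet at the translate of w by j; one contains the translate of w' by j', the
     other its translate by j. *)
  apply: (@essential_of_connected R U ((iter L F @` Q) `|` (shift_by j @` Q)) (shift_by j w') (j' - j)) => //.
  - apply: connectedU.
    + by exists (shift_by j w); split; [exists u => //; exact: BQ|exists w => //; exact: BQ].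
    + by apply: connected_continuous_connected => //; apply: continuous_subspaceT.
    + by apply: connected_continuous_connected => //; apply: continuous_subspaceT; exact: continuous_shift_by.
  - move=> _ [[q Qq <-]|[q Qq <-]]; rewrite /= ?hFL ?annulus_proj_shift; last exact: QU.
    have : (iter L f @^-1` U) (annulus_proj q) by rewrite periodic_preimage//; exact: QU.
    by [].
  - by right; exists w' => //; exact: BQ'.
  - left; exists u'; first exact: BQ'.
    rewrite ej'; apply: plane_eqP => //=.
    by rewrite -addrA -intrD; congr (_ + _%:~R); rewrite addrC subrK.
  - by rewrite subr_eq0; exact/eqP.
(* w' is to the left of w, but u' goes to the right of u, and their images are translates of w' and
   w by the same integer. *)
have [h1 _] := ex w w' Bw Bw'.
have [_ /(_ L L0)] := ex u u' Bu Bu'.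
by rewrite ej ej' jj /= ltrD2r => h2; have := lt_trans h1 h2; rewrite ltxx.
Qed.

Hypothesis U_finite : (annulus_lebesgue U < +oo)%E.

Lemma leftward_iterate (V : set A) : open V -> V `<=` U -> V !=set0 ->
  exists z n, [/\ V z, (0 < n)%N & vertical_image f n z < 0].
Proof.
move=> oV VU V0; apply: contrapT => nV.
have hV z n : V z -> (0 < n)%N -> 0 <= vertical_image f n z.
  by move=> Vz n0; rewrite leNgt; apply/negP => h; apply: nV; exists z, n.
have [[g [_ _ [F lF _] _]] _ _] := f_twist.
have [Q [B [B' [cQ QV [oB B0 BQ] [oB' B0' BQ'] ex]]]] := exchanged_squares f_twist oV V0 lF hV.
have QU : Q `<=` @annulus_proj R @^-1` U by move=> q /QV; exact: VU.
have mU := borel_open U_open.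
have U_finite' : (borel_area U < +oo)%E := U_finite.
pose mu : {finite_measure set X -> \bar R} := mfrestr mU U_finite'.
pose E (D : set P) n : set X := iter (n * M) f @` (@annulus_proj R @` D).
have oE D n : open D -> open (E D n).
  by move=> oD; apply: twist_iter_open => //; exact: annulus_proj_open.
have EU D n : D `<=` Q -> E D n `<=` U.
  move=> DQ _ [_ [q Dq <-] <-].
  have : (iter (n * M) f @^-1` U) (annulus_proj q) by rewrite periodic_preimage//; exact/QU/DQ.
  by [].
have muE D n : D `<=` Q -> mu (E D n) = borel_area (E D n).
  by move=> DQ; rewrite -[LHS]/(borel_area (E D n `&` U)) setIidl//; exact: EU.
have area_const D n : open D -> D `<=` Q -> mu (E D n) = mu (E D 0%N).
  move=> oD DQ; rewrite !muE// -(twist_iter_area f_twist f_leb (n * M) (borel_open (oE D n oD))).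
  congr borel_area; apply/seteqP; split => z; rewrite /E /=.
    by move=> [w Dw /twist_iter_inj e]; exists w => //; exact: e.
  by move=> [w Dw <-]; exists w.
have pos D : open D -> D !=set0 -> D `<=` Q -> (0 < mu (E D 0%N))%E.
  move=> oD [q Dq] DQ; rewrite muE//; apply: borel_area_open_gt0; first exact: oE.
  by exists (annulus_proj q); exists (annulus_proj q) => //; exists q.
apply: (@disjoint_products_null _ X R mu (E B) (E B')).
- by move=> n; apply: borel_open; exact: oE.
- by move=> n; apply: borel_open; exact: oE.
- by move=> n; exact: area_const.
- by move=> n; exact: area_const.
(* If the products of indices n and k + n meet, injectivity of f^(nM) leaves a common return of both
   squares after kM steps. *)
- have key n k x : (0 < k)%N -> (E B n `*` E B' n) x -> (E B (k + n)%N `*` E B' (k + n)%N) x -> False.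
    move=> k0 [[_ [w Bw <-] e1] [_ [w' Bw' <-] e1']] [[_ [u Bu <-] e2] [_ [u' Bu' <-] e2']].
    apply: (exchanged_squares_return lF cQ QU BQ BQ' ex k0 Bu Bw Bu' Bw').
      by apply: (twist_iter_inj f_twist (n := n * M)); rewrite e1 -e2 mulnDl addnC iterD.
    by apply: (twist_iter_inj f_twist (n := n * M)); rewrite e1' -e2' mulnDl addnC iterD.
  move=> i j _ _ [x [xi xj]]; apply/eqP; case: (ltngtP i j) => // ij; exfalso.
    have := @key i (j - i)%N x; rewrite subnK ?(ltnW ij)// subn_gt0 => h.
    exact: h ij xi xj.
  have := @key j (i - j)%N x; rewrite subnK ?(ltnW ij)// subn_gt0 => h.
  exact: h ij xj xi.
- by split; exact: pos.
Qed.

End LeftwardIterate.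

Theorem theorem1p1 (R : realType) (f : annulus R -> annulus R)
    (f_twist : positive_twist_map f) (f_leb : preserves_lebesgue f)
    (U : set (annulus R)) (U_nonempty : U !=set0) (U_open : open U)
    (U_periodic : periodic_set f U) (U_non_essential : ~ essential U)
    (U_finite : (annulus_lebesgue U < +oo)%E) :
  let S := U `&` negative_torsion f in
  U `<=` closure S /\ annulus_borel S /\ (0 < annulus_lebesgue S)%E.
Proof.
move=> S; have [M M0 MU] := U_periodic.
have area_gt0 (V : set (annulus R)) : open V -> V `<=` U -> V !=set0 ->
    (0 < borel_area (V `&` negative_torsion f))%E.
  move=> oV VU V0.
  have [z [n [Vz n0 zn]]] := leftward_iterate f_twist f_leb U_open M0 MU U_non_essential U_finite oV VU V0.
  exact: (negative_torsion_area f_twist f_leb U_open M0 MU U_finite oV VU n0 Vz zn).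
split; last split; last exact: area_gt0.
(* A neighbourhood of z that misses S would contain an open part of U where negative torsion has
   zero area. *)
- move=> z Uz B; rewrite nbhsE => -[V [oV Vz] VB].
  have := area_gt0 (V `&` U) (openI oV U_open) (@subIsetr _ _ _) (ex_intro _ z (conj Vz Uz)).
  apply: contraPP => h; rewrite (_ : _ `&` _ = set0) ?measure0 ?ltxx//.
  by apply/seteqP; split => // w [[Vw Uw] nw]; apply: h; exists w; split; [split|exact: VB].
- exact: (measurableI _ _ (borel_open U_open) (negative_torsion_measurable f_twist)).
Qed.
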